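(* Consider the Langevin particle system described in the context, and let $\{G^{m,N}_t\}_{2\le m\le N}$ be its many-particle correlation functions. Assume that the initial law $\mu_\circ$ satisfies $\int_{\mathbb D^d}e^{|z|^\theta}\mu_\circ(dz)<\infty$ for some $\theta>0$. For all $m\ge2$, there exist $\kappa_m>0$ (only depending on $d,\beta,W,A,\theta,m$), $C_m>0$ (further depending on $\mu_\circ$), and $\ell_m>0$ (only depending on $m$), such that, given $\kappa\in[0,\kappa_m]$, we have for all integers $N\ge m$ and all $t\ge0$, $$\|G^{m,N}_t\|_{W^{-\ell_m,1}(\mathbb D^d)^{\otimes m}}\,\le\,C_mN^{1-m}.$$
   Context: Let $d\ge1$, $\beta>0$, $\kappa\ge0$, $\mathbb D^d:=\mathbb R^d\times\mathbb R^d$ (points $z=(x,v)$), let $W\in C^\infty_b(\mathbb R^d)$ (smooth, bounded with all derivatives bounded) be even, $W(x)=W(-x)$, and let $A(x)=\frac12a|x|^2$ for some $a>0$. For $N\ge1$, the Langevin dynamics is the system of SDEs, for $1\le i\le N$, $t\ge0$, $$dX^{i,N}_t=V^{i,N}_tdt,\qquad dV^{i,N}_t=-\tfrac\kappa N\sum_{j=1}^N\nabla W(X^{i,N}_t-X^{j,N}_t)\,dt-\tfrac\beta2V^{i,N}_tdt-\nabla A(X^{i,N}_t)\,dt+dB^i_t,$$ where $\{B^i\}_i$ are i.i.d. $d$-dimensional Brownian motions and the initial data $Z^{i,N}_\circ=(X^{i,N}_0,V^{i,N}_0)$, $1\le i\le N$, are i.i.d. with law $\mu_\circ\in\mathcal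 P(\mathbb D^d)$, independent of the Brownian motions. Let $F^N_t$ be the law of $(Z^{1,N}_t,\ldots,Z^{N,N}_t)$ on $(\mathbb D^d)^N$, where $Z^{i,N}_t=(X^{i,N}_t,V^{i,N}_t)$, and for $1\le m\le N$ let $F^{m,N}_t$ be its $m$-particle marginal (the law of the first $m$ particles). The $m$-particle correlation function is $$G^{m,N}_t(z_1,\ldots,z_m)=\sum_{\pi\vdash\{1,\ldots,m\}}(\sharp\pi-1)!(-1)^{\sharp\pi-1}\prod_{B\in\pi}F^{\sharp B,N}_t(z_B),$$ where $\pi$ runs over all partitions of $\{1,\ldots,m\}$, $\sharp\pi$ is the number of blocks, $\sharp B$ the cardinality of a block, and $z_B=(z_i)_{i\in B}$ (products understood as tensor products of measures). Negative Sobolev norms are dual norms: $\|h\|_{W^{-\ell,1}(\mathbb D^d)}=\sup\{\int h\phi:\|\phi\|_{W^{\ell,\infty}(\mathbb D^d)}=1\}$, and for $G$ on $(\mathbb D^d)^m$, $\|G\|_{W^{-\ell,1}(\mathbb D^d)^{\otimes m}}=\sup\{\int\phi_1\otimes\cdots\otimes\phi_m\,G:\|\phi_j\|_{W^{\ell,\infty}(\mathbb D^d)}=1,\ 1\le j\le m\}$. *)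

(* Defs.v *)
From HB Require Import structures.
From mathcomp Require Import all_boot all_order all_algebra.
From mathcomp Require Import all_classical all_reals all_analysis.

Set Implicit Arguments.
Unset Strict Implicit.
Unset Printing Implicit Defensive.

Import Order.TTheory GRing.Theory Num.Theory.
Import numFieldNormedType.Exports.

Local Open Scope classical_set_scope.
Local Open Scope ring_scope.

Definition rV_display : measure_display -> measure_display.
Proof. exact. Qed.

Section measurable_rV.
Context {R : realType} (n : nat).

Let coors : 'I_n -> 'rV[R]_n -> R := fun i x => x ord0 i.

Let rV_set0 : g_sigma_preimage coors set0.
Proof. exact: sigma_algebra0. Qed.

Let rV_setC A : g_sigma_preimage coors A -> g_sigma_preimage coors (~` A).
Proof. exact: sigma_algebraC. Qed.

Let rV_bigcup (F : (set 'rV[R]_n)^nat) :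
  (forall i, g_sigma_preimage coors (F i)) ->
  g_sigma_preimage coors (\bigcup_i (F i)).
Proof. exact: sigma_algebra_bigcup. Qed.

HB.instance Definition _ := @isMeasurable.Build
  (rV_display default_measure_display) 'rV[R]_n (g_sigma_preimage coors) rV_set0 rV_setC rV_bigcup.

Lemma measurable_coord (i : 'I_n) :
  measurable_fun [set: 'rV[R]_n] (fun x : 'rV[R]_n => x ord0 i).
Proof.
move=> _ Y mY; rewrite setTI; apply: sub_sigma_algebra => /=.
rewrite -bigcup_seq/=; exists i => /=; first by rewrite mem_index_enum.
by exists Y => //; rewrite setTI.
Qed.

Lemma measurable_fun_rV d (T : measurableType d) (f : T -> 'rV[R]_n) :
  (forall i, measurable_fun [set: T] (fun x => f x ord0 i)) ->
  measurable_fun [set: T] f.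
Proof.
move=> mf _ Y mY; rewrite setTI.
have : preimage_set_system [set: T] f (g_sigma_preimage coors) (f @^-1` Y).
  by exists Y => //; rewrite setTI.
rewrite -g_sigma_preimage_comp; apply: smallest_sub.
  exact: sigma_algebra_measurable.
rewrite -bigcup_seq /=; apply: bigcup_sub => i _ A [B mB <-].
exact: mf.
Qed.

End measurable_rV.

Lemma sigma_finite_product d1 d2 (T1 : measurableType d1)
    (T2 : measurableType d2) (R : realType)
    (m1 : {sigma_finite_measure set T1 -> \bar R})
    (m2 : {sigma_finite_measure set T2 -> \bar R}) :
  sigma_finite setT (m1 \x m2)%E.
Proof.
have /sigma_finiteP[F [TF ndF Foo]] := sigma_finiteT m1.
have /sigma_finiteP[G [TG ndG Goo]] := sigma_finiteT m2.
exists (fun n => F n `*` G n).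
  rewrite -setXTT TF TG predeqE => -[x y]; split.
    move=> [/= [n _ Fnx] [k _ Gky]]; exists (maxn n k) => //; split.
    - by move: x Fnx; exact/subsetPset/ndF/leq_maxl.
    - by move: y Gky; exact/subsetPset/ndG/leq_maxr.
  by move=> [n _ []/= ? ?]; split; exists n.
move=> k; have [? ?] := Foo k; have [? ?] := Goo k.
split; first exact: measurableX.
by rewrite product_measure1E// lte_mul_pinfty// ge0_fin_numE.
Qed.

Section lebesgue_rV.
Context {R : realType}.

Section step.
Variables (n : nat) (m : {sigma_finite_measure set 'rV[R]_n -> \bar R}).

Definition rV_cons (p : R * 'rV[R]_n) : 'rV[R]_n.+1 :=
  \row_i (if unlift ord0 i is Some j then p.2 ord0 j else p.1).

Definition rV_uncons (x : 'rV[R]_n.+1) : R * 'rV[R]_n :=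
  (x ord0 ord0, \row_j x ord0 (lift ord0 j)).

Lemma rV_consK : cancel rV_cons rV_uncons.
Proof.
move=> [r x]; rewrite /rV_uncons /rV_cons mxE unlift_none; congr pair.
by apply/rowP => j; rewrite !mxE liftK.
Qed.

Lemma measurable_rV_cons : measurable_fun [set: R * 'rV[R]_n] rV_cons.
Proof.
apply: measurable_fun_rV => i; rewrite /rV_cons.
under eq_fun do rewrite mxE.
case: (unlift ord0 i) => [j|]; last exact: measurable_fst.
apply: (measurableT_comp (measurable_coord j)); exact: measurable_snd.
Qed.

Lemma measurable_rV_uncons : measurable_fun [set: 'rV[R]_n.+1] rV_uncons.
Proof.
apply: measurable_fun_pair; first exact: measurable_coord.
apply: measurable_fun_rV => i; under eq_fun do rewrite mxE.
exact: measurable_coord.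
Qed.

Definition lebesgue_step : set 'rV[R]_n.+1 -> \bar R :=
  pushforward (@lebesgue_measure R \x m)%E rV_cons.

Let step0 : lebesgue_step set0 = 0%E.
Proof. by rewrite /lebesgue_step /pushforward preimage_set0 measure0. Qed.

Let step_ge0 A : (0 <= lebesgue_step A)%E.
Proof. exact: (@measure_ge0 _ _ _ (@lebesgue_measure R \x m)%E). Qed.

Let step_sigma_additive : semi_sigma_additive lebesgue_step.
Proof.
pose mu' := measure_function_pushforward__canonical__measure_function_Measure
  (@lebesgue_measure R \x m)%E measurable_rV_cons.
exact: (@measure_semi_sigma_additive _ _ _ mu').
Qed.

HB.instance Definition _ := isMeasure.Build _ _ _ lebesgue_step
  step0 step_ge0 step_sigma_additive.

Let step_sigma_finite : sigma_finite setT lebesgue_step.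
Proof.
have [F FT mF] := sigma_finite_product (@lebesgue_measure R) m.
exists (fun i => rV_uncons @^-1` F i).
  by rewrite -preimage_bigcup -FT preimage_setT.
move=> i; have [mFi Fi] := mF i; split.
  rewrite -[X in measurable X]setTI; exact: measurable_rV_uncons.
rewrite /lebesgue_step /pushforward -comp_preimage.
rewrite (_ : rV_uncons \o rV_cons = id)//.
by apply/funext => x; exact: rV_consK.
Qed.

HB.instance Definition _ := Measure_isSigmaFinite.Build _ _ _ lebesgue_step
  step_sigma_finite.

End step.

Fixpoint lebesgue_rV (n : nat) :
    {sigma_finite_measure set 'rV[R]_n -> \bar R} :=
  if n is k.+1 then lebesgue_step (lebesgue_rV k) else dirac (0 : 'rV[R]_0).

End lebesgue_rV.

Notation phase R d := ('rV[R]_d * 'rV[R]_d)%type.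

Definition enorm (R : realType) (d : nat) (z : phase R d) : R :=
  Num.sqrt (\sum_i z.1 ord0 i ^+ 2 + \sum_i z.2 ord0 i ^+ 2).

Definition lebesgue_phase (R : realType) (d : nat) :
    set (phase R d) -> \bar R :=
  (lebesgue_rV d \x lebesgue_rV d)%E.

HB.instance Definition _ (R : realType) (d : nat) :=
  Measure.on (@lebesgue_phase R d).
HB.instance Definition _ (R : realType) (d : nat) :=
  Measure_isSigmaFinite.Build _ _ _ (@lebesgue_phase R d)
    (sigma_finite_product (lebesgue_rV d) (lebesgue_rV d)).

Definition rV_dir (R : realType) (d : nat) (i : 'I_d) : 'rV[R]_d :=
  delta_mx ord0 i.

Definition phase_dir (R : realType) (d : nat) (i : 'I_d + 'I_d) : phase R d :=
  match i with
  | inl j => (rV_dir R j, 0)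
  | inr j => (0, rV_dir R j)
  end.

Section partials.
Context {R : realType} {V : normedModType R} {I : Type} (e : I -> V).

(* Iterated partial derivatives are indexed by words s in the coordinate
   directions; for smooth f only the multi-index underlying s matters. *)
Definition partials (s : seq I) (f : V -> R) : V -> R :=
  foldr (fun i g x => 'D_(e i) g x) f s.

Definition smooth (f : V -> R) : Prop :=
  forall (s : seq I) (x : V), differentiable (partials s f) x.

Definition smooth_bounded (f : V -> R) : Prop :=
  smooth f /\ forall s : seq I, exists M : R, forall x, `|partials s f x| <= M.

Definition test_function (f : V -> R) : Prop :=
  smooth f /\ compact (closure [set x | f x != 0]).

End partials.

Definition grad (R : realType) (d : nat) (f : 'rV[R]_d -> R) (x : 'rV[R]_d) :
    'rV[R]_d :=
  \row_i 'D_(rV_dir R i) f x.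

Section sobolev.
Context {R : realType} {d : nat}.
Local Notation mu := (@lebesgue_phase R d).

Definition weak_derivative (s : seq ('I_d + 'I_d)) (phi g : phase R d -> R) :=
  [/\ measurable_fun setT g,
      forall K : set (phase R d), compact K -> mu.-integrable K (EFin \o g) &
      forall psi, test_function (@phase_dir R d) psi ->
        \int[mu]_z (phi z * partials (@phase_dir R d) s psi z) =
        (-1) ^+ size s * \int[mu]_z (g z * psi z)].

(* L^oo norm of the s-th weak derivative, +oo if there is none: weak
   derivatives are a.e. unique, so the infimum ranges over at most one value. *)
Definition weak_derivative_norm (s : seq ('I_d + 'I_d)) (phi : phase R d -> R)
    : \bar R :=
  ereal_inf [set ('N[mu]_+oo [EFin \o g])%E | g in weak_derivative s phi].

Definition sobolev_norm (l : nat) (phi : phase R d -> R) : \bar R :=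
  ereal_sup [set weak_derivative_norm s phi | s in [set s | (size s <= l)%N]].

End sobolev.

(* The list of pairs (c, mu) stands for the finite signed measure \sum c mu. *)
Definition signed_measure (dsp : measure_display) (T : measurableType dsp)
  (R : realType) := seq (R * probability T R).

Definition signed_integral (dsp : measure_display) (T : measurableType dsp)
    (R : realType) (nu : signed_measure T R) (f : T -> R) : R :=
  \sum_(p <- nu) p.1 * \int[p.2]_x f x.

(* Elements of W^{l,oo}, l >= 1, are a.e. equal to a unique continuous
   function, which is the one to be integrated against a measure that may have
   no density. *)
Definition neg_sobolev_norm (R : realType) (d m l : nat)
    (nu : signed_measure (m.-tuple (phase R d)) R) : \bar R :=
  ereal_sup
    [set (signed_integral nu (fun z => \prod_(j < m) phi j (tnth z j)))%:E |
      phi in [set phi : 'I_m -> phase R d -> R |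
        forall j, continuous (phi j) /\ sobolev_norm l (phi j) = 1%E]].

Lemma measurable_nth (dsp : measure_display) (T : measurableType dsp) (n : nat)
    (x0 : T) (i : nat) :
  measurable_fun [set: n.-tuple T] (fun z : n.-tuple T => nth x0 z i).
Proof.
have [lt_in|le_ni] := ltnP i n.
  rewrite (_ : (fun _ => _) = (@tnth n T)^~ (Ordinal lt_in)).
    exact: measurable_tnth.
  by apply/funext => z; rewrite (tnth_nth x0).
rewrite (_ : (fun _ => _) = cst x0); first exact: measurable_cst.
by apply/funext => z; rewrite nth_default ?size_tuple.
Qed.

Section first_particles.
Context {R : realType} {d N : nat} (m : nat).

(* The values beyond index N are junk; only m <= N is used. *)
Definition first_particles (z : N.-tuple (phase R d)) : m.-tuple (phase R d) :=
  [tuple nth 0 z i | i < m].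

Lemma measurable_first_particles : measurable_fun setT first_particles.
Proof.
apply/measurable_fun_tnthP => i.
apply: (eq_measurable_fun (fun z : N.-tuple (phase R d) => nth 0 z i)).
  by move=> z _ /=; rewrite tnth_mktuple.
exact: measurable_nth.
Qed.

HB.instance Definition _ := isMeasurableFun.Build _ _ _ _
  first_particles measurable_first_particles.

Definition marginal (F : probability (N.-tuple (phase R d)) R) :
    probability (m.-tuple (phase R d)) R :=
  distribution F first_particles.

End first_particles.

Section tensor.
Context {R : realType} {d m : nat}.

(* For yz = (y, z), z with its subfamily z_B, in increasing order of the
   indices, replaced by y. *)
Definition set_block (B : {set 'I_m})
    (yz : #|B|.-tuple (phase R d) * m.-tuple (phase R d)) :
    m.-tuple (phase R d) :=
  [tuple if i \in B then nth 0 yz.1 (index i (enum B)) else tnth yz.2 i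
    | i < m].

Lemma measurable_set_block (B : {set 'I_m}) :
  measurable_fun setT (@set_block B).
Proof.
apply/measurable_fun_tnthP => i.
apply: (eq_measurable_fun (fun yz :
    #|B|.-tuple (phase R d) * m.-tuple (phase R d) => if i \in B then
    nth 0 yz.1 (index i (enum B)) else tnth yz.2 i : phase R d)).
  by move=> yz _ /=; rewrite tnth_mktuple.
case: (i \in B).
  apply: (@measurableT_comp _ _ _ _ _ _
    (fun y : #|B|.-tuple (phase R d) => nth 0 y (index i (enum B)))).
    exact: measurable_nth.
  exact: measurable_fst.
apply: (@measurableT_comp _ _ _ _ _ _
  (fun z : m.-tuple (phase R d) => tnth z i)).
  exact: measurable_tnth.
exact: measurable_snd.
Qed.

HB.instance Definition _ (B : {set 'I_m}) := isMeasurableFun.Build _ _ _ _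
  (@set_block B) (@measurable_set_block B).

Variable F : forall k : nat, probability (k.-tuple (phase R d)) R.

(* The tensor product of the F^{#B}(z_B), for B in a list of disjoint blocks;
   the coordinates outside the blocks are set to 0. *)
Fixpoint tensor (bs : seq {set 'I_m}) : probability (m.-tuple (phase R d)) R :=
  if bs is B :: bs' then distribution (F #|B| \x tensor bs')%E (@set_block B)
  else dirac ([tuple 0 | _ < m] : m.-tuple (phase R d)).

End tensor.

Definition correlation (R : realType) (d N m : nat)
    (F : probability (N.-tuple (phase R d)) R) :
    signed_measure (m.-tuple (phase R d)) R :=
  [seq ((#|Q|.-1)`!%:R * (-1) ^+ #|Q|.-1,
        tensor (fun k => marginal k F) (enum Q))
    | Q : {set {set 'I_m}} <- enum {set {set 'I_m}}
    & finset.partition Q [set: 'I_m]%SET].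

Section independence.
Context {dsp : measure_display} {Omega : measurableType dsp} {R : realType}.
Variable P : probability Omega R.

Definition generated_sigma (I : Type) (dT : measure_display)
    (T : measurableType dT) (D : set I) (X : I -> Omega -> T) :
    set (set Omega) :=
  <<s \bigcup_(i in D) preimage_set_system setT (X i) measurable >>.

Definition mutually_independent (J : finType) (F : J -> set (set Omega)) :=
  forall (S : {set J}) (E : J -> set Omega),
    (forall j, j \in S -> F j (E j)) ->
    P (\bigcap_(j in [set` S]) E j) = (\prod_(j in S) P (E j))%E.

Definition independent (F G : set (set Omega)) :=
  forall A B, F A -> G B -> P (A `&` B) = (P A * P B)%E.

Definition brownian1 (B : R -> Omega -> R) : Prop :=
  [/\ {ae P, forall w, B 0 w = 0},
      {ae P, forall w, {within `[0, +oo[, continuous (B ^~ w)}},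
      forall s t A, 0 <= s -> s < t -> measurable A ->
        P ((fun w => B t w - B s w) @^-1` A) =
        normal_prob 0 (Num.sqrt (t - s)) A &
      forall s t, 0 <= s -> s < t ->
        independent (generated_sigma `[0, s] B)
          (generated_sigma [set: unit] (fun _ w => B t w - B s w))].

Definition brownian (d : nat) (B : R -> Omega -> 'rV[R]_d) : Prop :=
  (forall k, brownian1 (fun t w => B t w ord0 k)) /\
  mutually_independent
    (fun k => generated_sigma `[0, +oo[ (fun t w => B t w ord0 k)).

End independence.

Definition quadratic_potential (R : realType) (d : nat) (a : R)
    (x : 'rV[R]_d) : R :=
  2^-1 * a * \sum_i x ord0 i ^+ 2.

Section langevin.
Context {R : realType} {d : nat} {dsp : measure_display}
  {Omega : measurableType dsp}.
Variables (P : probability Omega R) (N : nat).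
Variables (beta kappa : R) (W A : 'rV[R]_d -> R).
Variable mu0 : probability (phase R d) R.
Variable B : 'I_N -> R -> {mfun Omega >-> 'rV[R]_d}.
Variable Z : 'I_N -> R -> {mfun Omega >-> phase R d}.

Definition drift (i : 'I_N) (t : R) (w : Omega) : 'rV[R]_d :=
  - ((kappa / N%:R) *: \sum_(j < N) grad W ((Z i t w).1 - (Z j t w).1))
  - (beta / 2) *: (Z i t w).2 - grad A ((Z i t w).1).

(* Since the noise is additive, the integrated system is a pathwise integral
   equation, written coordinatewise. *)
Record langevin : Prop := Langevin {
  langevin_noise : forall i, brownian P (B i : R -> Omega -> 'rV[R]_d);
  langevin_noise_indep : mutually_independent P
    (fun i => generated_sigma `[0, +oo[ (B i : R -> Omega -> 'rV[R]_d));
  langevin_init_law : forall i E, measurable E ->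
    distribution P (Z i 0) E = mu0 E;
  langevin_init_indep : mutually_independent P
    (fun i => generated_sigma [set: unit] (fun _ => Z i 0 : Omega -> phase R d));
  langevin_init_noise_indep : independent P
    (generated_sigma [set: 'I_N] (fun i => Z i 0 : Omega -> phase R d))
    (generated_sigma [set it : 'I_N * R | 0 <= it.2]
      (fun it => B it.1 it.2 : Omega -> 'rV[R]_d));
  langevin_continuous : {ae P, forall w, forall i,
    {within `[0, +oo[, continuous (fun t => Z i t w)}};
  langevin_position : {ae P, forall w, forall i t k, 0 <= t ->
    (Z i t w).1 ord0 k = (Z i 0 w).1 ord0 k +
      \int[@lebesgue_measure R]_(s in `[0, t]) ((Z i s w).2 ord0 k)};
  langevin_velocity : {ae P, forall w, forall i t k, 0 <= t ->
    (Z i t w).2 ord0 k = (Z i 0 w).2 ord0 k +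
      \int[@lebesgue_measure R]_(s in `[0, t]) (drift i s w ord0 k) +
      B i t w ord0 k}
}.

Definition configuration (t : R) (w : Omega) : N.-tuple (phase R d) :=
  [tuple Z i t w | i < N].

Lemma measurable_configuration t : measurable_fun setT (configuration t).
Proof.
apply/measurable_fun_tnthP => i.
apply: (eq_measurable_fun (Z i t)); last exact: measurable_funPT.
by move=> w _ /=; rewrite tnth_mktuple.
Qed.

HB.instance Definition _ t := isMeasurableFun.Build _ _ _ _
  (configuration t) (measurable_configuration t).

Definition law (t : R) : probability (N.-tuple (phase R d)) R :=
  distribution P (configuration t).

End langevin.

(* Main.v *)
(* Integrated against phi_1 (x) ... (x) phi_m, the correlation function is the
   joint cumulant of the variables phi_j(Z^j_t).  Replace the system by its
   explicit Euler scheme driven by quantized inputs (initial datum and Brownian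
   increments): the inputs of distinct particles are i.i.d. with values in a
   finite type.  Since grad W is bounded together with its derivatives, iterated
   differences of the trajectory of particle i with respect to the inputs of k
   other particles are O(N^-k), deterministically and uniformly in time and in
   the step: for small kappa, the friction and the confinement absorb the
   interaction in a quadratic Lyapunov function.  Revealing the inputs one
   particle at a time and using the law of total cumulance, such difference
   bounds turn into the bound O(N^(1-m)) on the cumulant of order m, which passes
   to the limit of vanishing step and mesh.  Only finite differences of the test
   functions enter, and those of order at most l are controlled by the W^{l,oo}
   norm. *)

Require Import Defs.
From HB Require Import structures.
From mathcomp Require Import all_boot all_order all_algebra.
From mathcomp Require Import ring lra.

Set Implicit Arguments.
Unset Strict Implicit.
Unset Printing Implicit Defensive.

Import Order.TTheory GRing.Theory Num.Theory.

Local Open Scope ring_scope.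

(** * Iterated differences *)

(** A particle reacts at order one to its own input and at order 1/N to any other, so a difference
    that hits an observed label gains nothing. [weight] and [set_weight] keep account of this loss,
    and the exponent survives it for a counting reason: in the sum over revealed particles, about N
    generic ones contribute N^-m each, while the at most m observed ones contribute N^(1-m) each.
    The same count closes the induction on the dynamics: the interaction with a particle whose own
    input is perturbed loses one power of N, but there are only as many such particles as
    differences, each with prefactor kappa/N. The threshold on kappa only has to control the
    differences of top order, which enter linearly; lower orders form a source term that enlarges
    the constant, so one threshold serves all orders up to m. Finite-valued inputs turn conditional
    expectations into finite sums; the price is that every constant must be independent of the set
    of values, the step and the number of steps. *)

Section differences.
Context {T A : Type} (tau : A -> T -> T) {V : zmodType}.
Implicit Types (F G : T -> V) (s : seq A).

Definition step_diff a F : T -> V := fun w => F (tau a w) - F w.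
Definition diffs s F : T -> V := foldl (fun G a => step_diff a G) F s.

Lemma eq_diffs s F G : F =1 G -> diffs s F =1 diffs s G.
Proof.
elim: s F G => [|a s IH] F G eFG //= w.
by apply: IH => v; rewrite /step_diff !eFG.
Qed.

Lemma diffsD s F G w :
  diffs s (fun v => F v + G v) w = diffs s F w + diffs s G w.
Proof.
elim: s F G => [|a s IH] F G //=; rewrite -IH.
by apply: eq_diffs => v; rewrite /step_diff opprD addrACA.
Qed.

Lemma diffsN s F w : diffs s (fun v => - F v) w = - diffs s F w.
Proof.
elim: s F => [|a s IH] F //=; rewrite -IH.
by apply: eq_diffs => v; rewrite /step_diff opprB opprK addrC.
Qed.

Lemma diffsB s F G w :
  diffs s (fun v => F v - G v) w = diffs s F w - diffs s G w.
Proof. by rewrite diffsD diffsN. Qed.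

Lemma diffs_sum (I : Type) (r : seq I) (F : I -> T -> V) s w :
  diffs s (fun v => \sum_(i <- r) F i v) w = \sum_(i <- r) diffs s (F i) w.
Proof.
elim: r => [|i r IH].
  rewrite big_nil (@eq_diffs _ _ (fun=> 0)) => [|v]; last by rewrite big_nil.
  by elim: s => //= a s IHs; rewrite -[RHS]IHs; apply: eq_diffs => v; rewrite /step_diff subrr.
by rewrite big_cons -IH -diffsD; apply: eq_diffs => v; rewrite big_cons.
Qed.

Lemma diffs_cst s (c : V) w : (0 < size s)%N -> diffs s (fun=> c) w = 0.
Proof.
case: s => //= a s _; rewrite (@eq_diffs _ _ (fun=> 0)) => [|v]; last by rewrite /step_diff subrr.
by elim: s => //= b s IHs; rewrite -[RHS]IHs; apply: eq_diffs => v; rewrite /step_diff subrr.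
Qed.

Lemma diffs_cat s1 s2 F : diffs (s1 ++ s2) F = diffs s2 (diffs s1 F).
Proof. by rewrite /diffs foldl_cat. Qed.

End differences.

Notation delta := (diffs (fun h x => x + h)).

Lemma delta_shift (V W : zmodType) (H : seq V) (f : V -> W) (x k : V) :
  delta H (fun z => f (z + k)) x = delta H f (x + k).
Proof.
elim: H f => [|h H IH] f //=; rewrite -IH; apply: eq_diffs => z.
by rewrite /step_diff addrAC.
Qed.

(** * A discrete chain rule of arbitrary order *)

Section composition.
Context {R : realFieldType} {V : normedZmodType R} {T : Type} {A : eqType}.
Variable tau : A -> T -> T.
Variable eps : R.
Hypotheses (eps0 : 0 <= eps) (eps1 : eps <= 1).
Local Notation Ds := (diffs tau).
Implicit Types (g : T -> V -> R) (k y : T -> V) (s : seq A).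

(** A substitute for the C^l norm that uses finite differences only, so that it makes sense for
    W^{l,oo} functions, whose derivatives are only weak. *)
Definition fd_bound l (M : R) (f : V -> R) := forall H x,
  (size H <= l)%N -> `|delta H f x| <= M * \prod_(h <- H) `|h|.

(** The intermediate functions of a discrete chain rule depend on the configuration [w] as well as
    on the point [x]. This class is stable under that rule: each input difference gains [eps], each
    spatial one gains its norm. *)
Definition cls l (s : seq A) (c : R) g := forall s' H w x,
  subseq s' s -> (size s' + size H <= l)%N ->
  `|delta H (fun x => Ds s' (g^~ x) w) x| <=
    c * eps ^+ size s' * \prod_(h <- H) `|h|.

Definition small (s : seq A) (c : R) k := forall s' w,
  subseq s' s -> `|Ds s' k w| <= c * eps ^+ size s'.

Definition increment g k : T -> V -> R := fun w x => g w (x + k w) - g w x.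

Let prod_ge0 (H : seq V) : 0 <= \prod_(h <- H) `|h|.
Proof. by apply: prodr_ge0 => h _. Qed.

Lemma clsW l l' s s' c c' g : (l' <= l)%N -> subseq s' s -> c <= c' ->
  cls l s c g -> cls l' s' c' g.
Proof.
move=> ll ss cc gc t H w x ts sz.
apply: (le_trans (gc _ _ _ _ (subseq_trans ts ss) (leq_trans sz ll))).
by apply: ler_wpM2r => //; apply: ler_wpM2r => //; exact: exprn_ge0.
Qed.

Lemma clsD l s c c' g g' : cls l s c g -> cls l s c' g' ->
  cls l s (c + c') (fun w x => g w x + g' w x).
Proof.
move=> gc gc' t H w x ts sz.
under eq_diffs do rewrite diffsD.
rewrite diffsD (le_trans (ler_normD _ _))// !mulrDl lerD//; [exact: gc|exact: gc'].
Qed.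

Lemma cls_diff l a s c g : cls l.+1 (a :: s) c g ->
  cls l s (c * eps) (fun w x => step_diff tau a (g^~ x) w).
Proof.
move=> gc t H w x ts sz.
have := gc (a :: t) H w x; rewrite /= eqxx => /(_ ts sz).
by rewrite exprS mulrA.
Qed.

Lemma small_diff a s c k : small (a :: s) c k -> small s (c * eps) (step_diff tau a k).
Proof.
move=> kc t w ts; have := kc (a :: t) w; rewrite /= eqxx => /(_ ts).
by rewrite exprS mulrA.
Qed.

Lemma smallW s s' c c' k : subseq s' s -> c <= c' -> small s c k -> small s' c' k.
Proof.
move=> ss cc kc t w ts; rewrite (le_trans (kc _ _ (subseq_trans ts ss)))//.
by rewrite ler_wpM2r// exprn_ge0.
Qed.

(** Discrete product rule: the first term differences [g]; the second differences [k], with [g]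
    moved along [a] and translated by [k]. *)
Lemma diff_increment a g k x w :
  step_diff tau a ((increment g k)^~ x) w =
  increment (fun w x => step_diff tau a (g^~ x) w) k w x +
  increment (fun w x => g (tau a w) (x + k w)) (step_diff tau a k) w x.
Proof.
rewrite /increment /step_diff /= -[x + _ + k w]addrA subrK; ring.
Qed.

Variable comm : rel A.
Hypothesis tauC : forall a b w, comm a b -> tau a (tau b w) = tau b (tau a w).

(** The relation [comm] will be distinctness of coordinates: two moves of the same coordinate
    overwrite each other and do not commute in general. *)
Lemma diffs_tau (W : zmodType) a s (F : T -> W) w : all (comm a) s ->
  Ds s (F \o tau a) w = Ds s F (tau a w).
Proof.
elim: s F w => [|b s IH] F w //= /andP[ab as'].
rewrite -IH//; apply: eq_diffs => v; rewrite /step_diff /=.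
by rewrite tauC.
Qed.

Lemma cls_tau l a s c g : all (comm a) s -> cls l s c g ->
  cls l s c (fun w => g (tau a w)).
Proof.
move=> sa gc t H w x ts sz.
have ta : all (comm a) t by apply/allP => b /(mem_subseq ts); exact: (allP sa).
rewrite (@eq_diffs _ _ _ _ _ _ (fun x => Ds t (g^~ x) (tau a w))); first exact: gc.
by move=> v; rewrite -(@diffs_tau _ a t (g^~ v)).
Qed.

Fixpoint increment_cst (K : R) n : R :=
  if n is n'.+1 then
    let C := increment_cst K n' in C + C * (1 + C * K)
  else 1.

Lemma increment_cst_ge0 K n : 0 <= K -> 0 <= increment_cst K n.
Proof.
move=> K0; elim: n => //= n IH.
by rewrite addr_ge0// mulr_ge0// addr_ge0// mulr_ge0.
Qed.

Lemma increment_cst_le K n : 0 <= K -> increment_cst K n <= increment_cst K n.+1.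
Proof.
move=> K0 /=; have C0 := increment_cst_ge0 n K0.
by rewrite lerDl mulr_ge0// addr_ge0// mulr_ge0.
Qed.

(** An increment is one more spatial difference, hence the drop from [l.+1] to [l]. By
    [diff_increment] each input difference hits either [g], which stays in the class, or [k], which
    stays small; [increment_cst] is the recursion that this alternative produces. *)
Lemma cls_increment K l s c kap g k : 0 <= K -> 0 <= c -> 0 <= kap -> kap <= K ->
  pairwise comm s -> cls l.+1 s c g -> small s kap k ->
  cls l s (increment_cst K (size s) * c * kap) (increment g k).
Proof.
move=> K0; elim: s l c kap g k => [|a s IH] l c kap g k c0 kap0 kapK.
  move=> _ gc kk t H w x; rewrite subseq0 => /eqP-> /=; rewrite add0n mul1r mulr1 => sz.
  have -> : delta H (increment g k w) x = delta (k w :: H) (g w) x by [].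
  have /= := gc [::] (k w :: H) w x isT; rewrite add0n => /(_ sz).
  rewrite big_cons mulr1 mulrA => /le_trans; apply.
  apply: ler_wpM2r => //; apply: ler_wpM2l => //.
  by have := kk [::] w isT; rewrite expr0 mulr1.
rewrite /= -/(pairwise comm s) => /andP[sa sp] gc kk t H w x.
set C := increment_cst K (size s).
have C0 : 0 <= C by exact: increment_cst_ge0.
have gcs : cls l.+1 s c g by apply: clsW gc => //; exact: subseq_cons.
have kks : small s kap k by apply: smallW kk => //; exact: subseq_cons.
case: t => [|b t] ts sz.
  have := IH l c kap g k c0 kap0 kapK sp gcs kks.
  move=> /(_ [::] H w x (sub0seq _) sz) /le_trans; apply.
  do 4 apply: ler_wpM2r => //.
  exact: increment_cst_le.
move: ts => /=; case: ifPn => [/eqP ->|_] ts; last first.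
  have := IH l c kap g k c0 kap0 kapK sp gcs kks.
  move=> /(_ (b :: t) H w x ts sz) /le_trans; apply.
  do 2 apply: ler_wpM2r => //; first exact: exprn_ge0.
  do 2 apply: ler_wpM2r => //.
  exact: increment_cst_le.
case: l gc gcs sz => // l gc gcs; rewrite addSn ltnS => sz.
have h1 := cls_diff gc.
(* The translate of the moved [g] is the moved [g] plus an increment, to which the induction
   hypothesis applies. *)
have h2 : cls l.+1 s (c + C * c * kap) (fun w x => g (tau a w) (x + k w)).
  have h3 : cls l.+1 s (c + C * c * kap) (fun w x => g (tau a w) x + increment (fun w => g (tau a w)) k w x).
    apply: clsD; first by apply: cls_tau => //; exact: clsW gcs.
    by apply: IH => //; apply: cls_tau.
  move=> t' H' w' x' ts' sz'; have := h3 t' H' w' x' ts' sz'.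
  congr (`|_| <= _); apply: eq_diffs => v; apply: eq_diffs => v'.
  by rewrite /increment addrC subrK.
rewrite (@eq_diffs _ _ _ _ _ _ (fun x => Ds t (fun w => increment (fun w x => step_diff tau a (g^~ x) w) k w x) w + Ds t (fun w => increment (fun w x => g (tau a w) (x + k w)) (step_diff tau a k) w x) w)); last first.
  by move=> v; rewrite -diffsD; apply: eq_diffs => v'; rewrite diff_increment.
rewrite diffsD (le_trans (ler_normD _ _))//.
have ke1 : kap * eps <= kap by rewrite ler_piMr.
have ce0 : 0 <= c * eps by exact: mulr_ge0.
have h4 := IH l _ kap _ k ce0 kap0 kapK sp h1 kks t H w x ts sz.
have h5 := IH l _ (kap * eps) _ (step_diff tau a k) _ _ _ sp h2 (small_diff kk) t H w x ts sz.
have {}h5 := h5 (addr_ge0 c0 (mulr_ge0 (mulr_ge0 C0 c0) kap0)) (mulr_ge0 kap0 eps0) (le_trans ke1 kapK).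
apply: (le_trans (lerD h4 h5)).
rewrite -mulrDl; apply: ler_wpM2r => //.
rewrite -/C exprS.
have -> : C * (c * eps) * kap * eps ^+ size t + C * (c + C * c * kap) * (kap * eps) * eps ^+ size t
  = (C + C * (1 + C * kap)) * (c * kap * (eps * eps ^+ size t)) by ring.
rewrite -2!(mulrA (C + _)) ; apply: ler_wpM2r.
  by rewrite !mulr_ge0// exprn_ge0.
by rewrite lerD2l ler_wpM2l// lerD2l ler_wpM2l.
Qed.

Lemma small_of_steps s a K y :
  (forall s' w, subseq s' (a :: s) -> s' != [::] -> `|Ds s' y w| <= K * eps ^+ size s') ->
  small s (K * eps) (step_diff tau a y).
Proof.
move=> h t w ts; have := h (a :: t) w; rewrite /= eqxx => /(_ ts isT).
by rewrite exprS mulrA.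
Qed.

Fixpoint comp_cst (K : R) n : R :=
  if n is n'.+1 then
    let C := comp_cst K n' in C + increment_cst K n' * C * K
  else 1.

Lemma comp_cst_ge0 K n : 0 <= K -> 0 <= comp_cst K n.
Proof.
move=> K0; elim: n => //= n IH; rewrite addr_ge0// mulr_ge0// mulr_ge0//.
exact: increment_cst_ge0.
Qed.

(** Only the differences of [y] are small, not [y] itself. One step of f(x + y w) is an increment by
    [step_diff tau a y], so [cls_increment] and induction on [s] replace the combinatorial chain
    rule. *)
Lemma cls_comp K l s (M : R) (f : V -> R) y : 0 <= K -> 0 <= M -> pairwise comm s ->
  fd_bound l M f ->
  (forall s' w, subseq s' s -> s' != [::] -> `|Ds s' y w| <= K * eps ^+ size s') ->
  cls l s (comp_cst K (size s) * M) (fun w x => f (x + y w)).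
Proof.
move=> K0 M0 sp fM; elim: s sp => [|a s IH] sp hy t H w x.
  rewrite subseq0 => /eqP-> /=; rewrite add0n mul1r mulr1 => sz.
  by rewrite delta_shift; exact: fM.
move: sp; rewrite /= => /andP[sa sp].
have hys s' w' : subseq s' s -> s' != [::] -> `|Ds s' y w'| <= K * eps ^+ size s'.
  by move=> ss; apply: hy; exact: (subseq_trans ss (subseq_cons _ _)).
have {}IH := IH sp hys.
set C := comp_cst K (size s) in IH *.
have C0 : 0 <= C by exact: comp_cst_ge0.
have le1 : C <= C + increment_cst K (size s) * C * K.
  by rewrite lerDl !mulr_ge0// increment_cst_ge0.
have skip : forall t, subseq t s -> (size t + size H <= l)%N ->
  `|delta H (fun x => Ds t (fun w => f (x + y w)) w) x| <=
  (C + increment_cst K (size s) * C * K) * M * eps ^+ size t * \prod_(h <- H) `|h|.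
  move=> t' ts sz; apply: (le_trans (IH _ _ _ _ ts sz)).
  by do 2 (apply: ler_wpM2r; rewrite ?exprn_ge0//); apply: ler_wpM2r.
case: t => [|b t]; first by move=> _; apply: skip; exact: sub0seq.
move=> /=; case: ifPn => [/eqP ->|_] ts sz; last exact: (skip (b :: t) ts sz).
case: l fM IH skip sz => // l fM IH skip sz.
have ke : K * eps <= K by rewrite ler_piMr.
have := @cls_increment K l s (C * M) (K * eps) (fun w x => f (x + y w)) (step_diff tau a y)
  K0 (mulr_ge0 C0 M0) (mulr_ge0 K0 eps0) ke sp IH (small_of_steps hy).
move=> /(_ t H w x ts sz) h.
rewrite (@eq_diffs _ _ _ _ _ _ (fun x => Ds t (fun w => increment (fun w x => f (x + y w)) (step_diff tau a y) w x) w)); last first.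
  move=> v; apply: eq_diffs => w'; rewrite /step_diff /increment.
  by rewrite -[v + _ + y w']addrA subrK.
apply: (le_trans h); apply: ler_wpM2r => //.
have -> : increment_cst K (size s) * (C * M) * (K * eps) * eps ^+ size t =
   increment_cst K (size s) * C * K * M * eps ^+ (size t).+1 by rewrite exprS; ring.
by do 2 (apply: ler_wpM2r; rewrite ?exprn_ge0//); rewrite lerDr.
Qed.

Lemma diffs_comp_le K l s (M : R) (f : V -> R) y w : 0 <= K -> 0 <= M ->
  pairwise comm s -> fd_bound l M f -> (size s <= l)%N ->
  (forall s' w, subseq s' s -> s' != [::] -> `|Ds s' y w| <= K * eps ^+ size s') ->
  `|Ds s (f \o y) w| <= comp_cst K (size s) * M * eps ^+ size s.
Proof.
move=> K0 M0 sp fM sl hy.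
have := @cls_comp K l s M f y K0 M0 sp fM hy s [::] w 0 (subseq_refl s).
rewrite addn0 big_nil mulr1 => /(_ sl) /=.
by rewrite (@eq_diffs _ _ _ _ _ _ (f \o y))// => v /=; rewrite add0r.
Qed.

Fixpoint top_cst (K : R) n : R :=
  if n is n'.+1 then
    let C := increment_cst K n' in C + top_cst K n' * (1 + C * K)
  else 0.

Lemma top_cst_ge0 K n : 0 <= K -> 0 <= top_cst K n.
Proof.
move=> K0; elim: n => //= n IH; have C0 := increment_cst_ge0 n K0.
by rewrite addr_ge0// mulr_ge0// addr_ge0// mulr_ge0.
Qed.

(* The top order difference of k enters linearly, with the Lipschitz constant
   of g: this is what a contraction argument can absorb. *)
Lemma diffs_increment_top K L l s c kap u g k w x :
  0 <= K -> 0 <= L -> 0 <= c -> 0 <= kap -> kap <= K ->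
  pairwise comm s -> (size s <= l)%N ->
  (forall w x h, `|g w (x + h) - g w x| <= L * `|h|) ->
  cls l.+1 s c g ->
  (forall s' w, subseq s' s -> (size s' < size s)%N ->
     `|Ds s' k w| <= kap * eps ^+ size s') ->
  (forall w, `|Ds s k w| <= u) ->
  `|Ds s ((increment g k)^~ x) w| <=
    L * u + top_cst K (size s) * c * kap * eps ^+ size s.
Proof.
move=> K0 L0; elim: s l c kap g k w x => [|a s IH] l c kap g k w x c0 kap0 kapK.
  move=> _ _ gL _ _ ku /=; rewrite !mul0r addr0.
  by rewrite (le_trans (gL _ _ _))// ler_wpM2l.
rewrite /= -/(pairwise comm s) => /andP[sa sp] sl gL gc kk ku.
case: l gc sl => // l gc; rewrite ltnS => sl.
set C := increment_cst K (size s).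
have C0 : 0 <= C by exact: increment_cst_ge0.
have gcs : cls l.+2 s c g by apply: clsW gc => //; exact: subseq_cons.
have kks : small s kap k.
  move=> t v ts; apply: kk; first exact: (subseq_trans ts (subseq_cons _ _)).
  by rewrite ltnS size_subseq.
have h1 := cls_diff gc.
have h2 : cls l.+1 s (c + C * c * kap) (fun w x => g (tau a w) (x + k w)).
  have h3 : cls l.+1 s (c + C * c * kap) (fun w x => g (tau a w) x + increment (fun w => g (tau a w)) k w x).
    apply: clsD; first by apply: cls_tau => //; exact: clsW gcs.
    by apply: cls_increment => //; apply: cls_tau.
  move=> t' H' w' x' ts' sz'; have := h3 t' H' w' x' ts' sz'.
  congr (`|_| <= _); apply: eq_diffs => v; apply: eq_diffs => v'.
  by rewrite /increment addrC subrK.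
have ke1 : kap * eps <= kap by rewrite ler_piMr.
have ce0 : 0 <= c * eps by exact: mulr_ge0.
rewrite (@eq_diffs _ _ _ _ _ _ (fun w => increment (fun w x => step_diff tau a (g^~ x) w) k w x + increment (fun w x => g (tau a w) (x + k w)) (step_diff tau a k) w x)); last first.
  by move=> v; rewrite diff_increment.
rewrite diffsD (le_trans (ler_normD _ _))//.
have h4 : `|Ds s ((increment (fun w x => step_diff tau a (g^~ x) w) k)^~ x) w| <= C * (c * eps) * kap * eps ^+ size s.
  have := cls_increment K0 ce0 kap0 kapK sp h1 kks.
  move=> /(_ s [::] w x (subseq_refl s)).
  by rewrite addn0 big_nil mulr1; apply; exact: (leq_trans sl).
have h5 := IH l (c + C * c * kap) (kap * eps) (fun w x => g (tau a w) (x + k w)) (step_diff tau a k) w x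
   (addr_ge0 c0 (mulr_ge0 (mulr_ge0 C0 c0) kap0)) (mulr_ge0 kap0 eps0) (le_trans ke1 kapK) sp sl.
have {}h5 := h5 _ h2 _ ku.
have {}h5 : `|Ds s ((increment (fun w x => g (tau a w) (x + k w)) (step_diff tau a k))^~ x) w| <=
    L * u + top_cst K (size s) * (c + C * c * kap) * (kap * eps) * eps ^+ size s.
  apply: h5 => [w' x' h|t v ts tsz]; first by rewrite addrAC; exact: gL.
  have := kk (a :: t) v; rewrite /= eqxx ltnS => /(_ ts tsz).
  by rewrite exprS mulrA.
apply: (le_trans (lerD h4 h5)).
rewrite addrCA lerD2l -/C exprS.
have -> : C * (c * eps) * kap * eps ^+ size s + top_cst K (size s) * (c + C * c * kap) * (kap * eps) * eps ^+ size s
  = (C + top_cst K (size s) * (1 + C * kap)) * (c * kap * (eps * eps ^+ size s)) by ring.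
rewrite -2!(mulrA (C + _)); apply: ler_wpM2r.
  by rewrite !mulr_ge0// exprn_ge0.
by rewrite lerD2l ler_wpM2l ?top_cst_ge0// lerD2l ler_wpM2l.
Qed.

(** Among the terms of the chain rule, the difference of [y] of full order occurs once and linearly,
    hence [M * u]; the others involve only orders strictly between 0 and [size s]. *)
Lemma diffs_comp_top K l s (M u : R) (f : V -> R) y w : 0 <= K -> 0 <= M ->
  pairwise comm s -> fd_bound l M f -> (0 < size s <= l)%N ->
  (forall s' w, subseq s' s -> s' != [::] -> (size s' < size s)%N ->
    `|Ds s' y w| <= K * eps ^+ size s') ->
  (forall w, `|Ds s y w| <= u) ->
  `|Ds s (f \o y) w| <= M * u + top_cst K (size s).-1 * (comp_cst K (size s).-1 * M) * K * eps ^+ size s.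
Proof.
case: s => // a s K0 M0 /= /andP[sa sp] fM sl hy hu.
case: l fM sl => // l fM sl.
have hs s' w' : subseq s' s -> s' != [::] -> `|Ds s' y w'| <= K * eps ^+ size s'.
  move=> ss s0; apply: hy => //; first exact: (subseq_trans ss (subseq_cons _ _)).
  by rewrite ltnS size_subseq.
have ke : K * eps <= K by rewrite ler_piMr.
have h := @diffs_increment_top K M l s (comp_cst K (size s) * M) (K * eps) u
  (fun w x => f (x + y w)) (step_diff tau a y) w 0 K0 M0
  (mulr_ge0 (comp_cst_ge0 _ K0) M0) (mulr_ge0 K0 eps0) ke sp sl.
have {}h := h _ (cls_comp K0 M0 sp fM hs) _ hu.
rewrite (@eq_diffs _ _ _ _ _ _ ((increment (fun w x => f (x + y w)) (step_diff tau a y))^~ 0)); last first.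
  by move=> v; rewrite /step_diff /increment !add0r subrK.
rewrite exprS mulrA -(mulrA _ K eps); apply: h => [w' x h|t v ts tsz].
  rewrite addrAC; have := fM [:: h] (x + y w') isT.
  by rewrite big_cons big_nil mulr1.
have := hy (a :: t) v; rewrite /= eqxx ltnS => /(_ ts isT tsz).
by rewrite exprS mulrA.
Qed.

End composition.

(** * Cumulants *)

Section set_exponential.
Context {I : finType} {R : comRingType}.
Implicit Types (A B C D : {set I}) (f g h K M : {set I} -> R) (Q : {set {set I}}).

(** The product of generating functions in variables of square zero. *)
Definition conv f g A : R := \sum_(B : {set I} | B \subset A) f B * g (A :\: B).

Lemma big_subsetU1 (F : {set I} -> R) a A : a \notin A ->
  \sum_(B : {set I} | B \subset a |: A) F B =
  \sum_(B : {set I} | B \subset A) F (a |: B) + \sum_(B : {set I} | B \subset A) F B.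
Proof.
move=> aA; rewrite (bigID (fun B : {set I} => a \in B)) /=; congr (_ + _).
  rewrite (reindex_onto (fun B => a |: B) (fun B => B :\ a)) /=; last first.
    by move=> B /andP[_ aB]; rewrite setD1K.
  apply: eq_bigl => B; rewrite setU11 andbT.
  apply/andP/idP => [[sB /eqP eB]|sB].
    apply/subsetP => x xB; have xa : x != a.
      by apply: contraTneq xB => ->; rewrite -eB !inE eqxx.
    by move/subsetP: sB => /(_ x); rewrite !inE xB orbT (negbTE xa) => /(_ isT).
  split; first exact: setUS.
  by rewrite setU1K//; apply: contra aA; exact: (subsetP sB).
apply: eq_bigl => B; apply/andP/idP => [[sB aB]|sB].
  apply/subsetP => x xB; have xa : x != a by apply: contraNneq aB => <-.
  by move/subsetP: sB => /(_ x xB); rewrite !inE (negbTE xa).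
split; first exact: (subset_trans sB (subsetUr _ _)).
by apply: contra aA; exact: (subsetP sB).
Qed.

Lemma convC f g A : conv f g A = conv g f A.
Proof.
rewrite /conv (reindex_onto (fun B => A :\: B) (fun B => A :\: B)) /=; last first.
  by move=> B sB; rewrite setDDr setDv set0U; apply/setIidPr.
apply: eq_big => [B|B /andP[_ /eqP ->]]; last by rewrite mulrC.
rewrite subsetDl /= setDDr setDv set0U.
by apply/eqP/idP => [<-|]; [exact: subsetIl|move/setIidPr].
Qed.

Lemma convA f g h A : conv f (conv g h) A = conv (conv f g) h A.
Proof.
rewrite /conv; under eq_bigr do rewrite mulr_sumr.
under [RHS]eq_bigr do rewrite mulr_suml.
rewrite [RHS](exchange_big_dep (fun C => C \subset A)) /=; last first.
  by move=> B C BA CB; exact: subset_trans CB BA.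
apply: eq_bigr => C CA.
rewrite [RHS](reindex_onto (fun D => C :|: D) (fun B => B :\: C)) /=; last first.
  by move=> B /andP[BA CB]; rewrite setDE setUIr setUCr setIT; apply/setUidPr.
apply: eq_big => [D|D DA].
  rewrite subUset CA subsetUl andbT /= setDUl setDv set0U.
  by rewrite subsetD; congr (_ && _); apply/setDidPl/eqP.
have dD : [disjoint D & C] by move: DA; rewrite subsetD => /andP[].
by rewrite setDUl setDv set0U (setDidPl dD) setDDl mulrA.
Qed.

(** [M] is the exponential of [K] for the product [conv]: the shift by a point [a] acts as a
    derivation, and the recursion reads M' = K' M. This differential form yields uniqueness and the
    rule for sums without any manipulation of partitions. *)
Definition is_exp K M := M set0 = 1 /\
  forall a A, a \notin A -> M (a |: A) = conv (fun B => K (a |: B)) M A.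

Lemma eq_conv f f' g g' A : (forall B, B \subset A -> f B = f' B) ->
  (forall B, B \subset A -> g B = g' B) -> conv f g A = conv f' g' A.
Proof.
move=> ef eg; apply: eq_bigr => B BA; rewrite ef// eg//.
exact: subsetDl.
Qed.

(** Leibniz rule for the derivation at [a]: the new point falls either to [f] or to [g]. *)
Lemma conv_recl f g a A : a \notin A ->
  conv f g (a |: A) = conv (fun B => f (a |: B)) g A + conv f (fun B => g (a |: B)) A.
Proof.
move=> aA; rewrite /conv big_subsetU1//; congr (_ + _); apply: eq_bigr => B BA.
  congr (_ * g _); apply/setP => x; rewrite !inE; case: eqP => //= ->.
  by rewrite (negbTE aA) andbF.
congr (_ * g _); apply/setP => x; rewrite !inE; case: eqP => //= ->.
by rewrite (negbTE (contra (subsetP BA a) aA)).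
Qed.

Lemma is_expD K K' M M' : is_exp K M -> is_exp K' M' ->
  is_exp (fun A => K A + K' A) (conv M M').
Proof.
move=> [M0 MK] [M0' MK']; split.
  rewrite /conv (big_pred1 set0) => [|B]; last by rewrite subset0.
  by rewrite setD0 M0 M0' mulr1.
move=> a A aA; rewrite conv_recl//.
have aB B : B \subset A -> a \notin B by move=> BA; apply: contra aA; exact: (subsetP BA).
rewrite (@eq_conv _ (conv (fun B => K (a |: B)) M) _ M')//; last first.
  by move=> B BA; rewrite MK// aB.
rewrite (@eq_conv M M _ (conv (fun B => K' (a |: B)) M'))//; last first.
  by move=> B BA; rewrite MK'// aB.
rewrite -convA.
rewrite [conv M _ A]convC -convA.
rewrite [X in _ + X](@eq_conv _ (fun B => K' (a |: B)) _ (conv M M'))//; last first.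
  by move=> B _; rewrite convC.
by rewrite /conv -big_split /=; apply: eq_bigr => B _; rewrite mulrDl.
Qed.

(** Isolates the only term with the value of [f] at [a |: A], so that the recursion of [is_exp] can
    be solved for it. *)
Lemma conv_top f g a A : a \notin A -> conv (fun B => f (a |: B)) g A =
  f (a |: A) * g set0 + \sum_(B : {set I} | B \proper A) f (a |: B) * g (A :\: B).
Proof.
move=> aA; rewrite /conv (bigD1 A)//= setDv; congr (_ + _).
by apply: eq_bigl => B; rewrite properEneq andbC.
Qed.

Lemma is_exp_inj K K' M A : is_exp K M -> is_exp K' M -> A != set0 -> K A = K' A.
Proof.
move=> [M0 MK] [_ MK']; have [n] := ubnP #|A|; elim: n A => // n IH A.
rewrite ltnS => An /set0Pn[a aA].
have aA' : a \notin A :\ a by rewrite !inE eqxx.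
have := MK a _ aA'; rewrite MK'// !conv_top// M0 !mulr1 setD1K// => e.
suff es : \sum_(B : {set I} | B \proper A :\ a) K' (a |: B) * M ((A :\ a) :\: B) =
    \sum_(B : {set I} | B \proper A :\ a) K (a |: B) * M ((A :\ a) :\: B).
  by move: e; rewrite es => /addIr.
apply: eq_bigr => B BA; congr (_ * _); apply/esym/IH; last first.
  by apply/set0Pn; exists a; rewrite setU11.
apply: leq_trans An; have := proper_card BA; rewrite (cardsD1 a A) aA cardsU1 => h.
by case: (a \notin B); rewrite ?add1n ?add0n ltnS//; exact: ltnW.
Qed.

(** Deleting the marked block is a bijection; since [C] is nonempty and disjoint from [D], it cannot
    already be a block of a partition of [D]. *)
Lemma partition_block_sum (F : {set {set I}} -> R) C D : C != set0 -> [disjoint C & D] ->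
  \sum_(Q : {set {set I}} | finset.partition Q (C :|: D) && (C \in Q)) F Q =
  \sum_(Q : {set {set I}} | finset.partition Q D) F (C |: Q).
Proof.
move=> C0 dCD.
rewrite (reindex_onto (fun Q => C |: Q) (fun Q => Q :\ C)) /=; last first.
  by move=> Q /andP[_ CQ]; rewrite setD1K.
apply: eq_bigl => Q; rewrite setU11 andbT.
apply/andP/idP => [[PQ /eqP eQ]|PQ].
  have := partitionD1 PQ (setU11 _ _).
  by rewrite eQ setDUl setDv set0U; rewrite disjoint_sym in dCD; rewrite (setDidPl dCD).
split; first exact: partitionU1.
rewrite setU1K//; apply: contra C0 => CQ.
have : C \subset D by rewrite -(cover_partition PQ); exact: bigcup_sup.
by move=> /setIidPl <-; rewrite (disjoint_setI0 dCD).
Qed.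

Definition exp_set K A : R :=
  \sum_(Q : {set {set I}} | finset.partition Q A) \prod_(B in Q) K B.

(** The coefficients in [correlation]; at k = 0 the truncated predecessor gives the value 1. *)
Definition log_coef (k : nat) : R := (k.-1)`!%:R * (-1) ^+ k.-1.

Definition log_set M A : R :=
  \sum_(Q : {set {set I}} | finset.partition Q A)
    log_coef #|Q| * \prod_(B in Q) M B.

Lemma partition_notin C D Q : C != set0 -> [disjoint C & D] ->
  finset.partition Q D -> C \notin Q.
Proof.
move=> C0 dCD PQ; apply: contra C0 => CQ.
have /setIidPl CD := partitionS PQ CQ.
by move/disjoint_setI0: dCD; rewrite CD => ->.
Qed.

Lemma setU1D a A B : a \notin A -> B \subset A -> (a |: B) :|: (A :\: B) = a |: A.
Proof.
move=> aA BA; rewrite -setUA; congr (_ :|: _).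
by rewrite setDE setUIr setUCr setIT; apply/setUidPr.
Qed.

Lemma disjointU1D a A B : a \notin A -> B \subset A -> [disjoint a |: B & A :\: B].
Proof.
move=> aA BA; rewrite -setI_eq0; apply/eqP/setP => x; rewrite !inE.
by case: eqP => [->|_]; [rewrite (negbTE aA) !andbF|case: (x \in B)].
Qed.

(** Partitions of [a |: A] are sorted by the block that contains [a]. *)
Lemma is_exp_exp_set K : is_exp K (exp_set K).
Proof.
split.
  rewrite /exp_set (big_pred1 set0) ?big_set0// => Q.
  by rewrite partition_set0.
move=> a A aA; rewrite /conv.
have aB0 B : a |: B != set0 by apply/set0Pn; exists a; rewrite setU11.
transitivity (\sum_(B : {set I} | B \subset A)
   \sum_(Q : {set {set I}} | finset.partition Q (a |: A) && (a |: B \in Q)) \prod_(B in Q) K B).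
  rewrite (exchange_big_dep (fun Q => finset.partition Q (a |: A))) /=; last first.
    by move=> B Q _ /andP[].
  apply: eq_bigr => Q PQ; rewrite [RHS](big_pred1 (pblock Q a :\ a))// => B.
  have aQ : a \in cover Q by rewrite (cover_partition PQ) setU11.
  rewrite PQ /=; apply/andP/eqP => [[BA BQ]|->].
    rewrite (def_pblock (partition_trivIset PQ) BQ (setU11 _ _)) setU1K//.
    by apply: contra aA; exact: (subsetP BA).
  rewrite setD1K ?mem_pblock// pblock_mem//; split=> //.
  have /subsetP sQ := partitionS PQ (pblock_mem aQ).
  apply/subsetP => x; rewrite !inE => /andP[xa /sQ].
  by rewrite !inE (negbTE xa).
apply: eq_bigr => B BA; rewrite -(setU1D aA BA) partition_block_sum//; last exact: disjointU1D.
rewrite /exp_set mulr_sumr; apply: eq_bigr => Q PQ.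
by rewrite big_setU1//; apply: partition_notin PQ => //; exact: disjointU1D.
Qed.

Lemma log_coef_rec k : (0 < k)%N ->
  log_coef k + log_coef k.-1 * k.-1%:R = (k == 1)%:R.
Proof.
case: k => // -[|k] _; first by rewrite /log_coef /= fact0 expr0 !mulr1 mulr0 addr0.
rewrite /log_coef /= factS natrM exprS; ring.
Qed.

(** A product of [log_set M (a |: B)] with M(C), where C is the nonempty complement of [B], is a sum
    over partitions of [a |: A] with a marked block C that avoids [a]. Each partition Q thus occurs
    #|Q| - 1 times, and by [log_coef_rec] everything cancels except the partition into one block. *)
Lemma is_exp_log_set M : M set0 = 1 -> is_exp (log_set M) M.
Proof.
move=> M0; split=> // a A aA; rewrite conv_top// M0 mulr1.
pose F Q := log_coef (#|Q|.-1) * \prod_(B in Q) M B.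
have -> : \sum_(B : {set I} | B \proper A) log_set M (a |: B) * M (A :\: B) =
   \sum_(C : {set I} | (C \subset A) && (C != set0))
     \sum_(Q : {set {set I}} | finset.partition Q (a |: A) && (C \in Q)) F Q.
  rewrite (reindex_onto (fun C => A :\: C) (fun C => A :\: C)) /=; last first.
    by move=> B /proper_sub BA; rewrite setDDr setDv set0U; apply/setIidPr.
  apply: eq_big => [C|C /andP[AC /eqP eC]].
    apply/andP/andP => [[pC /eqP eC]|[CA C0]].
      split; first by rewrite -eC subsetDl.
      by apply: contraTneq pC => ->; rewrite setD0 properxx.
    have eC : A :\: (A :\: C) = C by rewrite setDDr setDv set0U; apply/setIidPr.
    split; last by rewrite eC.
    rewrite properEneq subsetDl andbT; apply: contraNneq C0 => e.
    by rewrite -eC e setDv.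
  have CA : C \subset A by rewrite -eC subsetDl.
  have C0 : C != set0 by apply: contraTneq AC => ->; rewrite setD0 properxx.
  have dC : [disjoint C & a |: (A :\: C)].
    by have := disjointU1D aA (subsetDl A C); rewrite eC disjoint_sym.
  have eA : a |: A = C :|: (a |: (A :\: C)).
    by rewrite -(setU1D aA (subsetDl A C)) eC setUC.
  rewrite eC eA partition_block_sum// /log_set mulr_suml.
  apply: eq_bigr => Q PQ; have CQ := partition_notin C0 dC PQ.
  by rewrite /F big_setU1// cardsU1 CQ add1n /= mulrAC mulrA.
rewrite (exchange_big_dep (fun Q => finset.partition Q (a |: A))) /=; last first.
  by move=> B Q _ /andP[].
rewrite /log_set -big_split /=.
have aA0 : a |: A != set0 by apply/set0Pn; exists a; rewrite setU11.
rewrite (eq_bigr (fun Q : {set {set I}} => (#|Q| == 1)%:R * \prod_(B in Q) M B)); last first.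
  move=> Q PQ.
  have aQ : a \in cover Q by rewrite (cover_partition PQ) setU11.
  have pQ := pblock_mem aQ.
  have Q0 : (0 < #|Q|)%N by apply/card_gt0P; exists (pblock Q a).
  rewrite [X in _ + X](eq_bigl (fun C : {set I} => C \in Q :\ pblock Q a)); last first.
    move=> C; rewrite PQ /= !inE; apply/idP/andP.
      move=> /andP[/andP[CA C0] CQ]; split=> //.
      apply: contraTneq CA => ->; apply: contra aA => /subsetP; apply.
      by rewrite mem_pblock.
    move=> [Cp CQ]; rewrite CQ andbT (partition_neq0 PQ CQ) andbT.
    apply/subsetP => x xC; have := subsetP (partitionS PQ CQ) x xC.
    rewrite !inE => /orP[/eqP ex|//]; move: Cp.
    by rewrite -ex (def_pblock (partition_trivIset PQ) CQ xC) eqxx.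
  have cQ : #|Q :\ pblock Q a| = #|Q|.-1 by rewrite (cardsD1 (pblock Q a) Q) pQ.
  by rewrite sumr_const cQ -log_coef_rec// /F -mulr_natr; ring.
rewrite (bigD1 [set a |: A]) /=; last first.
  by rewrite /finset.partition /cover big_set1 eqxx trivIset1 inE eq_sym aA0.
rewrite cards1 big_set1 mul1r big1 ?addr0// => Q /andP[PQ Q1].
case: eqP => [/eqP/cards1P[B eB]|_]; last by rewrite mul0r.
move: Q1; rewrite eB; have := cover_partition PQ; rewrite eB /cover big_set1 => ->.
by rewrite eqxx.
Qed.

End set_exponential.

(** * Differences of cumulants of independent inputs *)

Lemma is_exp_det (I : finType) (R : comRingType) (K K' M M' : {set I} -> R) A :
  is_exp K M -> is_exp K' M' -> (forall B, B != set0 -> K B = K' B) -> M A = M' A.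
Proof.
move=> [M0 MK] [M0' MK'] eK; have [n] := ubnP #|A|; elim: n A => // n IH A.
rewrite ltnS => An; have [->|/set0Pn[a aA]] := eqVneq A set0; first by rewrite M0 M0'.
have aA' : a \notin A :\ a by rewrite !inE eqxx.
rewrite -(setD1K aA) MK// MK'//; apply: eq_bigr => B BA; rewrite eK; last first.
  by apply/set0Pn; exists a; rewrite setU11.
rewrite IH//; apply: leq_trans An; apply: (leq_ltn_trans (subset_leq_card (subsetDl _ _))).
by rewrite (cardsD1 a A) aA add1n.
Qed.

Definition upd (N : nat) (T : Type) (a : 'I_N * T) (y : {ffun 'I_N -> T}) :
    {ffun 'I_N -> T} := [ffun i => if i == a.1 then a.2 else y i].

Definition distinct_coord (N : nat) (T : finType) : rel ('I_N * T) :=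
  fun a b => a.1 != b.1.

Lemma updC (N : nat) (T : finType) (a b : 'I_N * T) (y : {ffun 'I_N -> T}) :
  distinct_coord a b -> upd a (upd b y) = upd b (upd a y).
Proof.
move=> ab; apply/ffunP => i; rewrite !ffunE; have [->|//] := eqVneq i a.1.
by rewrite (negbTE ab).
Qed.

Lemma pairwise_distinct_coord (N : nat) (T : finType) (s : seq ('I_N * T)) :
  pairwise (@distinct_coord N T) s = uniq [seq x.1 | x <- s].
Proof. by rewrite uniq_pairwise pairwise_map. Qed.

Lemma upd_upd (N : nat) (T : Type) j (e e' : T) (y : {ffun 'I_N -> T}) :
  upd (j, e) (upd (j, e') y) = upd (j, e) y.
Proof. by apply/ffunP => i; rewrite !ffunE /=; case: eqP. Qed.

Section configurations.
Context {R : realFieldType} {N : nat} {T : finType}.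
Local Notation Y := {ffun 'I_N -> T}.
Local Notation Ds := (diffs (@upd N T)).
Implicit Types (F G : Y -> R) (s : seq ('I_N * T)) (w : 'I_N -> R) (j : 'I_N).

(** Coordinates in [X] may not be differenced: they are being averaged over, or have already been
    differenced. *)
Definition diff_bound (X : seq 'I_N) (q : nat) (w : 'I_N -> R) (c : R) F :=
  forall s y, uniq (X ++ [seq x.1 | x <- s]) -> (size s <= q)%N ->
    `|Ds s F y| <= c * \prod_(x <- s) w x.1.

Definition indep_coord j F := forall e y, F (upd (j, e) y) = F y.

Lemma diffs_upd a s F y : uniq (a.1 :: [seq x.1 | x <- s]) ->
  Ds s (fun y => F (upd a y)) y = Ds s F (upd a y).
Proof.
rewrite -[uniq _]/(uniq [seq x.1 | x <- a :: s]) -pairwise_distinct_coord => /andP[h _].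
exact: (@diffs_tau _ _ (@upd N T) _ (@updC N T) _ a s F y h).
Qed.

Lemma diff_boundW X q q' w w' c c' F : (q' <= q)%N -> 0 <= c -> c <= c' ->
  (forall j, 0 <= w j <= w' j) -> diff_bound X q w c F -> diff_bound X q' w' c' F.
Proof.
move=> qq c0 cc ww Fb s y us sz; apply: (le_trans (Fb _ _ us (leq_trans sz qq))).
have p0 : 0 <= \prod_(x <- s) w x.1 by apply: prodr_ge0 => x _; case/andP: (ww x.1).
apply: ler_pM => //; elim: {us sz p0} s => [|x s IH]; first by rewrite !big_nil.
rewrite !big_cons; case/andP: (ww x.1) => w0 ww'; apply: ler_pM => //.
by apply: prodr_ge0 => z _; case/andP: (ww z.1).
Qed.

Lemma eq_diff_bound X q w c F G : F =1 G -> diff_bound X q w c F -> diff_bound X q w c G.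
Proof.
by move=> e Fb s y us sz; rewrite -(eq_diffs _ s e y); exact: Fb.
Qed.

Lemma diff_boundD X q w c c' F G : diff_bound X q w c F -> diff_bound X q w c' G ->
  diff_bound X q w (c + c') (fun y => F y + G y).
Proof.
move=> Fb Gb s y us sz; rewrite diffsD (le_trans (ler_normD _ _))// mulrDl.
by apply: lerD; [exact: Fb|exact: Gb].
Qed.

Lemma diff_boundN X q w c F : diff_bound X q w c F -> diff_bound X q w c (fun y => - F y).
Proof. by move=> Fb s y us sz; rewrite diffsN normrN; exact: Fb. Qed.

Lemma diff_bound_cst X q w c (d : R) : (forall j, 0 <= w j) -> 0 <= c -> `|d| <= c ->
  diff_bound X q w c (fun=> d).
Proof.
move=> w0 c0 dc [|a s] y us sz; first by rewrite big_nil mulr1.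
by rewrite diffs_cst// normr0 mulr_ge0//; apply: prodr_ge0.
Qed.

Lemma diff_bound_sum X q w (J : Type) (c : J -> R) (r : seq J) (P : pred J) (F : J -> Y -> R) :
  (forall j, 0 <= w j) -> (forall i, P i -> diff_bound X q w (c i) (F i)) ->
  diff_bound X q w (\sum_(i <- r | P i) c i) (fun y => \sum_(i <- r | P i) F i y).
Proof.
move=> w0 Fb; elim: r => [|i r IH].
  rewrite big_nil; apply: (@eq_diff_bound _ _ _ _ (fun=> 0)) => [y|]; first by rewrite big_nil.
  by apply: diff_bound_cst; rewrite ?normr0.
rewrite big_cons; case: ifPn => Pi; last first.
  by apply: eq_diff_bound IH => y; rewrite big_cons (negbTE Pi).
apply: (eq_diff_bound _ (diff_boundD (Fb i Pi) IH)) => y.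
by rewrite big_cons Pi.
Qed.

(** Each of at most [q] differences splits in two by the Leibniz rule, hence 2^q. The coordinate
    just differenced joins [X], so that the move along it commutes with the differences still to
    come. *)
Lemma diff_boundM X q w c c' F G : (forall j, 0 <= w j <= 1) -> 0 <= c -> 0 <= c' ->
  diff_bound X q w c F -> diff_bound X q w c' G ->
  diff_bound X q w (2 ^+ q * c * c') (fun y => F y * G y).
Proof.
move=> w01 c0 c'0.
elim: q c c' F G X c0 c'0 => [|q IH] c c' F G X c0 c'0 Fb Gb [|a s] y us //= sz.
- by rewrite normrM !big_nil expr0 mul1r mulr1 ler_pM//; [have := Fb [::] y us sz|have := Gb [::] y us sz];
    rewrite big_nil mulr1.
- rewrite normrM big_nil mulr1 -mulrA; have e1 : 1 <= 2 ^+ q.+1 :> R by rewrite exprn_ege1// ler1n.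
  apply: (@le_trans _ _ (c * c')); last by rewrite ler_peMl// mulr_ge0.
  by rewrite ler_pM//; [have := Fb [::] y us sz|have := Gb [::] y us sz]; rewrite big_nil mulr1.
have [wa0 wa1] := andP (w01 a.1).
have eX : uniq (a.1 :: X).
  by move: us; rewrite cat_uniq /= => /and3P[-> + _]; rewrite negb_or => /andP[-> _].
have us' t : uniq ((a.1 :: X) ++ [seq x.1 | x <- t]) -> uniq (X ++ [seq x.1 | x <- a :: t]).
  by rewrite -[_ ++ _]/([:: a.1] ++ (X ++ _)) uniq_catCA.
have usa : uniq ((a.1 :: X) ++ [seq x.1 | x <- s]).
  by move: us; rewrite -[[seq x.1 | x <- a :: s]]/([:: a.1] ++ _) uniq_catCA.
have dF : diff_bound (a.1 :: X) q w (c * w a.1) (step_diff (@upd N T) a F).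
  move=> t z ut tz; have := Fb (a :: t) z (us' _ ut); rewrite /= ltnS => /(_ tz).
  by rewrite big_cons mulrA.
have dG : diff_bound (a.1 :: X) q w (c' * w a.1) (step_diff (@upd N T) a G).
  move=> t z ut tz; have := Gb (a :: t) z (us' _ ut); rewrite /= ltnS => /(_ tz).
  by rewrite big_cons mulrA.
have Gt : diff_bound (a.1 :: X) q w c' (fun y => G (upd a y)).
  move=> t z ut tz; rewrite diffs_upd; last first.
    by move: ut; rewrite /= mem_cat negb_or cat_uniq => /andP[/andP[_ ->] /and3P[_ _ ->]].
  apply: Gb; first by move: ut => /= /andP[].
  exact: leqW.
have F1 : diff_bound (a.1 :: X) q w c F.
  move=> t z ut tz; apply: Fb; first by move: ut => /= /andP[].
  exact: leqW.
have h := IH _ _ _ _ _ (mulr_ge0 c0 wa0) c'0 dF Gt s y usa sz.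
have h' := IH _ _ _ _ _ c0 (mulr_ge0 c'0 wa0) F1 dG s y usa sz.
rewrite (@eq_diffs _ _ _ _ _ _ (fun y => step_diff (@upd N T) a F y * G (upd a y) + F y * step_diff (@upd N T) a G y)); last first.
  by move=> z; rewrite /step_diff; ring.
rewrite diffsD (le_trans (ler_normD _ _))// (le_trans (lerD h h'))//.
rewrite big_cons exprS le_eqVlt; apply/orP; left; apply/eqP; ring.
Qed.

(** A difference along [j] vanishes, so the restriction on [j] can be lifted. *)
Lemma indep_diff_bound j q w c F : 0 <= c -> (forall i, 0 <= w i) -> indep_coord j F ->
  diff_bound [:: j] q w c F -> diff_bound [::] q w c F.
Proof.
move=> c0 w0 jF Fb s y us sz.
have [js|js] := boolP (j \in [seq x.1 | x <- s]); last by apply: Fb => //=; rewrite js us.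
have -> : Ds s F y = 0; last by rewrite normr0 mulr_ge0//; apply: prodr_ge0.
elim: s F y us js jF {sz Fb} => // a s IH F y us js jF /=.
have [eja|ja] := eqVneq j a.1.
  have e z : step_diff (@upd N T) a F z = 0.
    by rewrite /step_diff; have := jF a.2 z; rewrite eja -surjective_pairing => ->; rewrite subrr.
  rewrite (@eq_diffs _ _ _ _ _ _ (fun=> 0)) //.
  by case: (s) => // b t; exact: diffs_cst.
apply: IH; first by case/andP: us.
  by move: js; rewrite inE (negbTE ja).
move=> e z; rewrite /step_diff jF updC; last by rewrite /distinct_coord eq_sym.
by rewrite jF.
Qed.

Variable p : T -> R.
Hypotheses (p0 : forall e, 0 <= p e) (p1 : \sum_e p e = 1).

Definition avg j F : Y -> R := fun y => \sum_e p e * F (upd (j, e) y).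

Lemma eq_avg j F G : F =1 G -> avg j F =1 avg j G.
Proof. by move=> e y; apply: eq_bigr => t _; rewrite e. Qed.

Lemma avg_cst j (c : R) y : avg j (fun=> c) y = c.
Proof. by rewrite /avg -mulr_suml p1 mul1r. Qed.

Lemma indep_avg j F : indep_coord j (avg j F).
Proof. by move=> e y; apply: eq_bigr => t _; rewrite upd_upd. Qed.

Lemma indep_avgW j j' F : indep_coord j F -> indep_coord j (avg j' F).
Proof.
move=> h e y; apply: eq_bigr => t _; congr (_ * _).
have [<-|jj] := eqVneq j j'; first by rewrite upd_upd.
by rewrite updC ?h// /distinct_coord eq_sym.
Qed.

Lemma avg_indep j F y : indep_coord j F -> avg j F y = F y.
Proof. by move=> h; rewrite -[RHS](avg_cst j _ y); apply: eq_bigr => e _; rewrite h. Qed.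

Lemma diffs_avg j s F y : uniq (j :: [seq x.1 | x <- s]) ->
  Ds s (avg j F) y = \sum_e p e * Ds s F (upd (j, e) y).
Proof.
move=> us; rewrite (@diffs_sum _ _ _ _ _ _ (fun e y => p e * F (upd (j, e) y))).
apply: eq_bigr => e _.
rewrite -(@diffs_upd (j, e) s F y)//.
have h G : Ds s (fun z => p e * G z) y = p e * Ds s G y.
  elim: s G {us} => //= a s IH G; rewrite -IH.
  by apply: eq_diffs => z; rewrite /step_diff mulrBr.
exact: (h (fun z => F (upd (j, e) z))).
Qed.

Lemma norm_avg_le j F y c : (forall e, `|F (upd (j, e) y)| <= c) -> `|avg j F y| <= c.
Proof.
move=> Fc; rewrite (le_trans (ler_norm_sum _ _ _))//.
rewrite -[leRHS](avg_cst j _ y) ler_sum// => e _.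
by rewrite normrM ger0_norm// ler_wpM2l.
Qed.

Lemma diff_bound_avg j q w c F : diff_bound [:: j] q w c F ->
  diff_bound [:: j] q w c (avg j F).
Proof.
move=> Fb s y us sz; rewrite diffs_avg//.
by apply: (@norm_avg_le j (Ds s F) y) => e; exact: Fb.
Qed.

(** Up to sign, F minus its average over [j] is an average of differences of F along [j]: centering
    gains [w j] and spends one order. *)
Lemma diff_bound_center j q w c F : diff_bound [::] q.+1 w c F ->
  diff_bound [:: j] q w (c * w j) (fun y => F y - avg j F y).
Proof.
move=> Fb s y us sz; rewrite diffsB diffs_avg//.
have -> : Ds s F y - \sum_e p e * Ds s F (upd (j, e) y) =
    - avg j (fun z => Ds s F z - Ds s F y) y.
  rewrite -[Ds s F y in LHS](avg_cst j _ y) -opprB -sumrB; congr (- _).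
  by apply: eq_bigr => e _; rewrite mulrBr.
rewrite normrN; apply: norm_avg_le => e.
have := Fb ((j, e) :: s) y us; rewrite /= ltnS => /(_ sz).
by rewrite diffsB diffs_upd// big_cons mulrA.
Qed.

End configurations.

(** * Weights for the reaction of a set of observed particles to one input *)

Section weights.
Context {R : realFieldType} {I : finType} {N : nat}.
Variables (r : I -> 'I_N) (N0 : (0 < N)%N).
Hypothesis r_inj : injective r.
Let eps : R := N%:R^-1.
Implicit Types (A B : {set I}) (j : 'I_N).

Definition weight A j : R := if j \in r @: A then 1 else N%:R^-1.

(** Multiplicative in [A], unlike [weight], and therefore compatible with [conv]. *)
Definition set_weight A j : R := \prod_(a in A) if r a == j then 1 else N%:R^-1.

Let eps0 : 0 <= eps. Proof. by rewrite invr_ge0. Qed.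
Let eps1 : eps <= 1.
Proof. by rewrite invf_le1 ?ltr0n// ler1n. Qed.

Lemma weight_itv A j : 0 <= weight A j <= 1.
Proof. by rewrite /weight; case: ifP => _; rewrite ?ler01 ?lexx// eps0 eps1. Qed.

Lemma weight_ge0 A j : 0 <= weight A j. Proof. by case/andP: (weight_itv A j). Qed.

Lemma weightS A B j : B \subset A -> 0 <= weight B j <= weight A j.
Proof.
move=> BA; rewrite weight_ge0 /weight; case: ifPn => [jB|_].
  by rewrite (subsetP (imsetS r BA) _ jB) /=.
by case: ifP => _ /=; [exact: eps1|].
Qed.

Lemma set_weight_ge0 A j : 0 <= set_weight A j.
Proof. by apply: prodr_ge0 => a _; case: ifP. Qed.

Lemma set_weight0 j : set_weight set0 j = 1. Proof. exact: big_set0. Qed.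

Lemma set_weightU1D a A B j : a \notin A -> B \subset A ->
  set_weight (a |: B) j * set_weight (A :\: B) j = set_weight (a |: A) j.
Proof.
move=> aA BA; have aB : a \notin B by apply: contra aA; exact: (subsetP BA).
rewrite /set_weight !big_setU1// -mulrA; congr (_ * _).
by rewrite [RHS](big_setID B) /= (setIidPr BA).
Qed.

(** By injectivity at most one factor of [set_weight] is 1. The identity turns a cumulant bound
    N^(1-#|A|), sharpened by one difference along [j], into the multiplicative profile. *)
Lemma weight_set_weight A j : A != set0 ->
  N%:R^-1 ^+ #|A|.-1 * weight A j = set_weight A j.
Proof.
move=> A0; rewrite /weight; case: ifPn => [/imsetP[a aA ->]|jA].
  rewrite mulr1 /set_weight (bigD1 a)//= eqxx mul1r.
  rewrite (eq_bigr (fun=> eps)) => [|b /andP[_ ba]]; last by rewrite (inj_eq r_inj) (negbTE ba).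
  rewrite prodr_const; congr (_ ^+ _); rewrite (cardsD1 a A) aA /=.
  by apply: eq_card => b; rewrite !inE andbC.
rewrite -exprSr prednK ?card_gt0// /set_weight.
rewrite (eq_bigr (fun=> eps)) => [|b bA]; first by rewrite prodr_const.
by case: eqP => // e; move: jA; rewrite -e imset_f.
Qed.

(** A generic [j] contributes N^-#|A|, and there are at most N of them; the observed ones contribute
    N^(1-#|A|), and there are at most #|A| of them. *)
Lemma sum_set_weight A (L : seq 'I_N) : A != set0 -> uniq L ->
  \sum_(j <- L) set_weight A j <= (1 + #|A|%:R) * N%:R^-1 ^+ #|A|.-1.
Proof.
move=> A0 uL; apply: (@le_trans _ _ (\sum_j set_weight A j)).
  by rewrite (big_uniq _ uL)/= [leRHS](bigID (fun j => j \in L)) /= lerDl sumr_ge0// => j _;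
    exact: set_weight_ge0.
under eq_bigr do rewrite -weight_set_weight//.
rewrite -mulr_sumr mulrC; apply: ler_wpM2r; first by rewrite exprn_ge0.
apply: (@le_trans _ _ (\sum_j (eps + (j \in r @: A)%:R))).
  by apply: ler_sum => j _; rewrite /weight; case: ifP => _; rewrite ?addr0 ?lerDr.
rewrite big_split /= sumr_const card_ord -[eps *+ N]mulr_natr /eps mulVf ?pnatr_eq0 -?lt0n// lerD2l.
rewrite -natr_sum ler_nat -big_mkcond /= sum1_card; exact: leq_imset_card.
Qed.

Context {T : finType}.
Local Notation Y := {ffun 'I_N -> T}.

Fixpoint exp_bound_cst (q : nat) (c : R) n : R :=
  if n is n'.+1 then exp_bound_cst q c n' * (1 + #|{set I}|%:R * (2 ^+ q * c)) else 1.

Lemma exp_bound_cst_ge1 q c n : 0 <= c -> 1 <= exp_bound_cst q c n.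
Proof.
move=> c0; elim: n => //= n IH; rewrite mulr_ege1// lerDl.
by rewrite mulr_ge0// mulr_ge0// exprn_ge0.
Qed.

Lemma sum_subset_le (A : {set I}) (P : pred {set I}) (F : {set I} -> R) (d : R) : 0 <= d ->
  (forall B, P B -> F B <= d) -> \sum_(B : {set I} | P B) F B <= #|{set I}|%:R * d.
Proof.
move=> d0 Fd; apply: (@le_trans _ _ (\sum_(B : {set I} | P B) d)); first exact: ler_sum.
rewrite sumr_const -[leLHS]mulr_natl ler_wpM2r// ler_nat; exact: max_card.
Qed.

(** Set weights of a block and its complement multiply to that of the union, so a convolution keeps
    the profile in N; only the constant grows, by the number of subsets and the Leibniz factor. *)
Lemma diff_bound_conv X q (c c' : R) a A (P : pred {set I}) (F G : {set I} -> Y -> R) j :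
  a \notin A -> 0 <= c -> 0 <= c' -> (forall B, P B -> B \subset A) ->
  (forall B, P B -> diff_bound X q (weight (a |: B)) (c * set_weight (a |: B) j) (F B)) ->
  (forall B, P B -> diff_bound X q (weight (A :\: B)) (c' * set_weight (A :\: B) j) (G B)) ->
  diff_bound X q (weight (a |: A)) (#|{set I}|%:R * (2 ^+ q * c * c') * set_weight (a |: A) j)
    (fun y => \sum_(B : {set I} | P B) F B y * G B y).
Proof.
move=> aA c0 c'0 PA Fb Gb.
pose d B : R := 2 ^+ q * (c * set_weight (a |: B) j) * (c' * set_weight (A :\: B) j).
have d0 B : 0 <= d B by rewrite !mulr_ge0// ?exprn_ge0// set_weight_ge0.
have h : diff_bound X q (weight (a |: A)) (\sum_(B : {set I} | P B) d B)
    (fun y => \sum_(B : {set I} | P B) F B y * G B y).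
  apply: diff_bound_sum => [i|B PB]; first exact: weight_ge0.
  apply: diff_boundM => [i||||]; rewrite ?weight_itv ?mulr_ge0 ?set_weight_ge0//.
    apply: diff_boundW (Fb _ PB) => // [|i]; first by rewrite mulr_ge0 ?set_weight_ge0.
    by apply: weightS; apply: setUS; exact: PA.
  apply: diff_boundW (Gb _ PB) => // [|i]; first by rewrite mulr_ge0 ?set_weight_ge0.
  by apply: weightS; apply: (subset_trans (subsetDl _ _)); exact: subsetUr.
apply: diff_boundW h => // [||i]; [exact: sumr_ge0| |by rewrite weight_ge0 lexx].
rewrite -mulrA; apply: sum_subset_le => // [|B PB].
  by rewrite !mulr_ge0// ?exprn_ge0// set_weight_ge0.
by rewrite /d -(set_weightU1D _ aA (PA _ PB)) le_eqVlt; apply/orP; left; apply/eqP; ring.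
Qed.

(** The estimate follows the recursion of [is_exp] instead of the sum over partitions, so that only
    products of two factors occur. *)
Lemma diff_bound_exp_set X q (c : R) j n (K : {set I} -> Y -> R) : 0 <= c ->
  (forall B, B != set0 -> (#|B| <= n)%N ->
    diff_bound X q (weight B) (c * set_weight B j) (K B)) ->
  forall A, (#|A| <= n)%N ->
  diff_bound X q (weight A) (exp_bound_cst q c n * set_weight A j)
    (fun y => exp_set (K^~ y) A).
Proof.
move=> c0; elim: n => [|n IH] Kb A An.
  have -> : A = set0 by apply/eqP; rewrite -cards_eq0 -leqn0.
  apply: (@eq_diff_bound _ _ _ _ _ _ _ (fun=> 1)).
    by move=> y; have [-> _] := is_exp_exp_set (K^~ y).
  apply: diff_bound_cst => [i||]; rewrite ?weight_ge0 ?set_weight0 ?mulr1 ?normr1//=.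
have {}IH := IH (fun B nB lB => Kb B nB (leqW lB)).
set C := exp_bound_cst q c n in IH *.
have C1 : 1 <= C by exact: exp_bound_cst_ge1.
have C0 : 0 <= C by exact: le_trans C1.
have D0 : 0 <= #|{set I}|%:R * (2 ^+ q * c) by rewrite !mulr_ge0// exprn_ge0.
have [->|/set0Pn[a aA]] := eqVneq A set0.
  apply: (@eq_diff_bound _ _ _ _ _ _ _ (fun=> 1)).
    by move=> y; have [-> _] := is_exp_exp_set (K^~ y).
  have h : 1 <= exp_bound_cst q c n.+1 by exact: exp_bound_cst_ge1.
  apply: diff_bound_cst => [i||]; rewrite ?weight_ge0 ?set_weight0 ?mulr1 ?normr1//.
  exact: le_trans h.
have aA' : a \notin A :\ a by rewrite !inE eqxx.
have lA : (#|A :\ a| <= n)%N by move: An; rewrite (cardsD1 a A) aA add1n.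
rewrite -(setD1K aA).
apply: (@eq_diff_bound _ _ _ _ _ _ _ (fun y => \sum_(B : {set I} | B \subset A :\ a)
    K (a |: B) y * exp_set (K^~ y) ((A :\ a) :\: B))).
  by move=> y; have [_ ->] := is_exp_exp_set (K^~ y).
have h : diff_bound X q (weight (a |: A :\ a)) (#|{set I}|%:R * (2 ^+ q * c * C) * set_weight (a |: A :\ a) j)
  (fun y => \sum_(B : {set I} | B \subset A :\ a)
    K (a |: B) y * exp_set (K^~ y) ((A :\ a) :\: B)).
  apply: (@diff_bound_conv X q c C a (A :\ a) (fun B => B \subset A :\ a) (fun B => K (a |: B)) (fun B y => exp_set (K^~ y) ((A :\ a) :\: B))) => // B BA.
    apply: Kb; first by apply/set0Pn; exists a; rewrite setU11.
    apply: leq_trans An; apply: subset_leq_card; rewrite -(setD1K aA); exact: setUS.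
  apply: IH; apply: leq_trans lA; apply: subset_leq_card; exact: subsetDl.
apply: diff_boundW h => // [||i]; last by rewrite weight_ge0 lexx.
  by rewrite !mulr_ge0 ?exprn_ge0 ?set_weight_ge0.
apply: ler_wpM2r; rewrite ?set_weight_ge0//= mulrDr mulr1.
have -> : #|{set I}|%:R * (2 ^+ q * c * C) = C * (#|{set I}|%:R * (2 ^+ q * c)) by ring.
by rewrite lerDr.
Qed.

Fixpoint log_bound_cst (q : nat) (c : R) n : R :=
  if n is n'.+1 then c + #|{set I}|%:R * (2 ^+ q * log_bound_cst q c n' * c) else 0.

Lemma log_bound_cst_ge0 q c n : 0 <= c -> 0 <= log_bound_cst q c n.
Proof.
by move=> c0; elim: n => //= n IH; rewrite addr_ge0// !mulr_ge0// exprn_ge0.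
Qed.

(** The recursion of [is_exp] is solved for its top term: M(A) minus products of [M] with logarithms
    of strictly smaller sets. *)
Lemma diff_bound_log_set X q (c : R) j n (M : {set I} -> Y -> R) : 0 <= c ->
  (forall y, M set0 y = 1) ->
  (forall B, B != set0 -> (#|B| <= n)%N ->
    diff_bound X q (weight B) (c * set_weight B j) (M B)) ->
  forall A, A != set0 -> (#|A| <= n)%N ->
  diff_bound X q (weight A) (log_bound_cst q c n * set_weight A j)
    (fun y => log_set (M^~ y) A).
Proof.
move=> c0 M0; elim: n => [|n IH] Mb A.
  by move=> A0; rewrite leqn0 cards_eq0 (negbTE A0).
have {}IH := IH (fun B nB lB => Mb B nB (leqW lB)).
move=> /[dup] A0 /set0Pn[a aA] An.
set C := log_bound_cst q c n in IH *.
have C0 : 0 <= C by exact: log_bound_cst_ge0.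
have aA' : a \notin A :\ a by rewrite !inE eqxx.
have lA : (#|A :\ a| <= n)%N by move: An; rewrite (cardsD1 a A) aA add1n.
have eA := setD1K aA.
apply: (@eq_diff_bound _ _ _ _ _ _ _ (fun y => M A y - \sum_(B : {set I} | B \proper A :\ a)
    log_set (M^~ y) (a |: B) * M ((A :\ a) :\: B) y)).
  move=> y; have [_ /(_ a (A :\ a) aA')] := @is_exp_log_set _ _ (M^~ y) (M0 y).
  by rewrite conv_top//= M0 mulr1 eA => ->; rewrite addrK.
rewrite /= mulrDl; apply: diff_boundD; first exact: Mb.
apply: diff_boundN.
rewrite -{1 2}eA.
apply: (@diff_bound_conv X q C c a (A :\ a) (fun B => B \proper A :\ a) (fun B y => log_set (M^~ y) (a |: B)) (fun B => M ((A :\ a) :\: B))) => // B; first exact: proper_sub.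
  move=> BA; apply: IH; first by apply/set0Pn; exists a; rewrite setU11.
  rewrite cardsU1; have := leq_trans (proper_card BA) lA.
  by case: (a \notin B); rewrite ?add1n ?add0n//; exact: ltnW.
move=> BA; apply: Mb.
  apply: contraTneq BA => e; have sB : A :\ a \subset B by rewrite -setD_eq0 e.
  by rewrite properE sB andbF.
apply: leqW; apply: leq_trans lA; apply: subset_leq_card; exact: subsetDl.
Qed.

End weights.

(** * Conditional cumulants and the revelation of one coordinate *)

Section cumulants.
Context {R : realFieldType} {I : finType} {N : nat} {T : finType}.
Local Notation Y := {ffun 'I_N -> T}.
Variable p : T -> R.
Hypotheses (p0 : forall e, 0 <= p e) (p1 : \sum_e p e = 1).
Variable X : I -> Y -> R.
Implicit Types (A B : {set I}) (L : seq 'I_N).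

Definition partial_avg L (F : Y -> R) : Y -> R := foldr (avg p) F L.

Definition moment L A : Y -> R := partial_avg L (fun y => \prod_(a in A) X a y).

(** The joint cumulant conditionally on the coordinates outside [L]: nothing is integrated for [L =
    [::]], everything for [enum 'I_N]. *)
Definition cumulant L A : Y -> R := fun y => log_set (fun B => moment L B y) A.

Lemma moment_set0 L y : moment L set0 y = 1.
Proof.
elim: L y => [|j L IH] y; first by rewrite /moment /= big_set0.
rewrite /moment /= -/(moment L set0) (eq_avg p j IH); exact: avg_cst.
Qed.

Lemma is_exp_cumulant L y : is_exp (cumulant L ^~ y) (moment L ^~ y).
Proof. by apply: is_exp_log_set; exact: moment_set0. Qed.

(** Deterministic variables have no cumulants beyond the first; the sum has one term when [A] is a
    singleton and none otherwise. *)
Lemma cumulant_nil A y : A != set0 ->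
  cumulant [::] A y = \sum_(a | A == [set a]) X a y.
Proof.
move=> A0; apply: (@is_exp_inj _ _ (cumulant [::] ^~ y) (fun A => \sum_(a | A == [set a]) X a y) _ A (is_exp_cumulant [::] y) _ A0) => {A A0}.
split; first exact: moment_set0.
have s1 a : \sum_(b | [set a] == [set b]) X b y = X a y.
  by rewrite (big_pred1 a)// => b; rewrite (inj_eq set1_inj) eq_sym.
have s0 a (B : {set I}) : a \notin B -> B != set0 -> \sum_(b | a |: B == [set b]) X b y = 0.
  move=> aB B0; rewrite big_pred0// => b; apply/negbTE; apply: contra B0 => /eqP e.
  have : a \in [set b] by rewrite -e setU11.
  rewrite inE => /eqP ab; apply/eqP/setP => x; rewrite inE; apply/negbTE.
  apply: contra aB => xB; have : x \in [set b] by rewrite -e !inE xB orbT.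
  by rewrite inE -ab => /eqP <-.
move=> a A aA; rewrite (@conv_top _ _ (fun A => \sum_(a | A == [set a]) X a y))// moment_set0 mulr1 /moment /=.
rewrite big_setU1//=; have [->|A0] := eqVneq A set0.
  rewrite setU0 s1 big_set0 mulr1 [X in _ + X]big1 ?addr0// => B.
  by rewrite properE sub0set andbF.
rewrite s0// add0r (bigD1 set0)/=; last by rewrite properE sub0set subset0.
rewrite setU0 s1 setD0 [X in _ + X]big1 ?addr0// => B /andP[BA B0].
by rewrite s0 ?mul0r//; apply: contra aA; exact: (subsetP (proper_sub BA)).
Qed.

Definition centered j L A : Y -> R := fun y => cumulant L A y - avg p j (cumulant L A) y.

Definition centered_exp j L A : Y -> R := fun y => exp_set (centered j L ^~ y) A.

(** The correction term in the law of total cumulance: the logarithm of the average of exp(K - Kbar)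
    over coordinate [j]. *)
Definition cumulant_step j L A : Y -> R :=
  fun y => log_set (fun B => avg p j (centered_exp j L B) y) A.

Lemma avg_centered_exp_set0 j L y : avg p j (centered_exp j L set0) y = 1.
Proof.
rewrite (@eq_avg _ _ _ p j _ (fun=> 1)) ?avg_cst// => z.
by have [] := is_exp_exp_set (centered j L ^~ z).
Qed.

(* Law of total cumulance for one coordinate: with Kbar the average of K,
   avg (exp K) = exp Kbar * avg (exp (K - Kbar)). *)
Lemma cumulant_cons j L A y : A != set0 ->
  cumulant (j :: L) A y = avg p j (cumulant L A) y + cumulant_step j L A y.
Proof.
move=> A0; apply: (@is_exp_inj _ _ (cumulant (j :: L) ^~ y)
  (fun A => avg p j (cumulant L A) y + cumulant_step j L A y) _ A (is_exp_cumulant (j :: L) y) _ A0).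
have e1 : is_exp (cumulant_step j L ^~ y) (fun B => avg p j (centered_exp j L B) y).
  by apply: is_exp_log_set; exact: avg_centered_exp_set0.
have e2 := is_expD (is_exp_exp_set (fun A => avg p j (cumulant L A) y)) e1.
split; first exact: moment_set0.
have key B : moment (j :: L) B y = conv (exp_set (fun A => avg p j (cumulant L A) y))
    (fun B => avg p j (centered_exp j L B) y) B.
  transitivity (\sum_e p e * moment L B (upd (j, e) y)); first by [].
  rewrite /conv.
  under [RHS]eq_bigr do rewrite /avg mulr_sumr.
  rewrite exchange_big /=; apply: eq_bigr => e _.
  have e3 := is_expD (is_exp_exp_set (fun A => avg p j (cumulant L A) (upd (j, e) y)))
    (is_exp_exp_set (centered j L ^~ (upd (j, e) y))).
  rewrite (is_exp_det B (is_exp_cumulant L (upd (j, e) y)) e3); last first.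
    by move=> C _; rewrite /centered addrC subrK.
  rewrite /conv mulr_sumr; apply: eq_bigr => C _; rewrite mulrCA; congr (_ * _).
  (* The factor built from averaged cumulants does not depend on coordinate [j] and leaves the
     average. *)
  by apply: eq_bigr => Q _; apply: eq_bigr => D _; rewrite (@indep_avg _ _ _ p j).
move=> a B aB; rewrite key; have [_ ->] := e2 => //.
by apply: eq_conv => // C _; rewrite key.
Qed.

Lemma indep_cumulant_step j L A : indep_coord j (cumulant_step j L A).
Proof.
move=> e y; apply: eq_bigr => Q _; congr (_ * _); apply: eq_bigr => B _.
exact: indep_avg.
Qed.

Variable r : I -> 'I_N.
Hypotheses (r_inj : injective r) (N0 : (0 < N)%N).

(** Cumulants of order at most [n] control the correction at order [n.+1], because the centered
    cumulant of full order averages to zero. This gain of one order drives the induction on the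
    order of cumulants. *)
Lemma diff_bound_cumulant_step q (c : R) n j L : 0 <= c ->
  (forall B, B != set0 -> (#|B| <= n)%N ->
    diff_bound [:: j] q (weight r B) (c * set_weight r B j) (centered j L B)) ->
  forall A, A != set0 -> (#|A| <= n.+1)%N ->
  diff_bound [::] q (weight r A)
    (log_bound_cst (I := I) q (exp_bound_cst (I := I) q c n +
       #|{set I}|%:R * (2 ^+ q * c * exp_bound_cst (I := I) q c n)) n.+1 *
     set_weight r A j) (cumulant_step j L A).
Proof.
move=> c0 cb A A0 An.
set C := exp_bound_cst q c n.
have C0 : 0 <= C by apply: le_trans (exp_bound_cst_ge1 q n c0).
set c' := C + _.
have d0 : 0 <= #|{set I}|%:R * (2 ^+ q * c * C) by rewrite !mulr_ge0// exprn_ge0.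
have c'0 : 0 <= c' by rewrite addr_ge0.
have eb := @diff_bound_exp_set _ I N r N0 T [:: j] q c j n (centered j L) c0 cb.
apply: (@indep_diff_bound _ _ _ j).
- by rewrite mulr_ge0// ?set_weight_ge0// log_bound_cst_ge0.
- by move=> i; exact: weight_ge0.
- exact: indep_cumulant_step.
apply: (@diff_bound_log_set _ I N r N0 T [:: j] q c' j n.+1 (fun B => avg p j (centered_exp j L B))) => //.
  exact: avg_centered_exp_set0.
move=> B nB lB.
have [lBn|lnB] := leqP #|B| n.
  apply: (@diff_boundW _ _ _ _ q q (weight r B) _ (C * set_weight r B j)) => //.
  - by rewrite mulr_ge0// set_weight_ge0.
  - by rewrite ler_wpM2r ?set_weight_ge0// lerDl.
  - by move=> i; rewrite weight_ge0// lexx.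
  apply: diff_bound_avg => //; exact: eb.
have [a aB] := set0Pn _ nB.
have aA' : a \notin B :\ a by rewrite !inE eqxx.
have eB := setD1K aB.
have lB' : (#|B :\ a| <= n)%N by move: lB; rewrite (cardsD1 a B) aB add1n.
(* At full order the exponential is expanded by its recursion; its top term has average zero and is
   dropped. *)
apply: (@eq_diff_bound _ _ _ _ _ _ _ (avg p j (fun y => \sum_(D : {set I} | D \proper B :\ a)
    centered j L (a |: D) y * centered_exp j L ((B :\ a) :\: D) y))).
  move=> y; rewrite /centered_exp /avg.
  transitivity (\sum_e (p e * centered j L B (upd (j, e) y) + p e * \sum_(D : {set I} | D \proper B :\ a)
      centered j L (a |: D) (upd (j, e) y) * exp_set (centered j L ^~ (upd (j, e) y)) (B :\ a :\: D))).
    rewrite big_split /= [X in _ = X + _](_ : _ = 0) ?add0r//.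
    under eq_bigr do rewrite /centered mulrBr.
    rewrite sumrB; apply/eqP; rewrite subr_eq0; apply/eqP.
    transitivity (avg p j (avg p j (cumulant L B)) y) => //.
    by rewrite avg_indep//; exact: indep_avg.
  apply: eq_bigr => e _; rewrite -mulrDr; congr (_ * _).
  have [f0 fs] := is_exp_exp_set (centered j L ^~ (upd (j, e) y)).
  by rewrite -{4}eB fs// (@conv_top _ _ (centered j L ^~ (upd (j, e) y)))// f0 mulr1 eB.
apply: diff_bound_avg => //.
have h : diff_bound [:: j] q (weight r (a |: B :\ a)) (#|{set I}|%:R * (2 ^+ q * c * C) * set_weight r (a |: B :\ a) j)
   (fun y => \sum_(D : {set I} | D \proper B :\ a)
    centered j L (a |: D) y * centered_exp j L ((B :\ a) :\: D) y).
  apply: (@diff_bound_conv _ I N r N0 T [:: j] q c C a (B :\ a) (fun D => D \proper B :\ a)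
     (fun D => centered j L (a |: D)) (fun D => centered_exp j L ((B :\ a) :\: D)) j) => // D.
  - exact: proper_sub.
  - move=> DB; apply: cb; first by apply/set0Pn; exists a; rewrite setU11.
    rewrite cardsU1; have := leq_trans (proper_card DB) lB'.
    by case: (a \notin D); rewrite ?add1n ?add0n//; exact: ltnW.
  - move=> DB; apply: eb; apply: leq_trans lB'; apply: subset_leq_card; exact: subsetDl.
rewrite eB in h.
apply: diff_boundW h => // [||i].
- by rewrite mulr_ge0// set_weight_ge0.
- by rewrite ler_wpM2r ?set_weight_ge0// lerDr.
- by rewrite weight_ge0// lexx.
Qed.

End cumulants.

(** Every order spends one more difference, since the correction needs centered cumulants of lower
    order and centering is a difference; hence [q + n] for the observables. The constant is chosen
    before N and the finite type of inputs. *)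
Lemma diff_bound_cumulant (R : realFieldType) (I : finType) (n q : nat) (c0 : R) :
  0 <= c0 -> exists2 C : R, 0 <= C & forall (N : nat) (T : finType) (p : T -> R)
    (X : I -> {ffun 'I_N -> T} -> R) (r : I -> 'I_N),
  (0 < N)%N -> injective r -> (forall e, 0 <= p e) -> \sum_e p e = 1 ->
  (forall a, diff_bound [::] (q + n) (weight r [set a]) c0 (X a)) ->
  forall (L : seq 'I_N) (A : {set I}), uniq L -> A != set0 -> (#|A| <= n)%N ->
  diff_bound [::] q (weight r A) (C * N%:R^-1 ^+ #|A|.-1) (cumulant p X L A).
Proof.
move=> c00; elim: n q => [|n IH] q.
  exists 0 => // N T p X r _ _ _ _ _ L A _ A0; by rewrite leqn0 cards_eq0 (negbTE A0).
have [C C0 HC] := IH q.+1.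
pose D := log_bound_cst (I := I) q (exp_bound_cst (I := I) q C n +
       #|{set I}|%:R * (2 ^+ q * C * exp_bound_cst (I := I) q C n)) n.+1.
have E0 : 0 <= exp_bound_cst (I := I) q C n by apply: le_trans (exp_bound_cst_ge1 q n C0).
have D0 : 0 <= D.
  by apply: log_bound_cst_ge0; rewrite addr_ge0// !mulr_ge0// exprn_ge0.
exists (c0 + D * (1 + n.+1%:R)); first by rewrite addr_ge0// mulr_ge0// addr_ge0.
move=> N T p X r N0 r_inj p0 p1 Xb L A uL A0 An.
have e0 : 0 <= N%:R^-1 :> R by rewrite invr_ge0.
have stepb j L' : uniq L' -> diff_bound [::] q (weight r A) (D * set_weight r A j) (cumulant_step p X j L' A).
  move=> uL'; apply: diff_bound_cumulant_step => // B nB lB.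
  rewrite -weight_set_weight// mulrA; apply: diff_bound_center => //.
  by apply: HC => // a; rewrite addSnnS.
(* Each revealed coordinate adds its correction and averaging preserves the rest; [sum_set_weight]
   then sums the corrections. *)
suff h : diff_bound [::] q (weight r A) (c0 * N%:R^-1 ^+ #|A|.-1 + \sum_(j <- L) D * set_weight r A j) (cumulant p X L A).
  apply: diff_boundW h => // [||i]; last by rewrite weight_ge0// lexx.
    by rewrite addr_ge0 ?mulr_ge0 ?exprn_ge0// sumr_ge0// => j _; rewrite mulr_ge0 ?set_weight_ge0.
  rewrite mulrDl lerD2l -mulr_sumr -mulrA ler_wpM2l//.
  apply: (le_trans (sum_set_weight N0 r_inj A0 uL)).
  by rewrite ler_wpM2r ?exprn_ge0// lerD2l ler_nat.
elim: L uL => [|j L IHL] uL.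
  rewrite big_nil addr0.
  apply: (@eq_diff_bound _ _ _ _ _ _ _ (fun y => \sum_(a | A == [set a]) X a y)).
    by move=> y; rewrite cumulant_nil.
  have [/cards1P[a ->]|A1] := boolP (#|A| == 1)%N.
    apply: (@eq_diff_bound _ _ _ _ _ _ _ (X a)).
      by move=> y; rewrite (big_pred1 a)// => b; rewrite (inj_eq set1_inj) eq_sym.
    rewrite cards1 expr0 mulr1; apply: diff_boundW (Xb a) => // [|i].
      by apply: leq_addr.
    by rewrite weight_ge0// lexx.
  apply: (@eq_diff_bound _ _ _ _ _ _ _ (fun=> 0)).
    by move=> y; rewrite big_pred0// => b; apply: contraNF A1 => /eqP ->; rewrite cards1.
  apply: diff_bound_cst => [i||]; rewrite ?weight_ge0 ?normr0// ?mulr_ge0// exprn_ge0//.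
case/andP: (uL) => jL uL'.
apply: (@eq_diff_bound _ _ _ _ _ _ _ (fun y => avg p j (cumulant p X L A) y + cumulant_step p X j L A y)).
  by move=> y; rewrite -cumulant_cons.
rewrite big_cons addrCA addrC.
apply: diff_boundD; last exact: stepb.
have B0 : 0 <= c0 * N%:R^-1 ^+ #|A|.-1 + \sum_(i <- L) D * set_weight r A i.
  by rewrite addr_ge0 ?mulr_ge0 ?exprn_ge0// sumr_ge0// => i _; rewrite mulr_ge0 ?set_weight_ge0.
(* The average is bounded only for differences away from [j], which suffices because it no longer
   depends on [j]. *)
apply: (@indep_diff_bound _ _ _ j) => // [i||]; first exact: weight_ge0.
  exact: indep_avg.
apply: diff_bound_avg => // s y us sz; apply: IHL => //.
by case/andP: us.
Qed.

Section product_mean.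
Context {R : realFieldType} {N : nat} {T : finType}.
Local Notation Y := {ffun 'I_N -> T}.
Variable p : T -> R.
Hypothesis p1 : \sum_e p e = 1.
Implicit Types (F : Y -> R).

Definition mean F : R := \sum_(z : Y) (\prod_i p (z i)) * F z.

(** The involution [h] exchanges coordinate [j] with the fresh sample and preserves the total
    product weight. *)
Lemma mean_avg j F : mean (avg p j F) = mean F.
Proof.
rewrite /mean /avg; under eq_bigr do rewrite mulr_sumr.
rewrite pair_big /=.
pose h (ze : Y * T) := (upd (j, ze.2) ze.1, ze.1 j).
have hK : involutive h.
  move=> [z e]; rewrite /h /=; congr pair; last by rewrite ffunE eqxx.
  by apply/ffunP => i; rewrite !ffunE /=; case: eqP => // ->.
rewrite (reindex_inj (inv_inj hK)) /=.
transitivity (\sum_(ze : Y * T) (\prod_i p (ze.1 i)) * F ze.1 * p ze.2).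
  apply: eq_bigr => -[z e] _ /=; rewrite mulrA.
  have -> : upd (j, z j) (upd (j, e) z) = z.
    by apply/ffunP => i; rewrite !ffunE /=; case: eqP => // ->.
  have hp : \prod_i p (upd (j, e) z i) * p (z j) = \prod_i p (z i) * p e.
    rewrite (bigD1 j)//= [in RHS](bigD1 j)//= ffunE eqxx /=.
    rewrite (eq_bigr (fun i => p (z i))) => [|i ij]; first by ring.
    by rewrite ffunE (negbTE ij).
  by rewrite hp mulrAC.
rewrite -(pair_big xpredT xpredT (fun (z : Y) e => (\prod_i p (z i)) * F z * p e)) /=.
by apply: eq_bigr => z _; rewrite -mulr_sumr p1 mulr1.
Qed.

Lemma mean_cst (c : R) : mean (fun=> c) = c.
Proof.
by rewrite /mean -mulr_suml -(bigA_distr_bigA (fun (_ : 'I_N) e => p e)) big1 ?mul1r// => i _.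
Qed.

Lemma indep_all_cst F y z : (forall j, indep_coord j F) -> F y = F z.
Proof.
move=> h; have e (s : seq 'I_N) : F y = F [ffun i => if i \in s then z i else y i].
  elim: s => [|j s ->]; first by congr F; apply/ffunP => i; rewrite ffunE.
  rewrite -(h j (z j)); congr F; apply/ffunP => i; rewrite !ffunE inE /=.
  by case: eqP => //= ->.
by rewrite (e (enum 'I_N)); congr F; apply/ffunP => i; rewrite ffunE mem_enum.
Qed.

(** The iterated average over all coordinates is a constant, and no averaging changes the mean. *)
Lemma partial_avg_mean F y : partial_avg p (enum 'I_N) F y = mean F.
Proof.
have e L : mean (partial_avg p L F) = mean F.
  by elim: L => //= j L IH; rewrite mean_avg.
have i L j : j \in L -> indep_coord j (partial_avg p L F).
  elim: L => //= k L IH; rewrite inE; case: eqVneq => [-> _|_ /= jL].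
    exact: indep_avg.
  by apply: indep_avgW; exact: IH.
rewrite -(e (enum 'I_N)) -[LHS]mean_cst; apply: eq_bigr => z _; congr (_ * _).
by apply: indep_all_cst => j; apply: i; rewrite mem_enum.
Qed.

Lemma mean_perm (sigma : 'I_N -> 'I_N) F : injective sigma ->
  mean (fun z => F [ffun i => z (sigma i)]) = mean F.
Proof.
move=> si; rewrite /mean [RHS](reindex (fun z : Y => [ffun i => z (sigma i)])) /=; last first.
  exists (fun z : Y => [ffun i => z (invF si i)]) => z _; apply/ffunP => i;
  by rewrite !ffunE ?f_invF ?invF_f.
apply: eq_bigr => z _; congr (_ * _).
rewrite (reindex_inj si); apply: eq_bigr => i _; by rewrite ffunE.
Qed.

End product_mean.

(** * The Euler scheme *)

Section lyapunov.
Context {R : realFieldType}.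

(** Friction damps only the velocity; the cross term carries dissipation over to the position. *)
Definition lyap (a e x v : R) : R := a * x ^+ 2 + v ^+ 2 + 2 * e * x * v.

Lemma young (c x y : R) : 0 < c -> 2 * x * y <= c * x ^+ 2 + c^-1 * y ^+ 2.
Proof.
move=> c0; rewrite -subr_ge0.
have -> : c * x ^+ 2 + c^-1 * y ^+ 2 - 2 * x * y = c^-1 * (c * x - y) ^+ 2.
  by field; rewrite gt_eqF.
by rewrite mulr_ge0 ?sqr_ge0// invr_ge0 ltW.
Qed.

Lemma lyapunov_step (a g : R) : 0 < a -> 0 < g ->
  exists e lam C h0 : R, [/\ [/\ 0 < lam, 0 < C & 0 < h0],
    forall x v, x ^+ 2 <= 2 / a * lyap a e x v,
    forall x v, v ^+ 2 <= 2 * lyap a e x v &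
    forall h x v f, 0 <= h <= h0 -> 0 <= 1 - lam * h /\
      lyap a e (x + h * v) (v + h * (f - g * v - a * x)) <=
      (1 - lam * h) * lyap a e x v + h * C * f ^+ 2].
Proof.
move=> a0 g0.
have ag0 : 0 < a + g ^+ 2 by rewrite addr_gt0// exprn_gt0.
(* Chosen so that e (1 + g^2/a) = g/4, which lets the friction absorb the cross terms, and e^2 <=
   a/4, which makes [lyap] comparable with a x^2 + v^2. *)
pose e := g * a / (4 * (a + g ^+ 2)).
have e0 : 0 < e by rewrite divr_gt0 ?mulr_gt0.
have e1 : e * (1 + g ^+ 2 / a) = g / 4.
  by rewrite /e; field; rewrite !gt_eqF// ltr_wpDl// ?sqr_ge0.
have e2 : e ^+ 2 <= a / 4.
  rewrite /e expr_div_n ler_pdivrMr ?exprn_gt0 ?mulr_gt0//.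
  have : 0 <= a * (a - g ^+ 2) ^+ 2 by rewrite mulr_ge0 ?sqr_ge0// ltW.
  have : 0 < a * g ^+ 2 * a by rewrite !mulr_gt0 ?exprn_gt0.
  nra.
pose nu := Num.min g (e * a).
have nu0 : 0 < nu by rewrite lt_min g0 mulr_gt0.
have nug : nu <= g by rewrite ge_min lexx.
have nue : nu <= e * a by rewrite ge_min lexx orbT.
have low x v : a / 2 * x ^+ 2 + v ^+ 2 / 2 <= lyap a e x v.
  rewrite /lyap; have := @young (a / 2) (- x) (e * v); rewrite divr_gt0// => /(_ isT).
  have : (a / 2)^-1 * (e * v) ^+ 2 <= v ^+ 2 / 2.
    rewrite exprMn invf_div mulrA mulrC ler_wpM2l ?sqr_ge0//.
    rewrite mulrAC ler_pdivrMr//; lra.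
  rewrite sqrrN; lra.
pose q := (2 * a + 2).
have q0 : 0 < q by rewrite addr_gt0// mulr_gt0.
have upp x v : lyap a e x v <= q * (x ^+ 2 + v ^+ 2).
  rewrite /lyap; have := @young (a / 2) x (e * v); rewrite divr_gt0// => /(_ isT).
  have : (a / 2)^-1 * (e * v) ^+ 2 <= v ^+ 2 / 2.
    rewrite exprMn invf_div mulrA mulrC ler_wpM2l ?sqr_ge0//.
    rewrite mulrAC ler_pdivrMr//; lra.
  have : 0 <= a * v ^+ 2 by rewrite mulr_ge0 ?sqr_ge0// ltW.
  have : 0 <= a * x ^+ 2 by rewrite mulr_ge0 ?sqr_ge0// ltW.
  have := sqr_ge0 x; have := sqr_ge0 v; rewrite /q; nra.
(* Bounds the part of one step that is quadratic in h; the limit [h0] lets half of the dissipation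
   [nu] absorb it, and the other half gives the rate [lam]. *)
pose D := a + e + 3 * (1 + e) * (1 + g ^+ 2 + a ^+ 2).
have g20 := sqr_ge0 g; have a20 := sqr_ge0 a.
have D0 : 0 < D.
  have t1 : 0 < 1 + e by exact: addr_gt0.
  have t2 : 0 < 1 + g ^+ 2 + a ^+ 2 by rewrite ltr_wpDr// ltr_wpDr.
  apply: addr_gt0; first exact: addr_gt0.
  by apply: mulr_gt0 => //; exact: mulr_gt0.
pose lam := nu / (2 * q).
have lam0 : 0 < lam by rewrite divr_gt0// mulr_gt0.
pose h0 := Num.min (nu / (2 * D)) (Num.min 1 lam^-1).
have h00 : 0 < h0 by rewrite !lt_min ltr01 invr_gt0 lam0 divr_gt0 ?mulr_gt0.
pose C := 2 / g + 2 * e / a + D.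
have C0 : 0 < C.
  apply: addr_gt0 => //; apply: addr_gt0; first exact: divr_gt0.
  by apply: divr_gt0 => //; exact: mulr_gt0.
exists e, lam, C, h0; split=> // [x v|x v|h x v f /andP[hge hle]].
- have := low x v; have : 0 <= v ^+ 2 by exact: sqr_ge0.
  rewrite [2 / a * _]mulrAC ler_pdivlMr//; lra.
- have := low x v; have : 0 <= a * x ^+ 2 by rewrite mulr_ge0 ?sqr_ge0// ltW.
  lra.
have hD : h * D <= nu / 2.
  have : h <= nu / (2 * D) by rewrite (le_trans hle)// ge_min lexx.
  by rewrite !ler_pdivlMr ?mulr_gt0//; lra.
have h1 : h <= 1 by rewrite (le_trans hle)// !ge_min lexx orbT.
have hl : lam * h <= 1.
  have : h <= lam^-1 by rewrite (le_trans hle)// !ge_min lexx !orbT.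
  by rewrite -[X in _ <= X -> _]mul1r ler_pdivlMr// mulrC.
split; first by rewrite subr_ge0.
set F := f - g * v - a * x.
have step : lyap a e (x + h * v) (v + h * F) = lyap a e x v +
   h * (2 * v * f - 2 * g * v ^+ 2 + 2 * e * v ^+ 2 + 2 * e * x * f - 2 * e * g * x * v - 2 * e * a * x ^+ 2)
   + h * h * (a * v ^+ 2 + F ^+ 2 + 2 * e * v * F).
  by rewrite /lyap /F; ring.
have b1 : 2 * v * f - 2 * g * v ^+ 2 + 2 * e * v ^+ 2 + 2 * e * x * f - 2 * e * g * x * v - 2 * e * a * x ^+ 2
   <= - nu * (x ^+ 2 + v ^+ 2) + (2 / g + 2 * e / a) * f ^+ 2.
  have y1 := @young (g / 2) v f; rewrite divr_gt0// in y1; have {}y1 := y1 isT.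
  have y2 := @young (a / 2) x f; rewrite divr_gt0// in y2; have {}y2 := y2 isT.
  have y3 := @young (a / 2) (- x) (g * v); rewrite divr_gt0// in y3; have {}y3 := y3 isT.
  rewrite !invf_div in y1 y2 y3.
  have {}y2 : 2 * e * x * f <= e * (a / 2) * x ^+ 2 + 2 * e / a * f ^+ 2.
    have := ler_wpM2l (ltW e0) y2.
    have -> : e * (2 * x * f) = 2 * e * x * f by ring.
    have -> : e * (a / 2 * x ^+ 2 + 2 / a * f ^+ 2) = e * (a / 2) * x ^+ 2 + 2 * e / a * f ^+ 2 by ring.
    by [].
  have {}y3 : - (2 * e * g * x * v) <= e * (a / 2) * x ^+ 2 + 2 * (e * (g ^+ 2 / a)) * v ^+ 2.
    have := ler_wpM2l (ltW e0) y3.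
    have -> : e * (2 * - x * (g * v)) = - (2 * e * g * x * v) by ring.
    have -> : e * (a / 2 * (- x) ^+ 2 + 2 / a * (g * v) ^+ 2) = e * (a / 2) * x ^+ 2 + 2 * (e * (g ^+ 2 / a)) * v ^+ 2 by ring.
    by [].
  have e1' : e * (g ^+ 2 / a) = g / 4 - e by rewrite -e1; ring.
  rewrite e1' in y3.
  have z1 : nu * x ^+ 2 <= e * a * x ^+ 2 by rewrite ler_wpM2r ?sqr_ge0.
  have z2 : nu * v ^+ 2 <= g * v ^+ 2 by rewrite ler_wpM2r ?sqr_ge0.
  lra.
have b2 : a * v ^+ 2 + F ^+ 2 + 2 * e * v * F <= D * (x ^+ 2 + v ^+ 2 + f ^+ 2).
  have w1 : 2 * e * v * F <= e * v ^+ 2 + e * F ^+ 2.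
    have : 0 <= e * (v - F) ^+ 2 by rewrite mulr_ge0 ?sqr_ge0// ltW.
    lra.
  have w2 : F ^+ 2 <= 3 * (f ^+ 2 + g ^+ 2 * v ^+ 2 + a ^+ 2 * x ^+ 2).
    rewrite /F; have := sqr_ge0 (f + g * v); have := sqr_ge0 (f + a * x).
    have := sqr_ge0 (g * v - a * x); nra.
  set S := x ^+ 2 + v ^+ 2 + f ^+ 2.
  have x2 := sqr_ge0 x; have v2 := sqr_ge0 v; have f2 := sqr_ge0 f.
  have w3 : f ^+ 2 + g ^+ 2 * v ^+ 2 + a ^+ 2 * x ^+ 2 <= (1 + g ^+ 2 + a ^+ 2) * S.
    have t1 : 0 <= g ^+ 2 * (x ^+ 2 + f ^+ 2) by rewrite mulr_ge0// addr_ge0.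
    have t2 : 0 <= a ^+ 2 * (v ^+ 2 + f ^+ 2) by rewrite mulr_ge0// addr_ge0.
    rewrite /S; lra.
  have w4 : v ^+ 2 <= S by rewrite /S; lra.
  have w5 : (a + e) * v ^+ 2 <= (a + e) * S by rewrite ler_wpM2l// addr_ge0// ltW.
  have w6 : (1 + e) * F ^+ 2 <= (1 + e) * (3 * ((1 + g ^+ 2 + a ^+ 2) * S)).
    apply: ler_wpM2l; first by rewrite addr_ge0// ltW.
    by apply: (le_trans w2); rewrite ler_wpM2l.
  rewrite /D; lra.
have b3 : h * h * (a * v ^+ 2 + F ^+ 2 + 2 * e * v * F) <=
    h * (nu / 2 * (x ^+ 2 + v ^+ 2) + D * f ^+ 2).
  rewrite -mulrA ler_wpM2l//; apply: (le_trans (ler_wpM2l hge b2)).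
  rewrite mulrDr mulrDr mulrA lerD//.
    by rewrite ler_wpM2r// addr_ge0 ?sqr_ge0.
  by rewrite ler_piMl// mulr_ge0 ?sqr_ge0// ltW.
have b4 := ler_wpM2l hge b1.
have b5 : lam * lyap a e x v <= nu / 2 * (x ^+ 2 + v ^+ 2).
  apply: (le_trans (ler_wpM2l (ltW lam0) (upp x v))).
  rewrite mulrA ler_wpM2r ?addr_ge0 ?sqr_ge0// /lam le_eqVlt; apply/orP; left; apply/eqP.
  by field; rewrite gt_eqF.
have b6 := ler_wpM2l hge b5.
rewrite step /C; lra.
Qed.

End lyapunov.

From mathcomp Require Import all_classical all_reals all_analysis.
From mathcomp Require Import measurable_realfun ess_sup_inf.

Import numFieldNormedType.Exports.

Local Open Scope classical_set_scope.
Local Open Scope ring_scope.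

Lemma rV_coord_le (R : realType) d (x : 'rV[R]_d) c : `|x ord0 c| <= `|x|.
Proof.
by rewrite [leRHS]mx_normrE; exact: (@le_bigmax _ _ _ _ (fun i => `|x i.1 i.2|) (ord0, c)).
Qed.

Lemma rV_norm_le (R : realType) d (x : 'rV[R]_d) b : 0 <= b ->
  (forall c, `|x ord0 c| <= b) -> `|x| <= b.
Proof.
move=> b0 xb; rewrite [leLHS]mx_normrE; apply: bigmax_le => // -[i c] _ /=.
by rewrite ord1.
Qed.

Section diffs_coordinates.
Context {R : realType} {N : nat} {T : finType}.
Local Notation Y := {ffun 'I_N -> T}.
Local Notation Ds := (diffs (@upd N T)).
Implicit Types s : seq ('I_N * T).

Lemma diffs_coord d (F : Y -> 'rV[R]_d) s y c :
  Ds s F y ord0 c = Ds s (fun y => F y ord0 c) y.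
Proof.
elim: s F => //= a s IH F; rewrite IH; apply: eq_diffs => z.
by rewrite /step_diff !mxE.
Qed.

Lemma diffsZ (k : R) (F : Y -> R) s y : Ds s (fun y => k * F y) y = k * Ds s F y.
Proof.
by elim: s F => //= a s IH F; rewrite -IH; apply: eq_diffs => z; rewrite /step_diff mulrBr.
Qed.

Lemma diffs_fst (V W : zmodType) (F : Y -> V * W) s y :
  Ds s (fun y => (F y).1) y = (Ds s F y).1.
Proof. by elim: s F => //= a s IH F; rewrite -IH. Qed.

Lemma diffs_snd (V W : zmodType) (F : Y -> V * W) s y :
  Ds s (fun y => (F y).2) y = (Ds s F y).2.
Proof. by elim: s F => //= a s IH F; rewrite -IH. Qed.

Lemma diffs_local (V : zmodType) (F : T -> V) i s y : (0 < size s)%N ->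
  i \notin [seq x.1 | x <- s] -> Ds s (fun y => F (y i)) y = 0.
Proof.
case: s => // a s _ /=; rewrite inE negb_or => /andP[ia _].
rewrite (@eq_diffs _ _ _ _ _ _ (fun=> 0)) => [|z]; last by rewrite /step_diff ffunE (negbTE ia) subrr.
by case: s => // b s; exact: diffs_cst.
Qed.

(** Gives up the difference along [a]: two differences of one order less remain, and they no longer
    touch the coordinate of [a]. *)
Lemma diffs_pivot (V : zmodType) (F : Y -> V) s1 a s2 y :
  uniq [seq x.1 | x <- s1 ++ a :: s2] ->
  Ds (s1 ++ a :: s2) F y = Ds (s1 ++ s2) F (upd a y) - Ds (s1 ++ s2) F y.
Proof.
rewrite map_cat cat_uniq => /and3P[_ _ us2]; rewrite !diffs_cat /=.
rewrite diffsB; congr (_ - _).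
apply: (@diffs_tau _ _ (@upd N T) _ (@updC N T) _ a s2 _ y).
by move: us2; rewrite -/(uniq [seq x.1 | x <- a :: s2]) -pairwise_distinct_coord => /andP[].
Qed.

End diffs_coordinates.

Section euler_scheme.
Context {R : realType} {d N : nat} {T : Type}.
Variables (kappa gam a h : R) (g : 'rV[R]_d -> 'rV[R]_d).
Variables (z0 : T -> phase R d) (b : T -> nat -> 'rV[R]_d).

Definition force (z : 'I_N -> phase R d) (i : 'I_N) : 'rV[R]_d :=
  - ((kappa / N%:R) *: \sum_(j < N) g ((z i).1 - (z j).1))
  - gam *: (z i).2 - a *: (z i).1.

Fixpoint euler (n : nat) (y : {ffun 'I_N -> T}) (i : 'I_N) : phase R d :=
  if n is n'.+1 then
    let z := euler n' y in
    ((z i).1 + h *: (z i).2, (z i).2 + h *: force z i + b (y i) n')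
  else z0 (y i).

End euler_scheme.

Section euler_differences.
Context {R : realType} {d : nat}.
Variables (gam a : R) (g : 'rV[R]_d -> 'rV[R]_d) (l : nat) (M : R).
Hypotheses (gam0 : 0 < gam) (a0 : 0 < a) (M0 : 0 <= M).
Hypothesis gM : forall c, fd_bound l M (fun x => g x ord0 c).

(* The threshold on kappa makes the Lyapunov function of the linear part absorb
   the top order differences of the interaction. *)
Lemma euler_differences : exists kappa0 h0 rho : R, [/\ 0 < kappa0, 0 < h0, 0 <= rho &
  forall p, (p <= l)%N -> exists2 K : R, 0 <= K &
  forall (N : nat) (T : finType) (kappa h : R) (z0 : T -> phase R d) (b : T -> nat -> 'rV[R]_d)
    (s : seq ('I_N * T)) (n : nat) (i : 'I_N) (y : {ffun 'I_N -> T}),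
  (0 < N)%N -> 0 <= kappa <= kappa0 -> 0 <= h <= h0 ->
  uniq [seq x.1 | x <- s] -> (0 < size s <= p)%N -> i \notin [seq x.1 | x <- s] ->
  `|diffs (@upd N T) s (fun y => euler kappa gam a h g z0 b n y i) y| <=
    K * N%:R^-1 ^+ size s].
Proof.
have [e [lam [C [h0 [[lam0 C0 h00] Qx Qv Qstep]]]]] := lyapunov_step a0 gam0.
(* Both 2 and 2/a are at most rho^2, so a bound B^2 on the Lyapunov form gives rho B on each
   component. *)
pose rho : R := 2 + 2 / a.
have rho0 : 0 < rho by rewrite addr_gt0// divr_gt0.
have Qrho x v B : 0 <= B -> lyap a e x v <= B ^+ 2 -> `|x| <= rho * B /\ `|v| <= rho * B.
  move=> B0 QB; have rB0 : 0 <= rho * B by rewrite mulr_ge0// ltW.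
  have a20 : 0 <= 2 / a by rewrite divr_ge0// ltW.
  have B20 : 0 <= B ^+ 2 by exact: sqr_ge0.
  have ar : 0 <= (2 / a) * B ^+ 2 by exact: mulr_ge0.
  have ar2 : 0 <= (2 / a) ^+ 2 * B ^+ 2 by rewrite mulr_ge0// sqr_ge0.
  have eq2 : (rho * B) ^+ 2 = 4 * B ^+ 2 + 4 * ((2 / a) * B ^+ 2) + (2 / a) ^+ 2 * B ^+ 2.
    by rewrite /rho; ring.
  have xs : x ^+ 2 <= (2 / a) * B ^+ 2.
    by rewrite (le_trans (Qx x v))// ler_wpM2l.
  have vs : v ^+ 2 <= 2 * B ^+ 2 by rewrite (le_trans (Qv x v))// ler_wpM2l.
  split; rewrite -(@ler_pXn2r _ 2)// ?nnegrE// real_normK ?num_real// eq2; lra.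
(* The term 2 M rho is the Lipschitz effect of the top order differences of the two particles of a
   pair; the 1 absorbs the lower orders, since [K] will be at least their total [B0]. *)
pose c1 := 2 * M * rho + 1.
have c10 : 0 < c1 by rewrite ltr_wpDl// !mulr_ge0// ltW.
have den0 : 0 < C * c1 ^+ 2 by rewrite mulr_gt0// exprn_gt0.
(* With kappa <= 1 this gives C (kappa c1)^2 <= lam: the source due to the interaction does not
   exceed the contraction. *)
pose kappa0 := Num.min 1 (lam / (C * c1 ^+ 2)).
have kappa00 : 0 < kappa0 by rewrite lt_min ltr01 divr_gt0.
exists kappa0, h0, rho; split=> //; first exact: ltW.
suff main : forall p, (p <= l)%N -> exists2 K : R, 0 <= K &
  forall (N : nat) (T : finType) (kappa h : R) (z0 : T -> phase R d) (b : T -> nat -> 'rV[R]_d)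
    (s : seq ('I_N * T)) (n : nat) (i : 'I_N) (y : {ffun 'I_N -> T}) c,
  (0 < N)%N -> 0 <= kappa <= kappa0 -> 0 <= h <= h0 ->
  uniq [seq x.1 | x <- s] -> (0 < size s <= p)%N -> i \notin [seq x.1 | x <- s] ->
  let D := diffs (@upd N T) s (fun y => euler kappa gam a h g z0 b n y i) y in
  lyap a e (D.1 ord0 c) (D.2 ord0 c) <= (K * N%:R^-1 ^+ size s) ^+ 2.
  move=> p /main[K K0 HK]; exists (rho * K); first by rewrite mulr_ge0// ltW.
  move=> N T kappa h z0 b s n i y N0 kk hh us sz is_.
  have B0 : 0 <= K * N%:R^-1 ^+ size s by rewrite mulr_ge0// exprn_ge0// invr_ge0.
  have rB0 : 0 <= rho * K * N%:R^-1 ^+ size s by rewrite -mulrA mulr_ge0// ltW.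
  rewrite prod_normE ge_max; apply/andP.
  by split; apply: rV_norm_le => // c;
    have [] := Qrho _ _ _ B0 (HK N T kappa h z0 b s n i y c N0 kk hh us sz is_); rewrite -mulrA.
elim=> [|p IH] pl.
  by exists 0 => // N T kappa h z0 b s n i y c _ _ _ _; case: (size s).
have [K1 K10 HK1] := IH (ltnW pl).
pose K' := 2 * (rho * K1).
have K'0 : 0 <= K' by rewrite !mulr_ge0// ltW.
pose T0 := top_cst K' p * (comp_cst K' p * M) * K'.
have T00 : 0 <= T0.
  apply: mulr_ge0 => //; apply: mulr_ge0; first exact: top_cst_ge0.
  by apply: mulr_ge0 => //; exact: comp_cst_ge0.
pose B0 := T0 + p.+1%:R * (2 * (comp_cst K' p * M)).
have cc0 : 0 <= comp_cst K' p * M by apply: mulr_ge0 => //; exact: comp_cst_ge0.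
have B00 : 0 <= B0.
  by rewrite addr_ge0// mulr_ge0// mulr_ge0.
pose K := K1 + B0.
have K0 : 0 <= K by exact: addr_ge0.
exists K => // N T kappa h z0 b s n i y c N0 /andP[k0 kk0] hh us /andP[s0 sp] is_.
have k01 : 0 <= kappa <= kappa0 by rewrite k0.
have eps0 : 0 <= N%:R^-1 :> R by rewrite invr_ge0.
have eps1 : N%:R^-1 <= 1 :> R by rewrite invf_le1 ?ltr0n// ler1n.
move: sp; rewrite leq_eqVlt => /orP[/eqP sp|]; last first.
  rewrite ltnS => sp; cbv zeta.
  have sp1 : (0 < size s <= p)%N by rewrite s0.
  apply: (le_trans (HK1 N T kappa h z0 b s n i y c N0 k01 hh us sp1 is_)).
  rewrite ler_pXn2r ?nnegrE ?mulr_ge0 ?exprn_ge0//.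
  by rewrite ler_wpM2r ?exprn_ge0// lerDl.
have prev s' n' i' y' : uniq [seq x.1 | x <- s'] -> (0 < size s' <= p)%N ->
  i' \notin [seq x.1 | x <- s'] ->
  `|diffs (@upd N T) s' (fun y => (euler kappa gam a h g z0 b n' y i').1) y'| <= rho * K1 * N%:R^-1 ^+ size s'.
  move=> us' sz' is'; have B1 : 0 <= K1 * N%:R^-1 ^+ size s' by rewrite mulr_ge0// exprn_ge0.
  rewrite diffs_fst -mulrA; apply: rV_norm_le => [|c'].
    by rewrite mulr_ge0// ltW.
  by have [] := Qrho _ _ _ B1 (HK1 N T kappa h z0 b s' n' i' y' c' N0 k01 hh us' sz' is').
rewrite sp.
(* Induction on time for all particles outside [s] at once. At time 0 particle [i] depends on its
   own input only, so the difference vanishes. *)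
elim: n i is_ y c => [|n IHn] i is_ y c.
  rewrite (@diffs_local _ _ _ z0 i s y s0 is_) /= !mxE /lyap !mulr0 expr0n /= mulr0 !addr0.
  exact: sqr_ge0.
pose X (k : 'I_N) : {ffun 'I_N -> T} -> phase R d :=
  fun y => euler kappa gam a h g z0 b n y k.
set eps : R := N%:R^-1 in eps0 eps1 prev IHn *.
have IHx k y' : k \notin [seq x.1 | x <- s] ->
    `|diffs (@upd N T) s (fun y => (X k y).1) y'| <= rho * K * eps ^+ p.+1.
  move=> ks; have B1 : 0 <= K * eps ^+ p.+1 by rewrite mulr_ge0// exprn_ge0.
  rewrite diffs_fst -mulrA; apply: rV_norm_le => [|c']; first by rewrite mulr_ge0// ltW.
  by have [] := Qrho _ _ _ B1 (IHn k ks y' c').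
have sub_uniq (s1 s2 : seq ('I_N * T)) : subseq s1 s2 -> uniq [seq x.1 | x <- s2] -> uniq [seq x.1 | x <- s1].
  by move=> ss; apply: subseq_uniq; exact: map_subseq.
have sub_in (s1 s2 : seq ('I_N * T)) k : subseq s1 s2 -> k \notin [seq x.1 | x <- s2] -> k \notin [seq x.1 | x <- s1].
  by move=> ss; apply: contra; apply: mem_subseq; exact: map_subseq.
have prevB k s1 s' y' : uniq [seq x.1 | x <- s1] -> i \notin [seq x.1 | x <- s1] -> k \notin [seq x.1 | x <- s1] -> subseq s' s1 -> (0 < size s' <= p)%N ->
   `|diffs (@upd N T) s' (fun y => (X i y).1 - (X k y).1) y'| <= K' * eps ^+ size s'.
  move=> us1 is1 ks1 ss sz; rewrite diffsB (le_trans (ler_normB _ _))//.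
  rewrite /K' -mulrA mulr_natl mulr2n.
  by apply: lerD; apply: prev => //; [exact: sub_uniq us1|exact: sub_in is1|exact: sub_uniq us1|exact: sub_in ks1].
have notin k : k \notin [seq x.1 | x <- s] ->
    `|diffs (@upd N T) s (fun y => g ((X i y).1 - (X k y).1) ord0 c) y| <= (2 * M * rho * K + T0) * eps ^+ p.+1.
  move=> ks.
  have /= := @diffs_comp_top _ _ _ _ (@upd N T) eps eps0 eps1 _ (@updC N T) K' l s M
    (2 * (rho * K * eps ^+ p.+1)) (fun x => g x ord0 c) (fun y => (X i y).1 - (X k y).1) y K'0 M0.
  rewrite pairwise_distinct_coord s0 sp => /(_ us (gM c) pl).
  have e0 (t : seq ('I_N * T)) : t != [::] -> (0 < size t)%N by case: t.
  move=> h1; apply: (le_trans (h1 _ _)).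
  - move=> s' w ss /e0 s'0 sz; apply: (@prevB k s) => //.
    by rewrite s'0 -ltnS.
  - move=> w; rewrite diffsB (le_trans (ler_normB _ _))//.
    by rewrite mulr_natl mulr2n; apply: lerD; exact: IHx.
  - by rewrite /= -/T0 le_eqVlt; apply/orP; left; apply/eqP; ring.
(* Particle [k] reacts at order one to its own input, so this coordinate is pivoted out and one
   power of [eps] is lost; only p + 1 particles are concerned, and the prefactor kappa/N restores
   the power. *)
have isin k : k \in [seq x.1 | x <- s] ->
    `|diffs (@upd N T) s (fun y => g ((X i y).1 - (X k y).1) ord0 c) y| <= 2 * (comp_cst K' p * M) * eps ^+ p.
  move=> /mapP[ke kes ek]; have [s1 [s2 es]] : exists s1 s2, s = s1 ++ ke :: s2.
    by case/splitPr: kes => s1 s2; exists s1, s2.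
  have ss : subseq (s1 ++ s2) s by rewrite es cat_subseq// subseq_cons.
  have sz : size (s1 ++ s2) = p by move: sp; rewrite es !size_cat /= addnS => -[].
  have us' := sub_uniq _ _ ss us.
  have ks : k \notin [seq x.1 | x <- s1 ++ s2].
    move: us; rewrite es map_cat /= -ek -cat1s uniq_catCA /= => /andP[+ _].
    by rewrite map_cat.
  have bnd y' : `|diffs (@upd N T) (s1 ++ s2) (fun y => g ((X i y).1 - (X k y).1) ord0 c) y'| <= comp_cst K' p * M * eps ^+ p.
    have := @diffs_comp_le _ _ _ _ (@upd N T) eps eps0 eps1 _ (@updC N T) K' l (s1 ++ s2) M
      (fun x => g x ord0 c) (fun y => (X i y).1 - (X k y).1) y' K'0 M0.
    rewrite pairwise_distinct_coord sz => /(_ us' (gM c) (ltnW pl)); apply.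
    move=> s' w ss' s'0; apply: (@prevB k (s1 ++ s2)) => //.
      exact: sub_in is_.
    by rewrite -sz size_subseq// andbT lt0n size_eq0.
  rewrite es diffs_pivot -?es// (le_trans (ler_normB _ _))//.
  by rewrite -!mulrA mulr_natl mulr2n; apply: lerD; rewrite mulrA.
pose f := diffs (@upd N T) s (fun y => - (kappa * eps) * \sum_(j < N) g ((X i y).1 - (X j y).1) ord0 c) y.
have fb : `|f| <= kappa * (c1 * K * eps ^+ p.+1).
  have ke0 : 0 <= kappa * eps by exact: mulr_ge0.
  rewrite /f diffsZ normrM normrN (ger0_norm ke0).
  rewrite diffs_sum -[leLHS]mulrA; apply: ler_wpM2l => //.
  have -> : c1 * K * eps ^+ p.+1 = eps * (c1 * K * eps ^+ p) by rewrite exprS; ring.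
  apply: ler_wpM2l => //; apply: (le_trans (ler_norm_sum _ _ _)).
  rewrite (bigID (fun k => k \in [seq x.1 | x <- s])) /=.
  have P1 : \sum_(k < N | k \in [seq x.1 | x <- s]) `|diffs (@upd N T) s (fun y => g ((X i y).1 - (X k y).1) ord0 c) y|
      <= p.+1%:R * (2 * (comp_cst K' p * M)) * eps ^+ p.
    apply: (le_trans (ler_sum _ isin)).
    rewrite -big_uniq//= big_map big_const_seq count_predT iter_addr_0 sp.
    by rewrite -[leLHS]mulr_natl !mulrA.
  have P2 : \sum_(k < N | k \notin [seq x.1 | x <- s]) `|diffs (@upd N T) s (fun y => g ((X i y).1 - (X k y).1) ord0 c) y|
      <= (2 * M * rho * K + T0) * eps ^+ p.
    apply: (le_trans (ler_sum _ notin)).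
    have tt0 : 0 <= (2 * M * rho * K + T0) * eps ^+ p.+1.
      by rewrite mulr_ge0 ?exprn_ge0// addr_ge0// !mulr_ge0// ltW.
    apply: (@le_trans _ _ (\sum_(k < N) (2 * M * rho * K + T0) * eps ^+ p.+1)).
      by rewrite [leRHS](bigID (fun k => k \in [seq x.1 | x <- s])) /= lerDr sumr_ge0.
    rewrite sumr_const card_ord -[leLHS]mulr_natl exprS mulrCA mulrA.
    rewrite /eps -mulrA (mulrA N%:R) divff ?mul1r// pnatr_eq0 -lt0n//.
  apply: (le_trans (lerD P1 P2)).
  rewrite -mulrDl; apply: ler_wpM2r; first exact: exprn_ge0.
  have -> : c1 * K = 2 * M * rho * K + K by rewrite /c1 mulrDl mul1r.
  by rewrite addrCA lerD2l (addrC _ T0) -/B0 lerDr.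
cbv zeta; set D := diffs _ _ _ _.
pose Dn := diffs (@upd N T) s (X i) y.
have eD1 : D.1 ord0 c = Dn.1 ord0 c + h * Dn.2 ord0 c.
  rewrite /D /Dn -!diffs_fst -!diffs_snd !diffs_coord -diffsZ -diffsD.
  by apply: eq_diffs => z /=; rewrite !mxE.
have eD2 : D.2 ord0 c = Dn.2 ord0 c + h * (f - gam * Dn.2 ord0 c - a * Dn.1 ord0 c).
  have e3 : diffs (@upd N T) s (fun y => b (y i) n ord0 c) y = 0.
    exact: (@diffs_local _ _ _ (fun e => b e n ord0 c)).
  rewrite -[RHS]addr0 -e3 /D /Dn -!diffs_fst -!diffs_snd !diffs_coord /f.
  rewrite -(diffsZ gam) -(diffsZ a) -!diffsB -diffsZ -!diffsD.
  apply: eq_diffs => z /=; rewrite !mxE summxE; congr (_ + _ * (_ - _ - _) + _).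
  by rewrite -mulNr.
rewrite eD1 eD2.
have [lh /le_trans] := Qstep h (Dn.1 ord0 c) (Dn.2 ord0 c) f hh; apply.
have KK := IHn i is_ y c.
set KE := K * eps ^+ p.+1 in KK *.
have f2 : f ^+ 2 <= (kappa * c1) ^+ 2 * KE ^+ 2.
  have KE0 : 0 <= KE by rewrite mulr_ge0// exprn_ge0.
  have fb' : `|f| <= kappa * c1 * KE by move: fb; rewrite /KE !mulrA.
  rewrite -exprMn -[leLHS]real_normK ?num_real// ler_pXn2r// nnegrE.
  by apply: mulr_ge0 => //; apply: mulr_ge0 => //; exact: ltW.
have k1 : kappa <= 1 by rewrite (le_trans kk0)// /kappa0 ge_min lexx.
have kl : C * (kappa * c1) ^+ 2 <= lam.
  have : kappa <= lam / (C * c1 ^+ 2) by rewrite (le_trans kk0)// /kappa0 ge_min lexx orbT.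
  rewrite ler_pdivlMr// => kl; apply: le_trans kl.
  rewrite exprMn mulrCA; apply: ler_wpM2r; first exact: ltW.
  by rewrite expr2 ler_piMr.
have h_0 : 0 <= h by case/andP: hh.
have t1 := ler_wpM2l lh KK.
have t2 : h * C * f ^+ 2 <= h * lam * KE ^+ 2.
  rewrite -2!mulrA; apply: ler_wpM2l => //.
  apply: (le_trans (ler_wpM2l (ltW C0) f2)); rewrite mulrA.
  by apply: ler_wpM2r => //; exact: sqr_ge0.
(* What the contraction removes, the source at most restores: the bound is reproduced with the same
   constant at every time step. *)
apply: (le_trans (lerD t1 t2)).
rewrite le_eqVlt; apply/orP; left; apply/eqP; ring.
Qed.

End euler_differences.

(** A difference in the coordinate [r a] of the particle itself is pivoted out, at the cost of a
    factor 2 and with no gain in N; this is the weight 1 at [r a]. *)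
Lemma diff_bound_comp (R : realType) (V : normedZmodType R) (N : nat) (T : finType)
    (I : finType) (r : I -> 'I_N) (a : I) (m : nat) (K M : R)
    (phi : V -> R) (Z : {ffun 'I_N -> T} -> V) :
  (0 < N)%N -> 0 <= K -> 0 <= M -> fd_bound m M phi ->
  (forall s y, uniq [seq x.1 | x <- s] -> (0 < size s <= m)%N ->
    r a \notin [seq x.1 | x <- s] ->
    `|diffs (@upd N T) s Z y| <= K * N%:R^-1 ^+ size s) ->
  diff_bound [::] m (weight r [set a]) (2 * (\sum_(k < m.+1) comp_cst K k) * M) (phi \o Z).
Proof.
move=> N0 K0 M0 fM HZ.
set C := \sum_(k < m.+1) _.
have eps0 : 0 <= N%:R^-1 :> R by rewrite invr_ge0.
have eps1 : N%:R^-1 <= 1 :> R by rewrite invf_le1 ?ltr0n// ler1n.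
have Ck k : (k <= m)%N -> comp_cst K k <= C.
  move=> km; rewrite /C (bigD1 (Ordinal (n := m.+1) (m := k) km)) //= lerDl sumr_ge0// => j _.
  exact: comp_cst_ge0.
have C0 : 0 <= C by apply: sumr_ge0 => j _; exact: comp_cst_ge0.
have out s y : uniq [seq x.1 | x <- s] -> (size s <= m)%N -> r a \notin [seq x.1 | x <- s] ->
    `|diffs (@upd N T) s (phi \o Z) y| <= C * M * N%:R^-1 ^+ size s.
  move=> us sz ras.
  have := @diffs_comp_le _ _ _ _ (@upd N T) _ eps0 eps1 _ (@updC N T) K m s M phi Z y K0 M0.
  rewrite pairwise_distinct_coord => /(_ us fM sz) h.
  apply: le_trans (h _) _ => [s' w ss s'0|].
    apply: HZ.
    - by apply: subseq_uniq us; exact: map_subseq.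
    - by rewrite lt0n size_eq0 s'0 (leq_trans (size_subseq ss)).
    - by apply: contra ras; apply: mem_subseq; exact: map_subseq.
  by rewrite ler_wpM2r ?exprn_ge0// ler_wpM2r// Ck.
have w1 s : r a \notin [seq x.1 | x <- s] ->
    \prod_(x <- s) weight r [set a] x.1 = (N%:R^-1 : R) ^+ size s.
  elim: s => [|x s IH]; first by rewrite big_nil.
  rewrite /= inE negb_or => /andP[xa sa]; rewrite big_cons IH// exprS; congr (_ * _).
  by rewrite /weight imset_set1 inE eq_sym (negbTE xa).
move=> s y us sz.
have [ras|ras] := boolP (r a \in [seq x.1 | x <- s]); last first.
  rewrite w1// (le_trans (out _ _ us sz ras))// ler_wpM2r ?exprn_ge0//.
  by rewrite ler_wpM2r// mulr_natl mulr2n lerDl.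
have [x xs ex] := mapP ras.
have [s1 [s2 es]] : exists s1 s2, s = s1 ++ x :: s2.
  by case/splitPr: xs => s1 s2; exists s1, s2.
have us' : uniq (x.1 :: [seq x.1 | x <- s1 ++ s2]).
  by move: us; rewrite /= es !map_cat /= -cat1s uniq_catCA.
have ras' : r a \notin [seq x.1 | x <- s1 ++ s2] by rewrite ex; case/andP: us'.
have us'' : uniq [seq x.1 | x <- s1 ++ s2] by case/andP: us'.
have sz' : (size (s1 ++ s2) <= m)%N.
  by apply: leq_trans sz; rewrite es !size_cat leq_add2l.
rewrite es diffs_pivot -?es// (le_trans (ler_normB _ _))// es.
have -> : \prod_(x <- s1 ++ x :: s2) weight r [set a] x.1 = (N%:R^-1 : R) ^+ size (s1 ++ s2).
  rewrite big_cat /= big_cons mulrCA -big_cat /= w1//.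
  by rewrite /weight imset_set1 inE -ex eqxx mul1r.
rewrite -!mulrA mulr_natl mulr2n; apply: lerD; rewrite mulrA; exact: out.
Qed.

Lemma finite_cumulant_bound (R : realType) (d m : nat) (gam a : R)
    (g : 'rV[R]_d -> 'rV[R]_d) (M M2 : R) :
  0 < gam -> 0 < a -> 0 <= M -> 0 <= M2 -> (forall c, fd_bound m M (fun x => g x ord0 c)) ->
  exists kappa0 h0 : R, [/\ 0 < kappa0, 0 < h0 & exists2 C : R, 0 <= C &
  forall (N : nat) (T : finType) (p : T -> R) (kappa h : R) (z0 : T -> phase R d)
    (b : T -> nat -> 'rV[R]_d) (r : 'I_m -> 'I_N) (phi : 'I_m -> phase R d -> R) (n : nat),
  (0 < N)%N -> injective r -> (forall e, 0 <= p e) -> \sum_e p e = 1 ->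
  0 <= kappa <= kappa0 -> 0 <= h <= h0 -> (forall j, fd_bound m M2 (phi j)) -> (0 < m)%N ->
  `|log_set (fun B => mean p (fun y => \prod_(j in B) phi j (euler kappa gam a h g z0 b n y (r j))))
     [set: 'I_m]%SET| <= C * N%:R^-1 ^+ m.-1].
Proof.
move=> gam0 a0 M0 M20 gM.
have [kappa0 [h0 [rho [k0 hp0 _ H]]]] := euler_differences gam0 a0 M0 gM.
exists kappa0, h0; split => //.
have [K K0 HK] := H m (leqnn m).
pose c0 : R := 2 * (\sum_(k < m.+1) comp_cst K k) * M2.
have c00 : 0 <= c0 by rewrite !mulr_ge0// sumr_ge0// => k _; exact: comp_cst_ge0.
have [C C0 HC] := @diff_bound_cumulant R 'I_m m 0 c0 c00.
exists C => // N T p kappa h z0 b r phi n N0 r_inj p0 p1 kk hh phiM m0.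
pose X (j : 'I_m) (y : {ffun 'I_N -> T}) := phi j (euler kappa gam a h g z0 b n y (r j)).
have Xb j : diff_bound [::] (0 + m) (weight r [set j]%SET) c0 (X j).
  apply: (@diff_bound_comp _ _ N T _ r j m K M2 (phi j) (fun y => euler kappa gam a h g z0 b n y (r j))) => //.
  by move=> s y us sz rj; apply: HK.
have mT : [set: 'I_m]%SET != finset.set0 by rewrite -card_gt0 cardsT card_ord.
have := HC N T p X r N0 r_inj p0 p1 Xb (enum 'I_N) [set: 'I_m]%SET (enum_uniq _) mT.
rewrite cardsT card_ord => /(_ (leqnn m)).
(* The fully averaged cumulant is a constant function, but evaluating it requires some
   configuration; the probabilities sum to 1, so [T] is nonempty. *)
have [e _|noT] := pickP (fun e : T => true); last first.
  by move: p1; rewrite big_pred0// => /esym/eqP; rewrite oner_eq0.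
move=> /(_ [::] [ffun=> e] isT isT); rewrite big_nil mulr1 /=.
congr (`|_| <= _); apply: eq_bigr => Q _; congr (_ * _); apply: eq_bigr => B _.
exact: partial_avg_mean.
Qed.

(** * Coordinates of the phase space *)

Section phase_coordinates.
Context {R : realType} {d : nat}.
Local Notation J := ('I_d + 'I_d)%type.
Implicit Types (z : phase R d) (i : J).

Definition pcoord i z : R := match i with inl j => z.1 ord0 j | inr j => z.2 ord0 j end.

Definition of_pcoord (c : J -> R) : phase R d := (\row_j c (inl j), \row_j c (inr j)).

Lemma pcoord_of c i : pcoord i (of_pcoord c) = c i.
Proof. by case: i => j /=; rewrite mxE. Qed.

Lemma pcoordD i z z' : pcoord i (z + z') = pcoord i z + pcoord i z'.
Proof. by case: i => j /=; rewrite mxE. Qed.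

Lemma pcoordB i z z' : pcoord i (z - z') = pcoord i z - pcoord i z'.
Proof. by case: i => j /=; rewrite !mxE. Qed.

Lemma pcoordZ i (t : R) z : pcoord i (t *: z) = t * pcoord i z.
Proof. by case: i => j /=; rewrite mxE. Qed.

Lemma pcoord_dir i j : pcoord i (phase_dir R j) = (i == j)%:R.
Proof. by case: i => i; case: j => j //=; rewrite !mxE. Qed.

Lemma pcoord_inj z z' : (forall i, pcoord i z = pcoord i z') -> z = z'.
Proof.
case: z z' => [x v] [x' v'] h; congr pair; apply/rowP => j.
  exact: (h (inl j)).
exact: (h (inr j)).
Qed.

Lemma pcoord_le i z : `|pcoord i z| <= `|z|.
Proof.
rewrite prod_normE le_max; case: i => j /=; rewrite rV_coord_le ?orbT//.
Qed.

Lemma pnorm_le z b : 0 <= b -> (forall i, `|pcoord i z| <= b) -> `|z| <= b.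
Proof.
move=> b0 h; rewrite prod_normE ge_max; apply/andP.
by split; apply: rV_norm_le => // c; [exact: (h (inl c))|exact: (h (inr c))].
Qed.

Lemma measurable_pcoord i : measurable_fun setT (pcoord i).
Proof.
case: i => j; apply: (measurableT_comp (measurable_coord j)).
  exact: measurable_fst.
exact: measurable_snd.
Qed.

Lemma measurable_floor_code (n : nat) (k : int) :
  measurable [set x : R | Num.floor (x * n.+1%:R) = k].
Proof.
rewrite (_ : [set _ | _] = [set` `[k%:~R / n.+1%:R, (k + 1)%:~R / n.+1%:R[ ])//.
apply/seteqP; split => x /=; rewrite in_itv /= ler_pdivrMr ?ltr_pdivlMr//.
  by move=> <-; rewrite floor_itv//.
by move=> h; apply/floor_def.
Qed.

Definition codes (n : nat) z : {ffun J -> int} :=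
  [ffun i => Num.floor (pcoord i z * n.+1%:R)].

Definition decode (n : nat) (c : {ffun J -> int}) : phase R d :=
  of_pcoord (fun i => (c i)%:~R / n.+1%:R).

Lemma decode_codes n z : `|decode n (codes n z) - z| <= n.+1%:R^-1.
Proof.
apply: pnorm_le => // i; rewrite pcoordB pcoord_of ffunE.
have n0 : 0 < n.+1%:R :> R by [].
have /andP[h1 h2] := floor_itv (pcoord i z * n.+1%:R).
set k := Num.floor _ in h1 h2 *.
have -> : k%:~R / n.+1%:R - pcoord i z = (k%:~R - pcoord i z * n.+1%:R) / n.+1%:R.
  by rewrite mulrBl mulfK// lt0r_neq0.
rewrite normrM [`|_^-1|]gtr0_norm ?invr_gt0//.
apply: ler_piMl; first by rewrite invr_ge0 ltW.
rewrite distrC ger0_norm; last by rewrite subr_ge0.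
by rewrite lerBlDl; move: h2; rewrite intrD => /ltW.
Qed.

Lemma measurable_codes n c : measurable [set z | codes n z = c].
Proof.
rewrite (_ : [set _ | _] = \bigcap_(i in [set: J]) (pcoord i @^-1` [set x | Num.floor (x * n.+1%:R) = c i])).
  apply: fin_bigcap_measurable => // i _; rewrite -[X in measurable X]setTI.
  apply: measurable_pcoord => //; exact: measurable_floor_code.
apply/seteqP; split => z /=; first by move=> <- i _ /=; rewrite ffunE.
by move=> h; apply/ffunP => i; rewrite ffunE; exact: (h i).
Qed.

Lemma measurable_fun_codes n (f : {ffun J -> int} -> R) :
  measurable_fun setT (fun z => f (codes n z)).
Proof.
move=> _ B mB; rewrite setTI.
rewrite (_ : _ @^-1` B = \bigcup_(c : {ffun J -> int}) (if f c \in B then [set z | codes n z = c] else set0)).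
  apply: countable_bigcupT_measurable => [|c]; first exact: countableP.
  by case: ifP => _ //; exact: measurable_codes.
apply/seteqP; split => z /=.
  by move=> fB; exists (codes n z) => //; rewrite mem_set.
by move=> [c _]; case: ifPn => // /set_mem fc /= ->.
Qed.

(** The sigma-algebra is generated by the coordinates; [phi] is a pointwise limit of functions of
    the grid cell, which take countably many values. *)
Lemma continuous_measurable_phase (phi : phase R d -> R) :
  continuous phi -> measurable_fun setT phi.
Proof.
move=> cphi; apply/measurable_EFinP.
apply: (@emeasurable_fun_cvg _ _ _ _ (fun n z => (phi (decode n (codes n z)))%:E)).
  by move=> n; apply/measurable_EFinP; exact: (measurable_fun_codes n (phi \o decode n)).
move=> z _; apply: cvg_EFin; first exact: nearW.
apply: (@cvg_comp _ _ _ (fun n => decode n (codes n z)) phi _ (nbhs z)); last exact: cphi.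
apply/cvgrPdist_le => e e0; near=> n.
rewrite distrC (le_trans (decode_codes n z))//.
apply: ltW; near: n; exact: (near_infty_natSinv_lt (PosNum e0)).
Unshelve. all: by end_near. Qed.

End phase_coordinates.

(** * From derivatives to finite differences *)

Section smooth_differences.
Context {R : realType} {V : normedModType R}.
Implicit Types (f G : V -> R) (x h v : V).

Lemma is_diff_shift h x : is_diff x (fun z : V => z + h) id.
Proof. by apply: is_diff_eq; rewrite addr0. Qed.

Lemma differentiable_shift f h x : differentiable f (x + h) ->
  differentiable (fun z => f (z + h)) x.
Proof.
move=> df; have [d1 _] := is_diff_shift h x.
exact: (@differentiable_comp _ _ _ _ (fun z => z + h) f).
Qed.

Lemma derive_shift f h v x : 'D_v (fun z => f (z + h)) x = 'D_v f (x + h).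
Proof.
have e : (fun t : R => t^-1 *: (((fun z => f (z + h)) \o shift x) (t *: v) - f (x + h))) =
    (fun t => t^-1 *: ((f \o shift (x + h)) (t *: v) - f (x + h))).
  by apply/funext => t /=; rewrite addrA.
by rewrite /derive e.
Qed.

Lemma segment_derive G x h t : differentiable G (x + t *: h) ->
  is_derive t 1 (fun t : R => G (x + t *: h)) ('D_h G (x + t *: h)).
Proof.
move=> dG.
have d1 : is_diff t (fun t : R => x + t *: h) (fun s => s *: h).
  by apply: is_diff_eq; apply/funext => s /=; rewrite add0r.
have d3 : is_diff (x + t *: h) G ('d G (x + t *: h)) by exact: DiffDef.
have [d2 e2] : is_diff t (G \o (fun t : R => x + t *: h))
    ('d G (x + t *: h) \o (fun s => s *: h)) by exact: is_diff_comp.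
apply: DeriveDef; first exact: diff_derivable.
by rewrite deriveE// e2 /= scale1r deriveE.
Qed.

Lemma increment_le G x h (B : R) : (forall z, differentiable G z) ->
  (forall z, `|'D_h G z| <= B) -> `|G (x + h) - G x| <= B.
Proof.
move=> dG DB.
pose f (t : R) := G (x + t *: h).
have df (t : R) : is_derive t 1 f ('D_h G (x + t *: h)) by exact: segment_derive.
have cf : {within `[0, 1], continuous f}.
  apply: derivable_within_continuous => t _; by have [] := df t.
have [c _] := MVT_segment ler01 (fun t _ => df t) cf.
by rewrite /f scale1r scale0r addr0 subr0 mulr1 => ->.
Qed.

Lemma differentiable_delta f H x : (forall z, differentiable f z) ->
  differentiable (delta H f) x.
Proof.
elim: H f => //= h H IH f df; apply: IH => z.
by apply: differentiableB => //; exact: differentiable_shift.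
Qed.

Lemma derive_delta f H v x : (forall z, differentiable f z) ->
  'D_v (delta H f) x = delta H ('D_v f) x.
Proof.
elim: H f => //= h H IH f df; rewrite IH => [|z]; last first.
  by apply: differentiableB => //; exact: differentiable_shift.
apply: eq_diffs => z; rewrite /step_diff deriveB ?derive_shift//.
  by apply: diff_derivable; exact: differentiable_shift.
exact: diff_derivable.
Qed.

(** Puts the first increment outermost, where the mean value theorem applies to a function already
    differenced by the others. *)
Lemma deltaC h H f x : delta (h :: H) f x = delta H f (x + h) - delta H f x.
Proof. by rewrite /= diffsB delta_shift. Qed.

End smooth_differences.

Section smooth_fd_bound.
Context {R : realType} {d : nat}.
Implicit Types (f : 'rV[R]_d -> R).
Local Notation P := (partials (@rV_dir R d)).

Lemma derive_sum_dir f (h x : 'rV[R]_d) : differentiable f x ->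
  'D_h f x = \sum_i h ord0 i * 'D_(rV_dir R i) f x.
Proof.
move=> df; rewrite deriveE// [in LHS](row_sum_delta h) linear_sum /=.
by apply: eq_bigr => i _; rewrite linearZ /= deriveE.
Qed.

(** Each mean value step trades an increment for a directional derivative, which commutes with the
    other differences and expands into d partial derivatives: a factor d |h| per order. *)
Lemma smooth_delta_le f l (M : R) H x : 0 <= M -> (size H <= l)%N ->
  (forall s x, differentiable (P s f) x) ->
  (forall s x, (size s <= l)%N -> `|P s f x| <= M) ->
  `|delta H f x| <= d%:R ^+ size H * M * \prod_(h <- H) `|h|.
Proof.
move=> M0; elim: H f l x => [|h H IH] f l x.
  by move=> _ _ fM; rewrite big_nil expr0 mul1r mulr1; exact: (fM [::]).
case: l => // l sz sf fM.
have df z : differentiable f z by exact: (sf [::]).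
rewrite deltaC; apply: increment_le => [z|z]; first exact: differentiable_delta.
rewrite derive_delta//.
rewrite (@eq_diffs _ _ _ _ _ _ (fun z => \sum_i h ord0 i * 'D_(rV_dir R i) f z)); last first.
  by move=> z'; rewrite derive_sum_dir.
rewrite diffs_sum (le_trans (ler_norm_sum _ _ _))//.
have zz i : `|delta H (fun v => h ord0 i * 'D_(rV_dir R i) f v) z| <= `|h| * (d%:R ^+ size H * M * \prod_(h <- H) `|h|).
  have -> : delta H (fun v => h ord0 i * 'D_(rV_dir R i) f v) z = h ord0 i * delta H ('D_(rV_dir R i) f) z.
    have hz (k : R) (H' : seq 'rV[R]_d) F : delta H' (fun v => k * F v) z = k * delta H' F z.
      elim: H' F => //= k' H' IH' F; rewrite -IH'.
      by apply: eq_diffs => t; rewrite /step_diff mulrBr.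
    exact: hz.
  rewrite normrM ler_pM ?rV_coord_le//.
  have eP s : P s ('D_(rV_dir R i) f) = P (rcons s i) f.
    by rewrite /partials -cats1 foldr_cat.
  apply: (IH _ l) => // s z'; first by rewrite eP.
  by move=> ss; rewrite eP; apply: fM; rewrite size_rcons.
apply: (le_trans (ler_sum _ (fun i _ => zz i))).
rewrite sumr_const card_ord -[leLHS]mulr_natl big_cons /= exprS.
by rewrite le_eqVlt; apply/orP; left; apply/eqP; ring.
Qed.

Lemma smooth_bounded_uniform f l : smooth_bounded (@rV_dir R d) f ->
  exists2 M : R, 0 <= M & forall s x, (size s <= l)%N -> `|P s f x| <= M.
Proof.
move=> [_ fb]; elim: l f fb => [|l IH] f fb.
  have [M HM] := fb [::]; exists `|M| => // -[|//] x _.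
  by rewrite (le_trans (HM x))// ler_norm.
have [M0 HM0] := fb [::].
have eP s i : P s ('D_(rV_dir R i) f) = P (rcons s i) f.
  by rewrite /partials -cats1 foldr_cat.
have Hi i : exists M : R, 0 <= M /\ forall s x, (size s <= l)%N -> `|P s ('D_(rV_dir R i) f) x| <= M.
  have [] := IH ('D_(rV_dir R i) f); last by move=> M ? ?; exists M.
  by move=> s; rewrite eP; exact: fb.
have [Mi HMi] := choice Hi.
exists (`|M0| + \sum_i Mi i).
  by rewrite addr_ge0// sumr_ge0// => i _; case: (HMi i).
move=> s x; case: (lastP s) => [_|s' i].
  rewrite (le_trans (HM0 x))// (le_trans (ler_norm _))// lerDl sumr_ge0// => i _.
  by case: (HMi i).
rewrite size_rcons ltnS => sz; rewrite -eP; have [_ h] := HMi i.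
rewrite (le_trans (h _ _ sz))// (bigD1 i)//= addrCA lerDl addr_ge0// sumr_ge0// => j _.
by case: (HMi j).
Qed.

Lemma smooth_bounded_grad_fd_bound f l : smooth_bounded (@rV_dir R d) f ->
  exists2 M : R, 0 <= M & forall c, fd_bound l M (fun x => grad f x ord0 c).
Proof.
move=> sbf; have [sf _] := sbf; have [M M0 HM] := smooth_bounded_uniform l.+1 sbf.
(* The base 1 + d is at least 1, so the power [l] covers all lower orders too. *)
exists ((1 + d%:R) ^+ l * M); first by rewrite mulr_ge0// exprn_ge0// addr_ge0.
move=> c H x sz.
rewrite (@eq_diffs _ _ _ _ _ _ ('D_(rV_dir R c) f)); last by move=> z; rewrite mxE.
have eP s : P s ('D_(rV_dir R c) f) = P (rcons s c) f.
  by rewrite /partials -cats1 foldr_cat.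
apply: (le_trans (@smooth_delta_le ('D_(rV_dir R c) f) l M H x M0 sz _ _)).
- by move=> s z; rewrite eP; exact: sf.
- by move=> s z ss; rewrite eP; apply: HM; rewrite size_rcons.
apply: ler_wpM2r; first by apply: prodr_ge0 => h _.
apply: ler_wpM2r => //; apply: (@le_trans _ _ ((1 + d%:R) ^+ size H)).
  by rewrite lerXn2r ?nnegrE ?addr_ge0// lerDr.
by rewrite ler_weXn2l// lerDl.
Qed.

End smooth_fd_bound.

(** * Smooth functions on the line and the flat functions at 0 *)

Section smooth_functions_of_a_real.
Context {R : realType}.
Implicit Types (f g df dg : R -> R) (x : R).

Lemma is_derive_add f g x (a b : R) : is_derive x 1 f a -> is_derive x 1 g b ->
  is_derive x 1 (fun x => f x + g x) (a + b).
Proof. by move=> df dg; exact: is_deriveD. Qed.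

Lemma is_derive_sub f g x (a b : R) : is_derive x 1 f a -> is_derive x 1 g b ->
  is_derive x 1 (fun x => f x - g x) (a - b).
Proof. by move=> df dg; exact: is_deriveB. Qed.

Lemma is_derive_mul f g x (a b : R) : is_derive x 1 f a -> is_derive x 1 g b ->
  is_derive x 1 (fun x => f x * g x) (a * g x + f x * b).
Proof.
move=> df dg; have h := @is_deriveM _ _ f g x 1 a b df dg.
by apply: (is_derive_eq h); rewrite /GRing.scale /=; ring.
Qed.

Lemma is_derive_affine f x (u c a : R) : is_derive (u * x + c) 1 f a ->
  is_derive x 1 (fun x => f (u * x + c)) (u * a).
Proof.
move=> df; have d1 : is_derive x 1 (fun x : R => u * x + c) u.
  have hu := is_derive_mul (is_derive_cst u x 1) (is_derive_id x 1).
  have h := is_derive_add hu (is_derive_cst c x 1).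
  by apply: (is_derive_eq h); rewrite mul0r add0r mulr1 addr0.
have h := @is_derive1_comp _ f (fun x : R => u * x + c) x a u df d1.
by apply: (is_derive_eq h); rewrite mulrC.
Qed.

(** The derivative is supplied as a witness, which gives closure under sums, products and affine
    changes of variable by plain induction. *)
Fixpoint smooth_upto n f : Prop :=
  if n is n'.+1 then
    exists2 df, (forall x, is_derive x 1 f (df x)) & smooth_upto n' df
  else True.

Definition smooth1 f := forall n, smooth_upto n f.

Lemma smooth_uptoW n f : smooth_upto n.+1 f -> smooth_upto n f.
Proof. by elim: n f => // n IH f [df fdf sdf]; exists df => //; exact: IH. Qed.

Lemma smooth_uptoD n f g : smooth_upto n f -> smooth_upto n g ->
  smooth_upto n (fun x => f x + g x).
Proof.
elim: n f g => // n IH f g [df fdf sf] [dg gdg sg].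
exists (fun x => df x + dg x) => [x|]; [exact: is_derive_add|exact: IH].
Qed.

Lemma smooth_upto_cst n (c : R) : smooth_upto n (fun=> c).
Proof. by elim: n c => // n IH c; exists (fun=> 0) => // x; exact: is_derive_cst. Qed.

Lemma smooth_uptoM n f g : smooth_upto n f -> smooth_upto n g ->
  smooth_upto n (fun x => f x * g x).
Proof.
elim: n f g => // n IH f g /[dup] sf [df fdf sdf] /[dup] sg [dg gdg sdg].
exists (fun x => df x * g x + f x * dg x) => [x|]; first exact: is_derive_mul.
by apply: smooth_uptoD; apply: IH => //; exact: smooth_uptoW.
Qed.

Lemma smooth_upto_affine n f (u c : R) : smooth_upto n f ->
  smooth_upto n (fun x => f (u * x + c)).
Proof.
elim: n f => // n IH f [df fdf sdf].
exists (fun x => u * df (u * x + c)) => [x|]; first exact: is_derive_affine.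
by apply: smooth_uptoM; [exact: smooth_upto_cst|exact: IH].
Qed.

Lemma smooth1_derive1 f : smooth1 f -> smooth1 (derive1 f).
Proof.
move=> sf n; have [df fdf sdf] := sf n.+1.
suff -> : (derive1 f) = df by [].
by apply/funext => x; rewrite derive1E; have [_ ->] := fdf x.
Qed.

Lemma smooth1_is_derive f x : smooth1 f -> is_derive x 1 f ((derive1 f) x).
Proof.
move=> /(_ 1) [df fdf _]; rewrite derive1E; have [d _] := fdf x.
exact: derivableP.
Qed.

Lemma smooth1_derive1n f n : smooth1 f -> smooth1 (derive1n n f).
Proof. by elim: n f => // n IH f sf; rewrite derive1nS; exact/smooth1_derive1/IH. Qed.

Lemma smooth1_continuous f : smooth1 f -> continuous f.
Proof.
move=> sf x; apply: differentiable_continuous; apply/derivable1_diffP.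
by have [] := smooth1_is_derive x sf.
Qed.

(** The span of this family is stable under differentiation, so smoothness of all members is proved
    at once. *)
Definition flat (k : nat) x : R :=
  if 0 < x then x^-1 ^+ k * expR (- x^-1) else 0.

Lemma flat_ge0 k x : 0 <= flat k x.
Proof.
rewrite /flat; case: ifP => // x0; rewrite mulr_ge0 ?expR_ge0// exprn_ge0//.
by rewrite invr_ge0 ltW.
Qed.

(** One term of the exponential series. Since flat k h / |h| equals flat k.+1 h, this linear bound
    makes the difference quotient of [flat k] vanish at 0. *)
Lemma flat_le k x : flat k.+1 x <= k.+2`!%:R * `|x|.
Proof.
rewrite /flat; case: ifP => [x0|_]; last by rewrite mulr_ge0.
rewrite gtr0_norm// expRN ler_pdivrMr ?expR_gt0//.
have u0 : 0 <= x^-1 by rewrite invr_ge0 ltW.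
have h : x^-1 ^+ k.+2 / k.+2`!%:R <= expR x^-1.
  by apply: le_trans (expR_ge1Dxn k.+1 u0); rewrite lerDr.
have f0 : 0 < k.+2`!%:R :> R by rewrite ltr0n fact_gt0.
have := ler_wpM2l (ltW (mulr_gt0 f0 x0)) h; apply: le_trans.
by rewrite le_eqVlt; apply/orP; left; apply/eqP; rewrite [in RHS]exprS; field; rewrite !gt_eqF.
Qed.

Lemma flat_pos_derive k x : 0 < x ->
  is_derive x 1 (fun x : R => x^-1 ^+ k * expR (- x^-1))
    (flat k.+2 x - k%:R * flat k.+1 x).
Proof.
move=> x0; have xn0 : x != 0 by rewrite gt_eqF.
have di : is_derive x 1 (fun x : R => x^-1) (- x ^- 2).
  apply: DeriveDef; first by apply: derivableV.
  by rewrite deriveV// derive_id /GRing.scale /= mulr1.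
have dX : is_derive x 1 (fun x : R => x^-1 ^+ k) (k%:R * x^-1 ^+ k.-1 * (- x ^- 2)).
  have h := @is_deriveX _ _ (fun x : R => x^-1) k x 1 _ di.
  have -> : (fun x : R => x^-1 ^+ k) = (fun x : R => x^-1) ^+ k by apply/funext => y; rewrite exprfctE.
  by apply: (is_derive_eq h); rewrite /GRing.scale /= mulr_natl.
have dE : is_derive x 1 (fun x : R => expR (- x^-1)) (expR (- x^-1) * (x ^- 2)).
  have dN : is_derive x 1 (fun x : R => - x^-1) (x ^- 2).
    have h := @is_deriveN _ _ _ (fun x : R => x^-1) x 1 _ di.
    by apply: (is_derive_eq h); rewrite opprK.
  have h := @is_derive1_comp _ expR (fun x : R => - x^-1) x _ _ (is_derive_expR _) dN.
  exact: (is_derive_eq h).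
apply: (is_derive_eq (is_derive_mul dX dE)).
rewrite /flat x0; case: k {dX} => [|k] /=; first by rewrite !mul0r add0r subr0 ?expr0 ?mul1r exprVn mulrC.
by rewrite !exprS; field.
Qed.

Lemma flat_derive k x : is_derive x 1 (flat k) (flat k.+2 x - k%:R * flat k.+1 x).
Proof.
have [x0|x0|->] := ltgtP x 0.
- have -> : flat k.+2 x - k%:R * flat k.+1 x = 0.
    by rewrite /flat ltNge (ltW x0) /= mulr0 subr0.
  apply: (@near_eq_is_derive _ _ _ (fun=> 0)).
  near=> y; rewrite /flat ltNge ltW//; near: y; exact: lt_nbhsl.
- apply: (@near_eq_is_derive _ _ _ (fun x : R => x^-1 ^+ k * expR (- x^-1))); last exact: flat_pos_derive.
  near=> y; rewrite /flat ifT//; near: y; exact: lt_nbhsr.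
have e0 j : flat j 0 = 0 by rewrite /flat ltxx.
rewrite !e0 mulr0 subr0.
have cv : h^-1 *: ((flat k \o shift 0) (h *: 1) - flat k 0) @[h --> 0^'] --> (0 : R).
  apply/cvgr0Pnorm_le => e e_gt0; near=> h.
  rewrite /= e0 subr0 addr0 [h *: 1]mulr1 /GRing.scale /=.
  have h0 : h != 0 by near: h; exact: nbhs_dnbhs_neq.
  rewrite normrM (ger0_norm (flat_ge0 _ _)) normfV.
  have -> : `|h|^-1 * flat k h = flat k.+1 h.
    rewrite /flat; case: ifPn => [hp|_]; last by rewrite mulr0.
    by rewrite gtr0_norm// exprS mulrA.
  rewrite (le_trans (flat_le _ _))// -ler_pdivlMl ?ltr0n ?fact_gt0//.
  near: h; apply: dnbhs0_le.
  by rewrite mulr_gt0// invr_gt0 ltr0n fact_gt0.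
apply: DeriveDef; first by apply/cvg_ex; exists 0.
exact: cvg_lim cv.
Unshelve. all: by end_near. Qed.

Lemma smooth1_flat k : smooth1 (flat k).
Proof.
move=> n; elim: n k => // n IH k.
exists (fun x => flat k.+2 x + (- k%:R) * flat k.+1 x) => [x|].
  by apply: (is_derive_eq (flat_derive k x)); rewrite mulNr.
apply: smooth_uptoD; first exact: IH.
by apply: smooth_uptoM; [exact: smooth_upto_cst|exact: IH].
Qed.

End smooth_functions_of_a_real.

(** * Bumps on the line with prescribed mass *)

Section bumps.
Context {R : realType}.
Implicit Types (f eta H : R -> R) (x r : R).
Local Notation mu := (@lebesgue_measure R).

Lemma continuous_integrable f a b : continuous f ->
  mu.-integrable `[a, b] (EFin \o f).
Proof.
move=> cf; apply: continuous_compact_integrable; first exact: segment_compact.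
exact: continuous_subspaceT.
Qed.

Lemma is_derive_continuous f df : (forall x, is_derive x 1 f (df x)) -> continuous f.
Proof.
move=> h x; apply: differentiable_continuous; apply/derivable1_diffP.
by have [] := h x.
Qed.

Lemma is_derive_MVT f df a b : (forall x, is_derive x 1 f (df x)) -> a <= b ->
  exists2 c, c \in `[a, b]%R & f b - f a = df c * (b - a).
Proof.
move=> h ab; have cf : {within `[a, b], continuous f}.
  by apply: continuous_subspaceT; exact: is_derive_continuous h.
exact: (MVT_segment ab (fun x _ => h x) cf).
Qed.

Lemma primitive_exists f r : continuous f -> (forall x, x <= - r -> f x = 0) ->
  exists2 F, forall x, is_derive x 1 F (f x) & forall x, x <= - r -> F x = 0.
Proof.
move=> cf f0; pose a := - r - 1.
pose F x := \int[mu]_(t in `[a, x]) f t.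
have F0 x : x <= - r -> F x = 0.
  move=> xr; rewrite /F (@eq_Rintegral _ _ _ _ _ (cst 0)) ?Rintegral_cst ?mul0r//.
  by move=> t; rewrite inE /= in_itv /= => /andP[_ tx]; apply: f0; exact: le_trans xr.
exists F => // x; have [xr|rx] := ltP x (- r).
  rewrite f0 ?ltW//; apply: (@near_eq_is_derive _ _ _ (fun=> 0)).
  by near=> y; rewrite F0// ltW//; near: y; exact: lt_nbhsl.
have ax : a < x by rewrite (lt_le_trans _ rx)// /a ltrBlDr ltrDl.
have x1 : x < x + 1 by rewrite ltrDl.
have [d e] := continuous_FTC1_closed x1 (@continuous_integrable f a (x + 1) cf) ax (cf x).
by apply: DeriveDef; [exact: d|rewrite -derive1E; exact: e].
Unshelve. all: by end_near. Qed.

(** The mass [m] is encoded by a primitive [H] rather than by an integral; the same [H] produces the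
    moving averages below. *)
Definition bump eta r (m : R) := [/\ smooth1 eta, forall x, 0 <= eta x,
  forall x, r <= `|x| -> eta x = 0, 0 < r &
  exists H, [/\ forall x, is_derive x 1 H (eta x), forall x, x <= - r -> H x = 0 &
    forall x, r <= x -> H x = m]].

Lemma bump_mass_ge0 eta r m : bump eta r m -> 0 <= m.
Proof.
move=> [_ e0 _ r0 [H [dH H0 Hm]]].
have rr : - r <= r by rewrite (@le_trans _ _ 0)// ?oppr_le0 ltW.
have [c _] := is_derive_MVT dH rr.
rewrite (H0 (- r) (lexx _)) (Hm r (lexx _)) subr0 => ->.
by apply: mulr_ge0 => //; rewrite opprK ltW// addr_gt0.
Qed.

Lemma integral_bump eta r m : bump eta r m ->
  (\int[mu]_x (eta x)%:E = m%:E)%E.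
Proof.
move=> [se e0 es r0 [H [dH H0 Hm]]].
have rr : - r < r by rewrite (@lt_trans _ _ 0)// oppr_lt0.
transitivity (\int[mu]_(x in `[(- r)%R, r]) (eta x)%:E)%E.
  rewrite [RHS]integral_mkcond; apply: eq_integral => x _.
  rewrite patchE; case: ifPn => //; rewrite notin_setE /= in_itv /= => /negP.
  rewrite -ler_norml -ltNge => /ltW rx; by rewrite es.
rewrite (@continuous_FTC2 _ eta H)//.
- by rewrite (H0 (- r) (lexx _)) (Hm r (lexx _)) sube0.
- by apply: continuous_subspaceT; exact: smooth1_continuous.
- have cH := is_derive_continuous dH.
  split => [x _||]; first by have [] := dH x.
    by apply: cvg_at_right_filter; exact: cH.
  by apply: cvg_at_left_filter; exact: cH.
- by move=> x _; rewrite derive1E; have [_ ->] := dH x.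
Qed.

Lemma bump_of_smooth eta r : smooth1 eta -> (forall x, 0 <= eta x) ->
  (forall x, r <= `|x| -> eta x = 0) -> 0 < r -> exists m, bump eta r m.
Proof.
move=> se e0 es r0.
have [|H dH H0] := @primitive_exists eta r (smooth1_continuous se).
  by move=> x xr; apply: es; rewrite lerNr in xr; rewrite (le_trans xr)// -normrN ler_norm.
exists (H r); split => //; exists H; split => // x rx.
have [c cin] := is_derive_MVT dH rx.
rewrite es ?mul0r => [/eqP|]; first by rewrite subr_eq0 => /eqP.
by move: cin; rewrite in_itv /= => /andP[rc _]; rewrite (le_trans rc)// ler_norm.
Qed.

Lemma bump_exists r : 0 < r -> exists eta m, bump eta r m /\ 0 < m.
Proof.
move=> r0; pose eta x := flat 0 (1 * x + r) * flat 0 (-1 * x + r).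
have es x : r <= `|x| -> eta x = 0.
  rewrite /eta /flat; case: (lerP 0 x) => x0.
    rewrite ger0_norm// => rx; rewrite [X in _ * X]ifF ?mulr0//.
    by apply/negbTE; rewrite -leNgt mulN1r addrC subr_le0.
  rewrite ltr0_norm// => rx; rewrite ifF ?mul0r//.
  by apply/negbTE; rewrite -leNgt mul1r -lerBrDr sub0r lerNr.
have se : smooth1 eta.
  by move=> n; apply: smooth_uptoM; apply: smooth_upto_affine; exact: smooth1_flat.
have e0 x : 0 <= eta x by rewrite mulr_ge0// flat_ge0.
have [m bm] := bump_of_smooth se e0 es r0.
exists eta, m; split=> //.
have [_ _ _ _ [H [dH H0 Hm]]] := bm.
have mono x y : x <= y -> H x <= H y.
  move=> xy; have [c _ e] := is_derive_MVT dH xy.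
  by rewrite -subr_ge0 e mulr_ge0// subr_ge0.
have r2 : - (r / 2) <= r / 2 by lra.
have [c cin] := is_derive_MVT dH r2.
have ec : 0 < eta c.
  move: cin; rewrite in_itv /= => /andP[c1 c2]; rewrite /eta /flat.
  rewrite !ifT; [|lra|lra].
  by rewrite !expr0 !mul1r mulr_gt0// expR_gt0.
have h1 : 0 <= H (- (r / 2)) by rewrite -(H0 (- r))// mono//; lra.
have h2 : H (r / 2) <= m by rewrite -(Hm r)// mono//; lra.
have : 0 < eta c * (r / 2 - - (r / 2)) by rewrite mulr_gt0//; lra.
move=> + e; rewrite -e; lra.
Qed.

Lemma bump_shift eta r m c : bump eta r m -> bump (fun x => eta (x - c)) (r + `|c|) m.
Proof.
move=> [se e0 es r0 [H [dH H0 Hm]]].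
have sh f x (a : R) : is_derive (x - c) 1 f a -> is_derive x 1 (fun x => f (x - c)) a.
  move=> d; have := @is_derive_affine _ f x 1 (- c) a; rewrite mul1r => /(_ d).
  by rewrite mul1r; under eq_fun do rewrite mul1r.
split => //.
- move=> n; have := smooth_upto_affine 1 (- c) (se n).
  by under eq_fun do rewrite mul1r.
- move=> x rx; apply: es; have := ler_normD (x - c) c; rewrite subrK; lra.
- by rewrite ltr_pwDl.
exists (fun x => H (x - c)); split => [x|x xr|x rx]; first exact: sh.
  by apply: H0; have := ler_norm (- c); rewrite normrN; lra.
by apply: Hm; have := ler_norm c; lra.
Qed.

Lemma derive1nB f g n : smooth1 f -> smooth1 g ->
  derive1n n (fun x => f x - g x) = (fun x => derive1n n f x - derive1n n g x).
Proof.
move=> sf sg; elim: n => // n IH; rewrite derive1nS IH; apply/funext => x.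
rewrite derive1E; have d := is_derive_sub (smooth1_is_derive x (smooth1_derive1n n sf))
  (smooth1_is_derive x (smooth1_derive1n n sg)).
by have [_ ->] := d; rewrite -!derive1nS.
Qed.

Lemma derive1n_shift f n c : smooth1 f ->
  derive1n n (fun x => f (x - c)) = (fun x => derive1n n f (x - c)).
Proof.
move=> sf; elim: n => // n IH; rewrite derive1nS IH; apply/funext => x.
rewrite derive1E; have := @is_derive_affine _ (derive1n n f) x 1 (- c).
move=> /(_ _ (smooth1_is_derive _ (smooth1_derive1n n sf))) [_].
rewrite !mul1r -derive1nS => <-; congr ('D_1 _ x).
by apply/funext => y; rewrite mul1r.
Qed.

(* The moving average of eta over [x - h, x], i.e. the convolution of eta with
   the indicator of [0, h]. *)
Lemma bump_average eta r m h : 0 <= h -> bump eta r m -> exists2 A, bump A (r + h) (h * m) &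
  forall n x, derive1n n.+1 A x = derive1n n eta x - derive1n n eta (x - h).
Proof.
move=> h0 [se e0 es r0 [H [dH H0 Hm]]].
have cH := is_derive_continuous dH.
have [K dK K0] := primitive_exists cH H0.
have sh f df x : (forall x, is_derive x 1 f (df x)) -> is_derive x 1 (fun x => f (x - h)) (df (x - h)).
  move=> d; have := @is_derive_affine _ f x 1 (- h) (df (x - h)); rewrite mul1r => /(_ (d _)).
  by rewrite mul1r; under eq_fun do rewrite mul1r.
have mono x y : x <= y -> H x <= H y.
  move=> xy; have [c _ e] := is_derive_MVT dH xy.
  by rewrite -subr_ge0 e mulr_ge0// subr_ge0.
pose A x := H x - H (x - h).
have dA x : is_derive x 1 A (eta x - eta (x - h)).
  exact: (is_derive_sub (dH x) (sh _ _ x dH)).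
have sB : smooth1 (fun x => eta x - eta (x - h)).
  move=> n; have sn := smooth_upto_affine 1 (- h) (se n).
  have s1 := smooth_uptoM (smooth_upto_cst n (-1)) sn.
  have := smooth_uptoD (se n) s1.
  by under eq_fun do rewrite mul1r mulN1r.
exists A.
  split.
  - by case=> // n; exists (fun x => eta x - eta (x - h)); [exact: dA|exact: sB].
  - by move=> x; rewrite subr_ge0 mono// gerBl.
  - move=> x; rewrite /A; case: (lerP 0 x) => x0; [rewrite ger0_norm//|rewrite ltr0_norm//] => rx.
      by rewrite !Hm ?subrr//; lra.
    by rewrite !H0 ?subrr//; lra.
  - by rewrite ltr_pwDl.
  (* Right of the support [H] is constant equal to m, so this primitive of [A] levels off at h m. *)
  exists (fun x => K x - K (x - h)); split.
  - by move=> x; exact: (is_derive_sub (dK x) (sh _ _ x dK)).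
  - by move=> x xr; rewrite !K0 ?subrr//; lra.
  move=> x rx; have xh : x - h <= x by rewrite gerBl.
  have [c] := is_derive_MVT dK xh; rewrite in_itv /= => /andP[c1 c2] ->.
  rewrite Hm; last by lra.
  by rewrite opprB addrC subrK mulrC.
move=> n x; rewrite derive1Sn.
have -> : derive1 A = (fun x => eta x - eta (x - h)).
  by apply/funext => y; rewrite derive1E; have [_ ->] := dA y.
have ss : smooth1 (fun x => eta (x - h)).
  move=> k; have := smooth_upto_affine 1 (- h) (se k).
  by under eq_fun do rewrite mul1r.
by rewrite derive1nB// derive1n_shift.
Qed.

End bumps.

(** * Tensor products of bumps as test functions on phase space *)

Section tensor_products.
Context {R : realType} {d : nat}.
Local Notation J := ('I_d + 'I_d)%type.
Local Notation mu := (@lebesgue_phase R d).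
Implicit Types (eta : J -> R -> R) (z : phase R d).

Definition tens eta z : R := \prod_i eta i (pcoord i z).

Lemma differentiable_pcoord i z : differentiable (pcoord i : phase R d -> R) z.
Proof.
case: i => j.
  apply: (@differentiable_comp _ _ _ _ (fun z : phase R d => z.1) (fun x : 'rV[R]_d => x ord0 j)).
    by apply: linear_differentiable => ?; exact: cvg_fst.
  exact: differentiable_coord.
apply: (@differentiable_comp _ _ _ _ (fun z : phase R d => z.2) (fun x : 'rV[R]_d => x ord0 j)).
  by apply: linear_differentiable => ?; exact: cvg_snd.
exact: differentiable_coord.
Qed.

Lemma differentiable_tens eta z : (forall i, smooth1 (eta i)) -> differentiable (tens eta) z.
Proof.
move=> se; rewrite /tens; elim: (index_enum _) => [|i r IH].
  by under eq_fun do rewrite big_nil; exact: differentiable_cst.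
under eq_fun do rewrite big_cons.
apply: differentiableM => //.
apply: (@differentiable_comp _ _ _ _ (pcoord i) (eta i)); first exact: differentiable_pcoord.
by apply/derivable1_diffP; have [] := smooth1_is_derive (pcoord i z) (se i).
Qed.

Lemma derive_line (f : phase R d -> R) v z :
  'D_v f z = 'D_1 (fun t : R => f (t *: v + z)) 0.
Proof.
rewrite /derive; have e : (fun h : R => h^-1 *: ((f \o shift z) (h *: v) - f z)) =
   (fun h : R => h^-1 *: (((fun t : R => f (t *: v + z)) \o shift 0) (h *: 1) - f (0 *: v + z))).
  by apply/funext => h /=; rewrite addr0 scale0r add0r [h *: 1]mulr1.
by rewrite e.
Qed.

Lemma derive_tens eta j z : (forall i, smooth1 (eta i)) ->
  'D_(phase_dir R j) (tens eta) z =
  tens (fun i => if i == j then derive1 (eta i) else eta i) z.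
Proof.
move=> se; rewrite derive_line.
have e (t : R) : tens eta (t *: phase_dir R j + z) =
    (\prod_(i | i != j) eta i (pcoord i z)) * eta j (1 * t + pcoord j z).
  rewrite /tens (bigD1 j)//= mulrC; congr (_ * eta j _); last first.
    by rewrite pcoordD pcoordZ pcoord_dir eqxx mulr1 mul1r.
  apply: eq_bigr => i ij; congr (eta i _).
  by rewrite pcoordD pcoordZ pcoord_dir (negbTE ij) mulr0 add0r.
rewrite (funext e).
have d0 := smooth1_is_derive (1 * 0 + pcoord j z) (se j).
have d1 := @is_derive_affine _ (eta j) 0 1 (pcoord j z) _ d0.
have dc : is_derive (0 : R) 1 (fun=> \prod_(i | i != j) eta i (pcoord i z)) 0 by exact: is_derive_cst.
have d2 := is_derive_mul dc d1.
have [_ ->] := d2.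
rewrite mul0r add0r mul1r mulr0 add0r /tens [RHS](bigD1 j)//= eqxx mulrC; congr (_ * _).
by apply: eq_bigr => i ij; rewrite (negbTE ij).
Qed.

Lemma partials_tens eta s : (forall i, smooth1 (eta i)) ->
  partials (@phase_dir R d) s (tens eta) = tens (fun i => derive1n (count_mem i s) (eta i)).
Proof.
move=> se; elim: s => [|j s IH] //=; apply/funext => z; rewrite /partials /= -/(partials _ _ _) IH.
rewrite derive_tens => [|i]; last exact: smooth1_derive1n.
by apply: eq_bigr => i _; rewrite (eq_sym j i); case: (i == j).
Qed.

Lemma smooth_tens eta : (forall i, smooth1 (eta i)) -> smooth (@phase_dir R d) (tens eta).
Proof.
move=> se s z; rewrite partials_tens//; apply: differentiable_tens => i.
exact: smooth1_derive1n.
Qed.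

Lemma continuous_tens eta : (forall i, smooth1 (eta i)) -> continuous (tens eta).
Proof.
by move=> se z; apply: differentiable_continuous; exact: differentiable_tens.
Qed.

Lemma compact_phase_ball (r : R) : compact [set z : phase R d | `|z| <= r].
Proof.
rewrite (_ : [set _ | _] = [set x : 'rV[R]_d | `|x| <= r] `*` [set x : 'rV[R]_d | `|x| <= r]); last first.
  by apply/seteqP; split => z /=; rewrite prod_normE ge_max => /andP.
have cb : compact [set x : 'rV[R]_d | `|x| <= r].
  apply: bounded_closed_compact.
    exists r; split; first exact: num_real.
    by move=> M rM x /= xr; rewrite (le_trans xr)// ltW.
  rewrite (_ : [set _ | _] = (fun x : 'rV[R]_d => `|x|) @^-1` [set y | y <= r])//.
  by apply: closed_comp; [move=> x _; exact: norm_continuous|exact: closed_le].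
exact: compact_setX.
Qed.

Lemma closed_phase_ball (r : R) : closed [set z : phase R d | `|z| <= r].
Proof.
rewrite (_ : [set _ | _] = (fun x : phase R d => `|x|) @^-1` [set y | y <= r])//.
by apply: closed_comp; [move=> x _; exact: norm_continuous|exact: closed_le].
Qed.

Lemma tens_support eta (r : J -> R) z : (forall i x, r i <= `|x| -> eta i x = 0) ->
  tens eta z != 0 -> forall i, `|pcoord i z| < r i.
Proof.
move=> er + i; apply: contraNT; rewrite -leNgt => /er e.
by rewrite /tens (bigD1 i)//= e mul0r.
Qed.

Lemma tens_support_ball eta (r : J -> R) z : (forall i, 0 <= r i) ->
  (forall i x, r i <= `|x| -> eta i x = 0) ->
  tens eta z != 0 -> `|z| <= \sum_i r i.
Proof.
move=> r0 er /(tens_support er) h; apply: pnorm_le => [|i]; first exact: sumr_ge0.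
by rewrite (le_trans (ltW (h i)))// (bigD1 i)//= lerDl sumr_ge0.
Qed.

Lemma test_function_tens eta (r : J -> R) (m : J -> R) : (forall i, bump (eta i) (r i) (m i)) ->
  test_function (@phase_dir R d) (tens eta).
Proof.
move=> b; split; first by apply: smooth_tens => i; case: (b i).
have er i x : r i <= `|x| -> eta i x = 0 by case: (b i) => _ _ + _ _; apply.
have r0 i : 0 <= r i by case: (b i) => _ _ _ + _; exact: ltW.
apply: (@subclosed_compact _ _ [set z : phase R d | `|z| <= \sum_i r i]).
- exact: closed_closure.
- exact: compact_phase_ball.
- rewrite [X in _ `<=` X](closure_id _).1; last exact: closed_phase_ball.
  by apply: closure_subset => z /=; exact: tens_support_ball.
Qed.

End tensor_products.

Section tensor_integral.
Context {R : realType}.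
Local Open Scope ereal_scope.

Lemma integral_product_rV n (eta : 'I_n -> R -> R) (m : 'I_n -> R) :
  (forall i, measurable_fun setT (eta i)) -> (forall i x, 0 <= eta i x)%R ->
  (forall i, \int[@lebesgue_measure R]_x (eta i x)%:E = (m i)%:E) ->
  \int[@lebesgue_rV R n]_x (\prod_(i < n) eta i (x ord0 i))%R%:E = (\prod_(i < n) m i)%R%:E.
Proof.
elim: n eta m => [|n IH] eta m me e0 em.
  under eq_integral do rewrite big_ord0.
  by rewrite integral_cst//= diracT mul1e big_ord0.
have mprod k (f : 'I_k -> R -> R) : (forall i, measurable_fun setT (f i)) ->
    measurable_fun setT (fun x : 'rV[R]_k => (\prod_(i < k) f i (x ord0 i))%R).
  move=> mf; apply: measurable_prod => i _.
  apply: (measurableT_comp (mf i)); exact: measurable_coord.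
have h : \int[@lebesgue_rV R n.+1]_x (\prod_(i < n.+1) eta i (x ord0 i))%R%:E =
   \int[(@lebesgue_measure R \x @lebesgue_rV R n)]_p
     ((eta ord0 p.1)%:E * (\prod_(i < n) eta (lift ord0 i) (p.2 ord0 i))%R%:E).
  rewrite /= /lebesgue_step ge0_integral_pushforward//=.
  - apply: eq_integral => -[r x] _ /=; rewrite big_ord_recl /rV_cons -EFinM; congr (_ * _)%R%:E.
      by rewrite mxE unlift_none.
    by apply: eq_bigr => i _; rewrite mxE liftK.
  - exact: measurable_rV_cons.
  - by apply/measurable_EFinP; exact: mprod.
  - by move=> x _; rewrite lee_fin prodr_ge0.
have m1 : measurable_fun setT (fun p : R * 'rV[R]_n => (eta ord0 p.1)%:E).
  by apply/measurable_EFinP; exact: (measurableT_comp (me ord0) measurable_fst).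
have m2 : measurable_fun setT (fun p : R * 'rV[R]_n => (\prod_(i < n) eta (lift ord0 i) (p.2 ord0 i))%R%:E).
  by apply/measurable_EFinP; exact: (measurableT_comp (mprod _ _ (fun i => me (lift ord0 i))) measurable_snd).
rewrite h fubini_tonelli1/=; last 2 first.
- exact: emeasurable_funM.
- by move=> p; rewrite -EFinM lee_fin mulr_ge0// prodr_ge0.
rewrite /fubini_F /=.
under eq_integral => x _.
  rewrite ge0_integralZl//; last 3 first.
  - by apply/measurable_EFinP; exact: (mprod _ (fun i => eta (lift ord0 i))).
  - by move=> y _; rewrite lee_fin prodr_ge0.
  - by rewrite lee_fin.
  rewrite (IH (fun i => eta (lift ord0 i)) (fun i => m (lift ord0 i)))//.
  over.
rewrite ge0_integralZr//.
- by rewrite em -EFinM big_ord_recl.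
- by apply/measurable_EFinP; exact: me.
- by move=> x _; rewrite lee_fin.
- rewrite lee_fin prodr_ge0// => i _; rewrite -lee_fin -em integral_ge0// => x _.
  by rewrite lee_fin.
Qed.

Lemma integral_tens d (eta : 'I_d + 'I_d -> R -> R) (r m : 'I_d + 'I_d -> R) :
  (forall i, bump (eta i) (r i) (m i)) ->
  \int[@lebesgue_phase R d]_z (tens eta z)%:E = (\prod_i m i)%R%:E.
Proof.
move=> b.
have me i : measurable_fun setT (eta i).
  by apply: continuous_measurable_fun; apply: smooth1_continuous; case: (b i).
have e0 i x : (0 <= eta i x)%R by case: (b i).
have em i : \int[@lebesgue_measure R]_x (eta i x)%:E = (m i)%:E by exact: integral_bump (b i).
have mprod (f : 'I_d -> R -> R) : (forall i, measurable_fun setT (f i)) ->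
    measurable_fun setT (fun x : 'rV[R]_d => (\prod_(i < d) f i (x ord0 i))%R).
  move=> mf; apply: measurable_prod => i _.
  apply: (measurableT_comp (mf i)); exact: measurable_coord.
have h : \int[@lebesgue_phase R d]_z (tens eta z)%:E =
   \int[(@lebesgue_rV R d \x @lebesgue_rV R d)]_p
     ((\prod_(i < d) eta (inl i) (p.1 ord0 i))%R%:E * (\prod_(i < d) eta (inr i) (p.2 ord0 i))%R%:E).
  by apply: eq_integral => p _; rewrite /tens big_sumType EFinM.
have m1 : measurable_fun setT (fun p : 'rV[R]_d * 'rV[R]_d => (\prod_(i < d) eta (inl i) (p.1 ord0 i))%R%:E).
  by apply/measurable_EFinP; exact: (measurableT_comp (mprod _ (fun i => me (inl i))) measurable_fst).
have m2 : measurable_fun setT (fun p : 'rV[R]_d * 'rV[R]_d => (\prod_(i < d) eta (inr i) (p.2 ord0 i))%R%:E).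
  by apply/measurable_EFinP; exact: (measurableT_comp (mprod _ (fun i => me (inr i))) measurable_snd).
rewrite h fubini_tonelli1/=; last 2 first.
- exact: emeasurable_funM.
- by move=> p; rewrite -EFinM lee_fin mulr_ge0// prodr_ge0.
rewrite /fubini_F /=.
under eq_integral => x _.
  rewrite ge0_integralZl//; last 3 first.
  - by apply/measurable_EFinP; exact: (mprod (fun i => eta (inr i))).
  - by move=> y _; rewrite lee_fin prodr_ge0.
  - by rewrite lee_fin prodr_ge0.
  rewrite (integral_product_rV (eta := fun i => eta (inr i)) (m := fun i => m (inr i)))//.
  over.
have m0 i : (0 <= m i)%R by exact: bump_mass_ge0 (b i).
rewrite ge0_integralZr//.
- by rewrite (integral_product_rV (eta := fun i => eta (inl i)) (m := fun i => m (inl i)))// -EFinM big_sumType.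
- by apply/measurable_EFinP; exact: (mprod (fun i => eta (inl i))).
- by move=> x _; rewrite lee_fin prodr_ge0.
- by rewrite lee_fin prodr_ge0.
Qed.

End tensor_integral.

Lemma Rintegral_ae_le (dsp : measure_display) (T : measurableType dsp) (R : realType)
    (mu : {measure set T -> \bar R}) (f h : T -> R) (M : R) :
  measurable_fun setT f -> measurable_fun setT h -> (forall x, 0 <= h x) ->
  {ae mu, forall x, `|f x| <= h x} -> (\int[mu]_x (h x)%:E = M%:E)%E ->
  mu.-integrable setT (EFin \o f) /\ `|\int[mu]_x f x| <= M.
Proof.
move=> mf mh h0 fh hM.
have le : (\int[mu]_x `|(f x)%:E| <= M%:E)%E.
  rewrite -hM; apply: ae_ge0_le_integral => //.
  - by apply: measurableT_comp => //; exact/measurable_EFinP.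
  - by move=> x _; rewrite lee_fin.
  - exact/measurable_EFinP.
  - by apply: filterS fh => x fx _; rewrite lee_fin.
have fi : mu.-integrable setT (EFin \o f).
  apply/integrableP; split; first exact/measurable_EFinP.
  by rewrite (le_lt_trans le)// ltry.
split=> //; rewrite (le_trans (le_normr_Rintegral measurableT fi))//.
rewrite -lee_fin /Rintegral fineK//.
by rewrite ge0_fin_numE ?integral_ge0// (le_lt_trans le)// ltry.
Qed.

(** * Finite differences of continuous functions in W^{l,oo} *)

Section weak_differences.
Context {R : realType} {d : nat}.
Local Notation J := ('I_d + 'I_d)%type.
Local Notation mu := (@lebesgue_phase R d).
Variable phi : phase R d -> R.
Hypothesis cphi : continuous phi.

Lemma measurable_tens (eta : J -> R -> R) : (forall i, smooth1 (eta i)) ->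
  measurable_fun setT (tens eta).
Proof. by move=> se; apply: continuous_measurable_phase; exact: continuous_tens. Qed.

Lemma weak_pairing_le l s (A : J -> R -> R) (r m : J -> R) :
  sobolev_norm l phi = 1%E -> (size s <= l)%N -> (forall i, bump (A i) (r i) (m i)) ->
  `|\int[mu]_z (phi z * partials (@phase_dir R d) s (tens A) z)| <= 2 * \prod_i m i.
Proof.
move=> sob sl b.
have w1 : (weak_derivative_norm s phi <= 1)%E.
  by rewrite -sob; apply: ereal_sup_ubound; exists s.
(* The infimum in [weak_derivative_norm] is only approached, so a weak derivative of norm below 2 is
   taken; this is the factor 2 in the bound. *)
have [g' [g [mg gi wg] <-] g2] : exists2 y, [set ('N[mu]_+oo [EFin \o g])%E | g in weak_derivative s phi] y & (y < 2%:E)%E.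
  by apply: ereal_inf_lt; apply: le_lt_trans w1 _; rewrite lte_fin ltr1n.
have aeg : {ae mu, forall z, `|g z| <= 2}.
  move: g2; rewrite unlock /Lnorm; case: ifPn => [_ /ltW/ess_supP|].
    by apply: filterS => z /=; rewrite lee_fin.
  rewrite -leNgt => mu0 _; exists setT; split => //.
  by apply/eqP; rewrite eq_le mu0 /= measure_ge0.
have tA := test_function_tens b.
have sA i : smooth1 (A i) by case: (b i).
have tA0 z : 0 <= tens A z by apply: prodr_ge0 => i _; case: (b i).
rewrite (wg _ tA) normrM normrX normrN1 expr1n mul1r.
have [|||||_ //] := @Rintegral_ae_le _ _ _ mu (fun z => g z * tens A z) (fun z => 2 * tens A z) (2 * \prod_i m i).
- by apply: measurable_funM => //; exact: measurable_tens.
- by apply: measurable_funM => //; exact: measurable_tens.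
- by move=> z; rewrite mulr_ge0.
- by apply: filterS aeg => z gz; rewrite normrM [`|tens A z|]ger0_norm// ler_wpM2r.
under eq_integral do rewrite EFinM.
rewrite ge0_integralZl//.
- by rewrite (integral_tens b) EFinM.
- by apply/measurable_EFinP; exact: measurable_tens.
- by move=> z _; rewrite lee_fin.
Qed.

Definition moved_tens (eta : J -> R -> R) (n : J -> nat) (a z : phase R d) : R :=
  \prod_i derive1n (n i) (eta i) (pcoord i z - pcoord i a).

Definition axis (x : J * R) : phase R d := x.2 *: phase_dir R x.1.

(** A difference of step t in the centre along axis j is, up to sign, one more derivative of the
    moving average of the j-th bump over length t, whose mass is t times the old one. A mixed
    difference of a mollifier is thus a mixed derivative of a test function of known mass. *)
Lemma delta_moved_tens (H : seq (J * R)) (eta : J -> R -> R) (r m : J -> R) (n : J -> nat) :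
  all (fun x => 0 <= x.2) H -> (forall i, bump (eta i) (r i) (m i)) ->
  exists (A : J -> R -> R) (r' m' : J -> R), [/\ forall i, bump (A i) (r' i) (m' i),
    \prod_i m' i = \prod_(x <- H) x.2 * \prod_i m i &
    forall z a, delta [seq axis x | x <- H] (fun a => moved_tens eta n a z) a =
      (-1) ^+ size H * moved_tens A (fun i => n i + count_mem i [seq x.1 | x <- H])%N a z].
Proof.
elim: H eta r m n => [|[j t] H IH] eta r m n /=.
  move=> _ b; exists eta, r, m; split=> // [|z a]; first by rewrite big_nil mul1r.
  by rewrite expr0 mul1r; apply: eq_bigr => i _; rewrite addn0.
move=> /andP[t0 H0] b.
have [B bB dB] := bump_average t0 (b j).
pose eta' i := if i == j then B else eta i.
pose r' i := if i == j then r j + t else r i.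
pose m' i := if i == j then t * m j else m i.
pose n' i := if i == j then (n j).+1 else n i.
have b' i : bump (eta' i) (r' i) (m' i) by rewrite /eta' /r' /m'; case: eqP.
have [A [r2 [m2 [bA mA dA]]]] := IH eta' r' m' n' H0 b'.
exists A, r2, m2; split=> // [|z a].
  rewrite mA big_cons /= (bigD1 j)//= [in RHS](bigD1 j)//= /m' eqxx.
  rewrite (eq_bigr m) => [|i ij]; last by rewrite (negbTE ij).
  by ring.
have e a' : moved_tens eta n (a' + axis (j, t)) z - moved_tens eta n a' z = - moved_tens eta' n' a' z.
  rewrite /moved_tens (bigD1 j)//= [X in _ - X](bigD1 j)//= [in RHS](bigD1 j)//=.
  rewrite /eta' /n' eqxx dB pcoordD /axis pcoordZ pcoord_dir eqxx mulr1 opprD addrA.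
  rewrite (eq_bigr (fun i => derive1n (n i) (eta i) (pcoord i z - pcoord i a'))); last first.
    by move=> i ij; rewrite pcoordD pcoordZ pcoord_dir (negbTE ij) mulr0 addr0.
  rewrite [in RHS](eq_bigr (fun i => derive1n (n i) (eta i) (pcoord i z - pcoord i a'))); last first.
    by move=> i ij; rewrite (negbTE ij).
  by ring.
rewrite (@eq_diffs _ _ _ _ _ _ (fun a => - moved_tens eta' n' a z)); last by move=> a'; rewrite /step_diff e.
rewrite diffsN dA exprS mulN1r mulNr; congr (- (_ * _)).
apply: eq_bigr => i _; congr (derive1n _ _ _); rewrite /n' /= (eq_sym j i).
by case: eqP => [->|_]; rewrite ?add1n ?addnS ?addSn ?add0n.
Qed.

Lemma moved_tensE eta n a z : (forall i, smooth1 (eta i)) ->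
  moved_tens eta n a z = tens (fun i => derive1n (n i) (fun x => eta i (x - pcoord i a))) z.
Proof. by move=> se; apply: eq_bigr => i _; rewrite derive1n_shift. Qed.

Lemma bounded_on_ball (r : R) : exists C : R, 0 <= C /\ forall z, `|z| <= r -> `|phi z| <= C.
Proof.
have cK := @compact_phase_ball R d r.
have := continuous_compact (continuous_subspaceT cphi) cK.
move=> /compact_bounded[M [_ HM]].
exists (`|M| + 1); split; first by rewrite addr_ge0.
by move=> z zr; apply: (HM (`|M| + 1)); [rewrite ltr_pwDr// ler_norm|exists z].
Qed.

Lemma integrable_phi_tens (A : J -> R -> R) (r m : J -> R) : (forall i, bump (A i) (r i) (m i)) ->
  mu.-integrable setT (EFin \o (fun z => phi z * tens A z)).
Proof.
move=> b.
have sA i : smooth1 (A i) by case: (b i).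
have A0 z : 0 <= tens A z by apply: prodr_ge0 => i _; case: (b i).
have [C [C0 HC]] := bounded_on_ball (\sum_i r i).
have [||||//|h _ //] := @Rintegral_ae_le _ _ _ mu (fun z => phi z * tens A z) (fun z => C * tens A z) (C * \prod_i m i).
- by apply: measurable_funM; [exact: continuous_measurable_phase|exact: measurable_tens].
- by apply: measurable_funM => //; exact: measurable_tens.
- by move=> z; rewrite mulr_ge0.
- apply: nearW => z; rewrite normrM [`|tens A z|]ger0_norm//.
  have [->|z0] := eqVneq (tens A z) 0; first by rewrite !mulr0.
  rewrite ler_wpM2r// HC//; apply: (tens_support_ball _ _ z0) => i; first by case: (b i) => _ _ _ /ltW.
  by case: (b i).
under eq_integral do rewrite EFinM.
rewrite ge0_integralZl//.
- by rewrite (integral_tens b) EFinM.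
- by apply/measurable_EFinP; exact: measurable_tens.
- by move=> z _; rewrite lee_fin.
Qed.

Lemma delta_scale (V : zmodType) (H : seq V) (k : R) (F : V -> R) x :
  delta H (fun y => k * F y) x = k * delta H F x.
Proof.
elim: H F => //= h H IH F; rewrite -IH; apply: eq_diffs => y.
by rewrite /step_diff mulrBr.
Qed.

Lemma delta_integral (H : seq (phase R d)) (G : phase R d -> phase R d -> R) a :
  (forall a, mu.-integrable setT (EFin \o (fun z => phi z * G a z))) ->
  delta H (fun a => \int[mu]_z (phi z * G a z)) a =
  \int[mu]_z (phi z * delta H (fun a => G a z) a).
Proof.
elim: H G => //= h H IH G Gi.
have iB a' : mu.-integrable setT (EFin \o (fun z => phi z * (G (a' + h) z - G a' z))).
  rewrite (_ : EFin \o _ = (EFin \o (fun z => (phi z * G (a' + h) z)%R)) \- (EFin \o (fun z => (phi z * G a' z)%R)))%E.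
    by apply: integrableB.
  by apply/funext => z /=; rewrite mulrBr EFinB.
rewrite -(IH (fun a z => G (a + h) z - G a z))//.
apply: eq_diffs => a'; rewrite /step_diff -RintegralB//.
by apply: eq_Rintegral => z _; rewrite mulrBr.
Qed.

Lemma integrable_delta (H : seq (phase R d)) (G : phase R d -> phase R d -> R) a :
  (forall a, mu.-integrable setT (EFin \o (fun z => phi z * G a z))) ->
  mu.-integrable setT (EFin \o (fun z => phi z * delta H (fun a => G a z) a)).
Proof.
elim: H G => //= h H IH G Gi; apply: (IH (fun a z => G (a + h) z - G a z)) => a'.
rewrite (_ : EFin \o _ = (EFin \o (fun z => (phi z * G (a' + h) z)%R)) \- (EFin \o (fun z => (phi z * G a' z)%R)))%E.
  by apply: integrableB.
by apply/funext => z /=; rewrite mulrBr EFinB.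
Qed.

Lemma cvg_delta (V : zmodType) (H : seq V) (F : nat -> V -> R) (f : V -> R) x :
  (forall y, F n y @[n --> \oo] --> f y) -> delta H (F n) x @[n --> \oo] --> delta H f x.
Proof.
elim: H F f => [|h H IH] F f Ff /=; first exact: Ff.
by apply: (IH (fun n => step_diff (fun h x => x + h) h (F n))) => y; apply: cvgB; exact: Ff.
Qed.

(** The difference is moved from mollified [phi] onto the mollifier, where it becomes a derivative
    of a test function; the weak derivative bounds the pairing by twice the mass, and the product of
    steps comes out. *)
Lemma axis_difference_le l (H : seq (J * R)) z0 : sobolev_norm l phi = 1%E ->
  (size H <= l)%N -> all (fun x => 0 <= x.2) H ->
  `|delta [seq axis x | x <- H] phi z0| <= 2 * \prod_(x <- H) x.2.
Proof.
move=> sob Hl H0.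
have /choice[eta] : forall n : nat, exists eta : R -> R, exists m : R, bump eta n.+1%:R^-1 m /\ 0 < m.
  by move=> n; apply: bump_exists; rewrite invr_gt0.
move=> /choice[m bm].
pose eta' n (i : J) := eta n.
pose c n := \prod_(i : J) m n.
have c0 n : 0 < c n by apply: prodr_gt0 => i _; case: (bm n).
have b n i : bump (eta' n i) n.+1%:R^-1 (m n) by case: (bm n).
have se n i : smooth1 (eta' n i) by case: (b n i).
pose psi n a z := moved_tens (eta' n) (fun=> 0%N) a z.
have bs n a i := bump_shift (pcoord i a) (b n i).
have psiE n a : psi n a = tens (fun i x => eta' n i (x - pcoord i a)).
  by apply/funext => z; rewrite /psi moved_tensE.
pose F n a := (c n)^-1 * \int[mu]_z (phi z * psi n a z).
have Fb n : `|delta [seq axis x | x <- H] (F n) z0| <= 2 * \prod_(x <- H) x.2.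
  rewrite delta_scale delta_integral => [|a]; last first.
    rewrite psiE; apply: integrable_phi_tens => i; exact: bs.
  have [A [r' [m' [bA mA dA]]]] := delta_moved_tens (fun=> 0%N) H0 (b n).
  set K := fun z => delta [seq axis x | x <- H] (fun a => psi n a z) z0.
  have iK : mu.-integrable setT (EFin \o (fun z => phi z * K z)).
    apply: integrable_delta => a; rewrite psiE; apply: integrable_phi_tens => i; exact: bs.
  have bA' i := bump_shift (pcoord i z0) (bA i).
  have := @weak_pairing_le l [seq x.1 | x <- H] _ _ _ sob _ bA'.
  rewrite size_map => /(_ Hl); rewrite mA -/(c n).
  rewrite (@eq_Rintegral _ _ _ _ _ (fun z => (-1) ^+ size H * (phi z * K z))); last first.
    move=> z _; rewrite /K dA.
    have sq : (-1) ^+ size H * (-1) ^+ size H = 1 :> R by rewrite -exprMn mulrNN mulr1 expr1n.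
    rewrite [RHS]mulrCA (mulrA ((-1) ^+ _) ((-1) ^+ _)) sq mul1r; congr (_ * _).
    rewrite moved_tensE => [|i]; last by case: (bA i).
    by rewrite partials_tens => [|i]; last by case: (bA' i).
  rewrite RintegralZl// normrM normrX normrN1 expr1n mul1r => h.
  rewrite normrM [`|(c n)^-1|]gtr0_norm ?invr_gt0// ler_pdivrMl//.
  by rewrite (le_trans h)// le_eqVlt; apply/orP; left; apply/eqP; ring.
(* Continuity of [phi] gives convergence at every point rather than almost everywhere, so the bound
   passes to the values of [phi]. *)
have Fc a : F n a @[n --> \oo] --> phi a.
  apply/cvgrPdist_le => e e0.
  have ca : phi z @[z --> a] --> phi a by exact: cphi.
  move/cvgrPdist_le : ca => /(_ e e0) /nbhs_ballP[del /= del0 Hdel].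
  near=> n.
  have rn : n.+1%:R^-1 < del by near: n; exact: (near_infty_natSinv_lt (PosNum del0)).
  have psi0 z : 0 <= psi n a z by rewrite psiE; apply: prodr_ge0 => i _; case: (bs n a i).
  have mpsi : measurable_fun setT (psi n a).
    by rewrite psiE; apply: measurable_tens => i; case: (bs n a i).
  have ipsi : (\int[mu]_z (psi n a z)%:E = (c n)%:E)%E.
    by rewrite psiE (integral_tens (bs n a)).
  have key : `|\int[mu]_z ((phi a - phi z) * psi n a z)| <= e * c n.
    have [|||||_ //] := @Rintegral_ae_le _ _ _ mu (fun z => (phi a - phi z) * psi n a z) (fun z => e * psi n a z) (e * c n).
    - apply: measurable_funM => //; apply: measurable_funB => //; exact: continuous_measurable_phase.
    - exact: measurable_funM.
    - by move=> z; rewrite mulr_ge0// ltW.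
    - apply: nearW => z; rewrite normrM [`|psi n a z|]ger0_norm//.
      have [->|z1] := eqVneq (psi n a z) 0; first by rewrite !mulr0.
      apply: ler_wpM2r => //; apply: Hdel; rewrite -ball_normE /= distrC.
      apply: le_lt_trans rn; apply: pnorm_le => [|i]; first by rewrite invr_ge0.
      rewrite pcoordB leNgt; apply: contra z1 => zr; rewrite /psi /moved_tens (bigD1 i)//=.
      by case: (b n i) => _ _ -> //; rewrite ?mul0r// ltW.
    under eq_integral do rewrite EFinM.
    rewrite ge0_integralZl//.
    + by rewrite ipsi EFinM.
    + exact/measurable_EFinP.
    + by move=> z _; rewrite lee_fin.
    + by rewrite lee_fin ltW.
  have iphi : mu.-integrable setT (EFin \o (fun z => phi z * psi n a z)).
    by rewrite psiE; exact: (integrable_phi_tens (bs n a)).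
  have ipsi' : mu.-integrable setT (EFin \o psi n a).
    apply/integrableP; split; first exact/measurable_EFinP.
    under eq_integral => z _ do rewrite /= ger0_norm//.
    by rewrite ipsi ltry.
  have e2 : \int[mu]_z ((phi a - phi z) * psi n a z) = phi a * c n - \int[mu]_z (phi z * psi n a z).
    under eq_Rintegral do rewrite mulrBl.
    rewrite RintegralB//; last first.
      rewrite (_ : EFin \o _ = fun z => ((phi a)%:E * (psi n a z)%:E)%E)//.
      exact: integrableZl.
    rewrite RintegralZl//; congr (_ * _ - _).
    by rewrite /Rintegral ipsi.
  rewrite /F; have cn := c0 n.
  set I := \int[mu]_z (phi z * psi n a z) in e2 *.
  have -> : phi a - (c n)^-1 * I = (c n)^-1 * (phi a * c n - I) by field; rewrite gt_eqF.
  rewrite -e2 normrM [`|(c n)^-1|]gtr0_norm ?invr_gt0// ler_pdivrMl// mulrC.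
  exact: key.
have cv : `|delta [seq axis x | x <- H] (F n) z0| @[n --> \oo] -->
    `|delta [seq axis x | x <- H] phi z0| by apply: cvg_norm; exact: cvg_delta.
rewrite -(cvg_lim _ cv)//.
apply: limr_le; last exact: nearW.
by apply/cvg_ex; exists `|delta [seq axis x | x <- H] phi z0|.
Unshelve. all: by end_near. Qed.

Definition axis_bound k (B : R) (f : phase R d -> R) := forall (H : seq (J * R)) x,
  (size H <= k)%N -> all (fun x => 0 <= x.2) H ->
  `|delta [seq axis x | x <- H] f x| <= B * \prod_(x <- H) x.2.

(** A backward step is minus the forward step from its endpoint; this removes the sign condition on
    one increment. *)
Lemma axis_bound_diff k B f (j : J) (t : R) y : axis_bound k.+1 B f ->
  axis_bound k (B * `|t|) (fun x => f (x + y + axis (j, t)) - f (x + y)).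
Proof.
move=> fB H x Hk H0.
have [t0|t0] := leP 0 t.
  have := fB ((j, t) :: H) (x + y); rewrite /= t0 => /(_ Hk H0).
  rewrite big_cons /= [`|t|]ger0_norm// mulrA; congr (`|_| <= _).
  rewrite -delta_shift; apply: eq_diffs => z; by rewrite /step_diff.
have e z : f (z + y + axis (j, t)) - f (z + y) =
    - (f (z + (y + axis (j, t)) + axis (j, - t)) - f (z + (y + axis (j, t)))).
  rewrite opprB /axis /= -!addrA; congr (f _ - f (_ + _)).
  by rewrite [X in _ + X]addrA scaleNr subrr add0r || rewrite scaleNr subrr addr0.
rewrite (eq_diffs _ _ e) diffsN normrN.
have := fB ((j, - t) :: H) (x + (y + axis (j, t))); rewrite /= oppr_ge0 (ltW t0) => /(_ Hk H0).
rewrite big_cons /= [`|t|]ltr0_norm// mulrA; congr (`|_| <= _).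
by rewrite -delta_shift; apply: eq_diffs => z; rewrite /step_diff.
Qed.

(** A general increment is a path of d + d axis steps along which the difference telescopes: a
    factor d + d per order. *)
Lemma axis_bound_general k (B : R) f (H : seq (phase R d)) x : 0 <= B ->
  axis_bound k B f -> (size H <= k)%N ->
  `|delta H f x| <= (d + d)%:R ^+ size H * B * \prod_(h <- H) `|h|.
Proof.
elim: H k B f x => [|h H IH] k B f x B0 fB.
  move=> _; rewrite big_nil expr0 mul1r mulr1.
  by have := fB [::] x isT isT; rewrite big_nil mulr1.
case: k fB => // k fB Hk.
pose v i := axis (i, pcoord i h).
have hv : h = \sum_(i <- index_enum J) v i.
  apply: pcoord_inj => i.
  have p0 : pcoord i (0 : phase R d) = 0 by case: (i) => ? /=; rewrite mxE.
  rewrite [RHS](big_morph (pcoord i) (pcoordD i) p0).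
  rewrite (bigD1 i)//= /v /axis pcoordZ pcoord_dir eqxx mulr1 big1 ?addr0// => j ji.
  by rewrite pcoordZ pcoord_dir eq_sym (negbTE ji) mulr0.
have tel (r : seq J) : `|delta H (fun x => f (x + \sum_(i <- r) v i) - f x) x| <=
    \sum_(i <- r) (d + d)%:R ^+ size H * (B * `|h|) * \prod_(h <- H) `|h|.
  elim: r x => [|i r IHr] x0.
    rewrite !big_nil (@eq_diffs _ _ _ _ _ _ (fun=> 0)) => [|z]; last by rewrite addr0 subrr.
    have -> : delta H (fun _ : phase R d => 0 : R) x0 = 0.
      by case: (H) => // ? ?; exact: diffs_cst.
    by rewrite normr0.
  rewrite !big_cons [leRHS]addrC (@eq_diffs _ _ _ _ _ _ (fun x => (f (x + \sum_(i <- r) v i) - f x) +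
     (f (x + \sum_(i <- r) v i + axis (i, pcoord i h)) - f (x + \sum_(i <- r) v i)))); last first.
    move=> z; rewrite (addrC (v i)) addrA -/(v i).
    by rewrite [RHS]addrC addrA subrK.
  rewrite diffsD (le_trans (ler_normD _ _))// lerD//.
  have := IH k (B * `|pcoord i h|) _ x0 (mulr_ge0 B0 (normr_ge0 _)) (@axis_bound_diff k B f i (pcoord i h) (\sum_(i <- r) v i) fB) Hk.
  move=> /le_trans; apply; apply: ler_wpM2r; first by apply: prodr_ge0 => ? _.
  apply: ler_wpM2l; first by rewrite exprn_ge0.
  by apply: ler_wpM2l => //; exact: pcoord_le.
have := tel (index_enum J); rewrite -hv => /le_trans; apply.
rewrite sumr_const card_sum card_ord -[leLHS]mulr_natl big_cons /= exprS.
by rewrite le_eqVlt; apply/orP; left; apply/eqP; ring.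
Qed.

Lemma sobolev_fd_bound l : sobolev_norm l phi = 1%E ->
  fd_bound l ((1 + (d + d)%:R) ^+ l * 2) phi.
Proof.
move=> sob H x Hl.
have ab : axis_bound l 2 phi.
  move=> H1 x1 sH1 H10; have h := axis_difference_le x1 sob sH1 H10; exact: h.
apply: (le_trans (axis_bound_general x _ ab Hl)) => //.
apply: ler_wpM2r; first by apply: prodr_ge0 => h _.
apply: ler_wpM2r => //; apply: (@le_trans _ _ ((1 + (d + d)%:R) ^+ size H)).
  by rewrite lerXn2r ?nnegrE ?addr_ge0// lerDr.
by rewrite ler_weXn2l// lerDl.
Qed.

End weak_differences.

(** * Law of the quantized inputs *)

Section generated_sigma_events.
Context {dsp : measure_display} {Omega : measurableType dsp}.
Variables (I : Type) (dT : measure_display) (T : measurableType dT).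
Variables (D : set I) (X : I -> Omega -> T).

Definition generators := \bigcup_(i in D) preimage_set_system setT (X i) measurable.

Lemma generated_measurable i : D i ->
  measurable_fun [set: g_sigma_algebraType generators] (X i).
Proof.
move=> Di _ A mA; apply: sub_sigma_algebra; exists i => //.
by exists A.
Qed.

Lemma generated_preimage i A : D i -> measurable A ->
  generated_sigma D X (X i @^-1` A).
Proof. by move=> Di mA; have := generated_measurable Di measurableT mA; rewrite setTI. Qed.

Lemma generated_fin_bigcap (K : finType) (S : set K) (A : K -> set Omega) :
  (forall k, generated_sigma D X (A k)) ->
  generated_sigma D X (\bigcap_(k in S) A k).
Proof.
move=> h; apply: (@fin_bigcap_measurable _ (g_sigma_algebraType generators)) => [|k _].
  exact: finite_finset.
exact: h.
Qed.

Lemma generated_sub (F : set (set Omega)) : sigma_algebra setT F ->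
  (forall i A, D i -> measurable A -> F (X i @^-1` A)) ->
  generated_sigma D X `<=` F.
Proof.
move=> sF h; apply: smallest_sub => //; apply: bigcup_sub => i Di _ [A mA <-].
by rewrite setTI; exact: h.
Qed.

End generated_sigma_events.

Section finite_law.
Context {R : realType} {dsp : measure_display} {Omega : measurableType dsp}.
Variable P : probability Omega R.

Definition step_increment (V : zmodType) (B : R -> Omega -> V) (h : R) (k : nat) (w : Omega) : V :=
  B (h * k.+1%:R) w - B (h * k%:R) w.

Lemma generated_increment (B : R -> Omega -> R) (D : set R) h k A :
  D (h * k%:R) -> D (h * k.+1%:R) -> measurable A ->
  generated_sigma D B (step_increment B h k @^-1` A).
Proof.
move=> D1 D2 mA.
have : measurable_fun [set: g_sigma_algebraType (generators D B)] (step_increment B h k).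
  by apply: measurable_funB; exact: generated_measurable.
by move=> /(_ measurableT _ mA); rewrite setTI.
Qed.

(** The last increment is independent of the past up to [h * n], which contains all earlier ones. *)
Lemma brownian1_increments (B : R -> Omega -> R) h n (A : 'I_n -> set R) : 0 < h ->
  brownian1 P B -> (forall k, measurable (A k)) ->
  P (\bigcap_(k in [set: 'I_n]) (step_increment B h k @^-1` A k)) =
  (\prod_(k < n) normal_prob 0 (Num.sqrt h) (A k))%E.
Proof.
move=> h0 [_ _ law ind]; elim: n A => [|n IH] A mA.
  rewrite big_ord0 (_ : [set: 'I_0] = set0) ?bigcap_set0 ?probability_setT//.
  by apply/seteqP; split => // -[].
rewrite big_ord_recr /= -IH //.
have hn : h * n%:R < h * n.+1%:R by rewrite ltr_pM2l// ltr_nat.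
have hn0 : 0 <= h * n%:R by rewrite mulr_ge0// ltW.
have := law _ _ _ hn0 hn (mA ord_max).
rewrite -mulrBr -natrB// subSnn mulr1 => <-.
rewrite -(ind _ _ hn0 hn).
- congr (P _); apply/seteqP; split => [w hw|w [hw h1] k _ /=].
    by split; [move=> k _; exact: (hw (widen_ord (leqnSn n) k))|exact: (hw ord_max)].
  have [kn|nk] := ltnP k n.
    have := hw (Ordinal kn) I; rewrite /preimage /=.
    by congr (A _ _); exact: val_inj.
  have -> : k = ord_max by apply/val_inj/eqP; rewrite eqn_leq nk -ltnS ltn_ord.
  exact: h1.
- apply: generated_fin_bigcap => k; apply: generated_increment => //=;
  rewrite in_itv /= ler_pM2l// ler_nat ?ltn_ord ?(ltnW (ltn_ord k)) andbT mulr_ge0//; exact: ltW.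
- exact: (@generated_preimage _ _ _ _ _ _ (fun _ w => B (h * n.+1%:R) w - B (h * n%:R) w) tt).
Qed.

Lemma brownian_increments d (B : R -> {mfun Omega >-> 'rV[R]_d}) h n (A : 'I_n -> 'I_d -> set R) : 0 < h ->
  brownian P (B : R -> Omega -> 'rV[R]_d) -> (forall k c, measurable (A k c)) ->
  P (\bigcap_(k in [set: 'I_n]) \bigcap_(c in [set: 'I_d])
       ((fun w => step_increment (B : R -> Omega -> _) h k w ord0 c) @^-1` A k c)) =
  (\prod_(k < n) \prod_(c < d) normal_prob 0 (Num.sqrt h) (A k c))%E.
Proof.
move=> h0 [B1 ind] mA; rewrite exchange_big /=.
pose E c := \bigcap_(k in [set: 'I_n]) (step_increment (fun t w => B t w ord0 c) h k @^-1` A k c).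
transitivity (P (\bigcap_(c in [set` [set: 'I_d]%SET]) E c)).
  congr (P _); apply/seteqP; split => [w hw c _ k _ /=|w hw k _ c _ /=].
    by have := hw k I c I; rewrite /preimage /= /step_increment !mxE.
  by have := hw c (finset.in_setT c) k I; rewrite /preimage /= /step_increment !mxE.
rewrite (ind [set: 'I_d]%SET).
  apply: eq_big => c; first by rewrite finset.in_setT.
  by move=> _; exact: brownian1_increments.
move=> c _; apply: generated_fin_bigcap => k.
by apply: generated_increment => //=; rewrite in_itv /= andbT mulr_ge0// ltW.
Qed.

Lemma generated_increment_coord d (B : R -> Omega -> 'rV[R]_d) (D : set R) h k c A :
  D (h * k%:R) -> D (h * k.+1%:R) -> measurable A ->
  generated_sigma D B ((fun w => step_increment B h k w ord0 c) @^-1` A).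
Proof.
move=> D1 D2 mA.
have : measurable_fun [set: g_sigma_algebraType (generators D B)]
    (fun w => B (h * k.+1%:R) w ord0 c - B (h * k%:R) w ord0 c).
  by apply: measurable_funB; apply: (measurableT_comp (measurable_coord c)); exact: generated_measurable.
move=> /(_ measurableT _ mA); rewrite setTI.
by congr (generated_sigma _ _ _); apply/seteqP; split => w; rewrite /preimage /= /step_increment !mxE.
Qed.

Lemma finite_valued_sum (K : finType) (Y : Omega -> K) (G : K -> R) w :
  G (Y w) = \sum_k G k * \1_[set w | Y w = k] w.
Proof.
rewrite (bigD1 (Y w)) //= indicE mem_set // mulr1 big1 ?addr0 // => k kY.
by rewrite indicE memNset ?mulr0 //= => /esym/eqP; rewrite (negbTE kY).
Qed.

Lemma finite_valued_measurable (K : finType) (Y : Omega -> K) (G : K -> R) :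
  (forall k, measurable [set w | Y w = k]) -> measurable_fun setT (fun w => G (Y w)).
Proof.
move=> mY; rewrite (_ : (fun _ => _) = fun w => \sum_k G k * \1_[set w | Y w = k] w).
  by apply: measurable_sum => k; apply: measurable_funM => //; exact: measurable_indic.
by apply/funext => w; exact: finite_valued_sum.
Qed.

Lemma finite_valued_Rintegral (K : finType) (Y : Omega -> K) (G : K -> R) :
  (forall k, measurable [set w | Y w = k]) ->
  \int[P]_w G (Y w) = \sum_k fine (P [set w | Y w = k]) * G k.
Proof.
move=> mY; rewrite /Rintegral.
under eq_integral do rewrite finite_valued_sum -sumEFin.
have iY k : P.-integrable setT (EFin \o \1_[set w | Y w = k]).
  exact: integrable_indic.
rewrite integral_sum //; last first.
  move=> k; under eq_fun do rewrite EFinM.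
  by apply: integrableZl => //; exact: iY.
have intY k : (\int[P]_w (G k * \1_[set w | Y w = k] w)%R%:E = (fine (P [set w | Y w = k]) * G k)%R%:E)%E.
  under eq_integral do rewrite EFinM.
  rewrite (integralZl _ (iY k)) // [X in (_ * X)%E](_ : _ = P [set w | Y w = k]).
    by rewrite muleC EFinM fineK // fin_num_measure.
  by rewrite integral_indic // setIT.
by rewrite (eq_bigr _ (fun k _ => intY k)) sumEFin.
Qed.

Section codes.
Context {d N n : nat} {Q : finType}.
Variables (beta kappa : R) (W A : 'rV[R]_d -> R) (mu0 : probability (phase R d) R).
Variable B : 'I_N -> R -> {mfun Omega >-> 'rV[R]_d}.
Variable Z : 'I_N -> R -> {mfun Omega >-> phase R d}.
Hypothesis LZ : langevin P beta kappa W A mu0 B Z.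
Variables (h : R) (h0 : 0 < h) (q : R -> Q).
Hypothesis mq : forall e, measurable (q @^-1` [set e]).

Definition input_code := ({ffun 'I_d + 'I_d -> Q} * {ffun 'I_n -> {ffun 'I_d -> Q}})%type.

Definition code (j : 'I_N) (w : Omega) : input_code :=
  ([ffun i => q (pcoord i (Z j 0 w))],
   [ffun k : 'I_n => [ffun c => q (step_increment (B j : R -> Omega -> _) h k w ord0 c)]]).

Definition code_prob (e : input_code) : \bar R :=
  (mu0 (\bigcap_(i in [set: 'I_d + 'I_d]) (pcoord i @^-1` (q @^-1` [set e.1 i]))) *
   \prod_(k < n) \prod_(c < d) normal_prob 0 (Num.sqrt h) (q @^-1` [set e.2 k c]))%E.

Let init j (e : input_code) : set Omega :=
  Z j 0 @^-1` (\bigcap_(i in [set: 'I_d + 'I_d]) (pcoord i @^-1` (q @^-1` [set e.1 i]))).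

Let noise j (e : input_code) : set Omega :=
  \bigcap_(k in [set: 'I_n]) \bigcap_(c in [set: 'I_d])
    ((fun w => step_increment (B j : R -> Omega -> _) h k w ord0 c) @^-1` (q @^-1` [set e.2 k c])).

Let measurable_init_code (e : input_code) :
  measurable (\bigcap_(i in [set: 'I_d + 'I_d]) (pcoord (R := R) i @^-1` (q @^-1` [set e.1 i]))).
Proof.
apply: fin_bigcap_measurable => [|i _]; first exact: finite_finset.
by have := measurable_pcoord i measurableT (mq (e.1 i)); rewrite setTI.
Qed.

Let code_events j e : [set w | code j w = e] = init j e `&` noise j e.
Proof.
apply/seteqP; split => [w /= <-|w [h1 h2]] /=.
  by split => [i _|k _ c _]; rewrite /preimage /= !ffunE.
rewrite /code [RHS]surjective_pairing; congr pair.
  by apply/ffunP => i; rewrite ffunE; exact: h1.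
by apply/ffunP => k; apply/ffunP => c; rewrite !ffunE; exact: h2.
Qed.

Let noise_generated j e :
  generated_sigma `[0, +oo[ (B j : R -> Omega -> 'rV[R]_d) (noise j e).
Proof.
apply: generated_fin_bigcap => k; apply: generated_fin_bigcap => c.
by apply: generated_increment_coord => //=; rewrite in_itv /= andbT mulr_ge0// ltW.
Qed.

(** Initial data are first separated from the noise, then each side is split over the particles. *)
Lemma code_law (y : 'I_N -> input_code) :
  P (\bigcap_(j in [set: 'I_N]) [set w | code j w = y j]) =
  (\prod_(j < N) code_prob (y j))%E.
Proof.
rewrite big_split /=.
transitivity (P ((\bigcap_(j in [set` [set: 'I_N]%SET]) init j (y j)) `&`
                 (\bigcap_(j in [set` [set: 'I_N]%SET]) noise j (y j)))).
  congr (P _); rewrite -bigcapI; apply/seteqP; split => w hw j _.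
    by rewrite -code_events; exact: hw.
  by rewrite code_events; apply: hw; rewrite /= finset.in_setT.
rewrite (langevin_init_noise_indep LZ); first congr (_ * _)%E.
- rewrite (langevin_init_indep LZ).
    apply: eq_big => j; first by rewrite finset.in_setT.
    by move=> _; rewrite -(langevin_init_law LZ j).
  by move=> j _; apply: (@generated_preimage _ _ _ _ _ _ (fun=> Z j 0 : Omega -> phase R d) tt).
- rewrite (langevin_noise_indep LZ).
    apply: eq_big => j; first by rewrite finset.in_setT.
    move=> _; apply: (brownian_increments h0 (langevin_noise LZ j)) => k c; exact: mq.
  by move=> j _; exact: noise_generated.
- apply: generated_fin_bigcap => j.
  exact: (@generated_preimage _ _ _ _ _ setT (fun i => Z i 0 : Omega -> phase R d)).
- apply: generated_fin_bigcap => j.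
  move: (noise j (y j)) (@noise_generated j (y j)); apply: generated_sub.
    exact: smallest_sigma_algebra.
  move=> t A0 /=; rewrite in_itv /= andbT => t0 mA.
  exact: (@generated_preimage _ _ _ _ _ [set it : 'I_N * R | 0 <= it.2]
    (fun it => B it.1 it.2 : Omega -> 'rV[R]_d) (j, t)).
Qed.

Definition codes_of w : {ffun 'I_N -> input_code} := [ffun j => code j w].

Let measurable_code j e : measurable [set w | code j w = e].
Proof.
rewrite code_events; apply: measurableI.
  have := @measurable_funPT _ _ _ _ (Z j 0) measurableT _ (measurable_init_code e).
  by rewrite setTI.
do 2 (apply: fin_bigcap_measurable => [|? _]; first exact: finite_finset).
rewrite -[X in measurable X]setTI.
apply: (measurableT_comp (measurable_coord _)) => //.
apply: measurable_fun_rV => i; under eq_fun do rewrite !mxE.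
by apply: measurable_funB; apply: (measurableT_comp (measurable_coord _)); exact: measurable_funPT.
Qed.

Let codes_events y : [set w | codes_of w = y] = \bigcap_(j in [set: 'I_N]) [set w | code j w = y j].
Proof.
apply/seteqP; split => w /=; first by move=> <- j _ /=; rewrite ffunE.
by move=> hw; apply/ffunP => j; rewrite ffunE; exact: hw.
Qed.

Lemma measurable_codes_of y : measurable [set w | codes_of w = y].
Proof.
rewrite codes_events; apply: fin_bigcap_measurable => [|j _]; first exact: finite_finset.
exact: measurable_code.
Qed.

Let fin_code_prob e : code_prob e \is a fin_num.
Proof.
rewrite fin_numM //.
  by rewrite fin_num_measure //; exact: measurable_init_code.
by apply: prode_fin_num => k _; apply: prode_fin_num => c _; apply: (fin_num_measure (normal_prob _ _)); exact: mq.
Qed.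

Definition input_prob e : R := fine (code_prob e).

Lemma input_prob_ge0 e : 0 <= input_prob e.
Proof.
apply: fine_ge0; rewrite mule_ge0 //; apply: prode_ge0 => k _.
by apply: prode_ge0 => c _.
Qed.

Let prob_codes y : fine (P [set w | codes_of w = y]) = \prod_j input_prob (y j).
Proof.
rewrite codes_events code_law (eq_bigr (fun j => (input_prob (y j))%:E)).
  by rewrite prodEFin.
by move=> j _; rewrite fineK.
Qed.

Lemma codes_mean (G : {ffun 'I_N -> input_code} -> R) :
  \int[P]_w G (codes_of w) = mean input_prob G.
Proof.
rewrite finite_valued_Rintegral; last exact: measurable_codes_of.
by apply: eq_bigr => y _; rewrite prob_codes.
Qed.

(** The mean of 1 is the N-th power of the total mass, which is nonnegative. *)
Lemma input_prob_sum : (0 < N)%N -> \sum_e input_prob e = 1.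
Proof.
move=> N0; have := codes_mean (fun=> 1).
rewrite Rintegral_cst // mul1r [X in fine X = _ -> _](probability_setT P).
rewrite /mean /=.
under [RHS]eq_bigr do rewrite mulr1.
rewrite -(bigA_distr_bigA (fun (_ : 'I_N) e => input_prob e)) /= prodr_const card_ord => /esym/eqP.
rewrite pexpr_eq1 //; first by move=> /eqP.
apply: sumr_ge0 => e _; exact: input_prob_ge0.
Qed.

End codes.

End finite_law.

(** * Convergence of the Euler scheme *)

Section uniform_continuity.
Context {R : realType}.

Lemma segment_uniform_continuity (V : normedModType R) (f : R -> V) (t : R) (h : nat -> R) (eta : R) :
  {within `[0, t], continuous f} -> h @ \oo --> 0 -> 0 < eta ->
  \forall n \near \oo, forall u v, 0 <= u <= t -> 0 <= v <= t -> `|u - v| <= h n ->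
    `|f u - f v| <= eta.
Proof.
move=> cf h0 eta0.
have /compact_near_coveringP/near_covering_withinP cK := @segment_compact R 0 t.
pose P (n : nat) u := forall v, `[0, t]%classic v -> `|u - v| <= h n -> `|f u - f v| <= eta.
suff PK u : `[0, t]%classic u -> \forall u' \near u & n \near \oo, `[0, t]%classic u' -> P n u'.
  apply: filterS (cK nat \oo P eventually_filter PK) => n Pn u v u0 v0.
  by apply: (Pn u); rewrite /= in_itv.
move=> Ku; have /subspace_continuousP/(_ u Ku)/cvgrPdist_le/(_ (eta / 2)) := cf.
move=> /(_ (divr_gt0 eta0 (ltr0Sn _ 1))); rewrite near_withinE => /nbhs_ballP[r /= r0 ur].
have r20 : 0 < r / 2 by rewrite divr_gt0.
near=> u' n => Ku' v Kv u'v.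
have hr : h n < r / 2.
  rewrite (le_lt_trans (ler_norm _))//; near: n.
  by move/cvgrPdist_lt : h0 => /(_ _ r20); under eq_near do rewrite sub0r normrN.
have uu' : `|u - u'| < r / 2 by near: u'; exact: (nbhsx_ballx u (r / 2) r20).
rewrite [eta]splitr; apply: le_trans (lerD (ur u' _ Ku') (ur v _ Kv)).
- by rewrite [`|f u - f u'|]distrC ler_distD.
- rewrite /ball /=; lra.
- rewrite /ball /= -[u - v](subrKA u') (le_lt_trans (ler_normD _ _))//.
  by rewrite [r]splitr ltrD// (le_lt_trans u'v).
Unshelve. all: by end_near. Qed.

End uniform_continuity.

Section integral_equation_step.
Context {R : realType}.
Local Notation mu := (@lebesgue_measure R).

Lemma continuous_Rintegral_step (f : R -> R) t u v eta :
  {within `[0, t], continuous f} -> 0 <= u -> u <= v -> v <= t ->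
  (forall r, u <= r <= v -> `|f r - f u| <= eta) ->
  `|\int[mu]_(r in `[0, v]) f r - \int[mu]_(r in `[0, u]) f r - (v - u) * f u| <= (v - u) * eta.
Proof.
move=> cf u0 uv vt fe.
have int x y : 0 <= x -> y <= t -> mu.-integrable `[x, y] (EFin \o f).
  move=> x0 yt; apply: continuous_compact_integrable; first exact: segment_compact.
  apply: continuous_subspaceW cf; apply: subset_itv; by rewrite bnd_simp.
rewrite Rintegral_itvB; [|exact: int|by rewrite bnd_simp|by rewrite bnd_simp].
rewrite Rintegral_itv_obnd_cbnd; last first.
  by apply: integrableS (int u v u0 vt) => //; apply: subset_itvr; rewrite bnd_simp.
have mI : fine (mu `[u, v]) = v - u by rewrite lebesgue_measure_itv /= lte_fin; case: ltP => //= vu; apply/eqP; rewrite eq_sym subr_eq0 eq_le uv vu.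
have icst c : mu.-integrable `[u, v] (EFin \o (fun=> c)).
  apply: continuous_compact_integrable; first exact: segment_compact.
  by apply: continuous_subspaceT => x; exact: cst_continuous.
rewrite -mI mulrC -Rintegral_cst// -RintegralB//; [|exact: int].
have ifu : mu.-integrable `[u, v] (EFin \o (fun r => f r - f u)).
  rewrite (_ : EFin \o _ = (fun r => (f r)%:E - (f u)%:E)%E)//.
  apply: integrableB => //; [exact: int|exact: (icst (f u))].
apply: le_trans (le_normr_Rintegral _ ifu) _ => //.
rewrite mulrC -Rintegral_cst//; apply: le_Rintegral => //.
exact: (integrable_norm ifu).
Qed.

End integral_equation_step.

(** * Discrete Gronwall estimate for the Euler scheme *)

Section euler_error.
Context {R : realType} {d N : nat}.
Variables (kappa gam a : R) (g : 'rV[R]_d -> 'rV[R]_d) (M : R).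
Hypotheses (kappa0 : 0 <= kappa) (gam0 : 0 <= gam) (a0 : 0 <= a) (M0 : 0 <= M).
Hypothesis gM : forall x y, `|g x - g y| <= M * `|x - y|.
Local Notation force := (@force R d N kappa gam a g).

(** The added 1 makes the constant at least 1, so that it also serves the position equation, whose
    right side is the velocity. *)
Definition lipschitz_force : R := kappa * (2 * M) + gam + a + 1.

Lemma lipschitz_force_ge1 : 1 <= lipschitz_force.
Proof. by rewrite lerDr !addr_ge0// !mulr_ge0. Qed.

Lemma phase_norm1 (z : phase R d) : `|z.1| <= `|z|.
Proof. by rewrite prod_normE le_max lexx. Qed.

Lemma phase_norm2 (z : phase R d) : `|z.2| <= `|z|.
Proof. by rewrite prod_normE le_max lexx orbT. Qed.

Lemma force_lipschitz (z z' : 'I_N -> phase R d) i e :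
  (forall j, `|z j - z' j| <= e) -> `|force z i - force z' i| <= lipschitz_force * e.
Proof.
move=> ze; have e0 : 0 <= e := le_trans (normr_ge0 _) (ze i).
have z1 j : `|(z j).1 - (z' j).1| <= e by apply: le_trans (ze j); exact: (phase_norm1 (z j - z' j)).
have z2 j : `|(z j).2 - (z' j).2| <= e by apply: le_trans (ze j); exact: (phase_norm2 (z j - z' j)).
have N0 : 0 < N%:R :> R by rewrite ltr0n (leq_ltn_trans _ (ltn_ord i)).
pose S (z : 'I_N -> phase R d) := \sum_(j < N) g ((z i).1 - (z j).1).
have Sle : `|S z - S z'| <= N%:R * (M * (2 * e)).
  rewrite /S -sumrB (le_trans (ler_norm_sum _ _ _))//.
  rewrite mulr_natl -[in leRHS](card_ord N) -sumr_const; apply: ler_sum => j _.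
  apply: (le_trans (gM _ _)); apply: ler_wpM2l => //.
  have -> : (z i).1 - (z j).1 - ((z' i).1 - (z' j).1) =
      (z i).1 - (z' i).1 - ((z j).1 - (z' j).1) by apply/rowP => c; rewrite !mxE; ring.
  by rewrite (le_trans (ler_normB _ _))// [2 * e]mulr_natl mulr2n lerD.
rewrite /force -/(S z) -/(S z').
have -> : - ((kappa / N%:R) *: S z) - gam *: (z i).2 - a *: (z i).1
    - (- ((kappa / N%:R) *: S z') - gam *: (z' i).2 - a *: (z' i).1) =
    - ((kappa / N%:R) *: (S z - S z')) - gam *: ((z i).2 - (z' i).2) - a *: ((z i).1 - (z' i).1).
  by apply/rowP => c; rewrite !mxE; ring.
apply: (le_trans (ler_normB _ _)); apply: (le_trans (lerD (ler_normB _ _) (lexx _))).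
rewrite normrN !normrZ (ger0_norm gam0) (ger0_norm a0) (ger0_norm kappa0).
rewrite [`|_^-1|]ger0_norm ?invr_ge0 ?ler0n//.
have h1 : kappa / N%:R * `|S z - S z'| <= kappa * (2 * M) * e.
  rewrite -mulrA -[leRHS]mulrA; apply: ler_wpM2l => //.
  by rewrite ler_pdivrMl// (le_trans Sle)// le_eqVlt; apply/orP; left; apply/eqP; ring.
have h2 : gam * `|(z i).2 - (z' i).2| <= gam * e by exact: ler_wpM2l.
have h3 : a * `|(z i).1 - (z' i).1| <= a * e by exact: ler_wpM2l.
by rewrite /lipschitz_force; lra.
Qed.

(** [X] is any sequence that satisfies the scheme up to a defect; it will be the exact trajectory on
    the time grid. *)
Lemma euler_error (T : Type) (z0 : T -> phase R d) (b : T -> nat -> 'rV[R]_d) (h : R)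
    (y : {ffun 'I_N -> T}) (X : nat -> 'I_N -> phase R d) n eps delta :
  0 <= h ->
  (forall i, `|z0 (y i) - X 0 i| <= eps) ->
  (forall k i, (k < n)%N -> `|(X k.+1 i).1 - (X k i).1 - h *: (X k i).2| <= delta) ->
  (forall k i, (k < n)%N ->
    `|(X k.+1 i).2 - (X k i).2 - h *: force (X k) i - b (y i) k| <= delta) ->
  forall i, `|euler kappa gam a h g z0 b n y i - X n i| <=
    (1 + h * lipschitz_force) ^+ n * (eps + n%:R * delta).
Proof.
move=> h0 H0; elim: n => [|n IH] H1 H2 i.
  by rewrite expr0 mul1r mul0r addr0; exact: H0.
have {}IH j := IH (fun k i' kn => H1 k i' (ltnW kn)) (fun k i' kn => H2 k i' (ltnW kn)) j.
set e := _ * _ in IH; set L := lipschitz_force in e IH *.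
have L1 : 1 <= L := lipschitz_force_ge1.
have e0 : 0 <= e := le_trans (normr_ge0 _) (IH i).
have d0 : 0 <= delta := le_trans (normr_ge0 _) (H1 n i (ltnSn n)).
have hL : 0 <= h * L by rewrite mulr_ge0// (le_trans ler01).
suff : `|euler kappa gam a h g z0 b n.+1 y i - X n.+1 i| <= (1 + h * L) * e + delta.
  move=> /le_trans; apply; rewrite /e exprS -mulrA.
  have -> : (1 + h * L) * ((1 + h * L) ^+ n * (eps + n.+1%:R * delta)) =
    (1 + h * L) * ((1 + h * L) ^+ n * (eps + n%:R * delta)) + (1 + h * L) ^+ n.+1 * delta.
    by rewrite exprS -natr1; ring.
  by rewrite lerD2l ler_peMl// exprn_ege1// lerDl.
rewrite /=; set z := euler _ _ _ _ _ _ _ n y in IH *.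
rewrite prod_normE ge_max; apply/andP; split => /=.
  have -> : (z i).1 + h *: (z i).2 - (X n.+1 i).1 = ((z i).1 - (X n i).1)
      + h *: ((z i).2 - (X n i).2) - ((X n.+1 i).1 - (X n i).1 - h *: (X n i).2).
    by apply/rowP => c; rewrite !mxE; ring.
  rewrite (le_trans (ler_normB _ _))// lerD ?H1// (le_trans (ler_normD _ _))//.
  rewrite mulrDl mul1r lerD//; first by apply: le_trans (IH i); exact: (phase_norm1 (z i - X n i)).
  rewrite normrZ (ger0_norm h0) -mulrA ler_wpM2l//.
  by apply: le_trans (ler_peMl e0 L1); apply: le_trans (IH i); exact: (phase_norm2 (z i - X n i)).
have -> : (z i).2 + h *: force z i + b (y i) n - (X n.+1 i).2 = ((z i).2 - (X n i).2)
    + h *: (force z i - force (X n) i) - ((X n.+1 i).2 - (X n i).2 - h *: force (X n) i - b (y i) n).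
  by apply/rowP => c; rewrite !mxE; ring.
rewrite (le_trans (ler_normB _ _))// lerD ?H2// (le_trans (ler_normD _ _))//.
rewrite mulrDl mul1r lerD//; first by apply: le_trans (IH i); exact: (phase_norm2 (z i - X n i)).
by rewrite normrZ (ger0_norm h0) -mulrA ler_wpM2l//; exact: force_lipschitz.
Qed.

End euler_error.

Section quantization.
Context {R : realType} (k : nat).

(* Mesh 1 / (k + 1) on [-k, k]; the values outside have a junk code. *)
Definition quant_type := 'I_(k.*2 * k.+1).+1.

Definition quant (x : R) : quant_type := inord `|Num.floor ((x + k%:R) * k.+1%:R)|.

Definition dequant (e : quant_type) : R := (e : nat)%:R / k.+1%:R - k%:R.

Lemma quant_error x : `|x| <= k%:R -> `|dequant (quant x) - x| <= k.+1%:R^-1.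
Proof.
rewrite ler_norml => /andP[xk kx].
have n0 : 0 < k.+1%:R :> R by [].
set u := (x + k%:R) * k.+1%:R.
have u0 : 0 <= u by rewrite mulr_ge0// -lerBlDr sub0r.
have /andP[h1 h2] := floor_itv u.
have f0 : 0 <= Num.floor u by rewrite floor_ge0.
have uk : u <= (k.*2 * k.+1)%:R by rewrite natrM ler_wpM2r// -muln2 natrM; lra.
have fE : `|Num.floor u|%:R = (Num.floor u)%:~R :> R.
  by rewrite -[in RHS](gez0_abs f0).
rewrite /dequant inordK; last first.
  by rewrite ltnS -(ler_nat R) fE (le_trans h1).
rewrite fE.
have -> : (Num.floor u)%:~R / k.+1%:R - k%:R - x = ((Num.floor u)%:~R - u) / k.+1%:R.
  by rewrite mulrBl mulfK ?lt0r_neq0//; ring.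
rewrite normrM [`|_^-1|]gtr0_norm ?invr_gt0//.
apply: ler_piMl; first by rewrite invr_ge0 ltW.
rewrite distrC ger0_norm; last by rewrite subr_ge0.
by rewrite lerBlDl; move: h2; rewrite intrD => /ltW.
Qed.

Lemma measurable_quant (e : quant_type) : measurable (quant @^-1` [set e]).
Proof.
rewrite (_ : _ @^-1` _ = \bigcup_(z : int) (if inord `|z| == e
    then (fun x => x + k%:R) @^-1` [set x | Num.floor (x * k.+1%:R) = z] else set0)).
  apply: countable_bigcupT_measurable => [|z]; first exact: countableP.
  case: ifP => // _; rewrite -[X in measurable X]setTI.
  apply: (measurable_funD (@measurable_id _ _ _) (measurable_cst _)) => //.
  exact: measurable_floor_code.
apply/seteqP; split => x.
  by rewrite /preimage /= => <-; exists (Num.floor ((x + k%:R) * k.+1%:R)); rewrite ?eqxx.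
by move=> [z _]; case: ifP => // /eqP <-; rewrite /preimage /= => <-.
Qed.

End quantization.

Section decoded_inputs.
Context {R : realType} {d n : nat} (k : nat).
Local Notation input := (@input_code d n (quant_type k)).

Definition decoded_init (e : input) : phase R d := of_pcoord (fun i => dequant (e.1 i)).

Definition decoded_noise (e : input) (l : nat) : 'rV[R]_d :=
  if insub l is Some l' then \row_c dequant (e.2 l' c) else 0.

End decoded_inputs.

(** * Convergence of the quantized scheme along one trajectory *)

Section pathwise_convergence.
Context {R : realType} {d N : nat}.
Variables (kappa gam a : R) (g : 'rV[R]_d -> 'rV[R]_d) (M : R).
Hypotheses (kappa0 : 0 <= kappa) (gam0 : 0 <= gam) (a0 : 0 <= a) (M0 : 0 <= M).
Hypothesis gM : forall x y, `|g x - g y| <= M * `|x - y|.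
Local Notation force := (@force R d N kappa gam a g).
Local Notation mu := (@lebesgue_measure R).
Local Notation L := (lipschitz_force kappa gam a M).

Variables (X : 'I_N -> R -> phase R d) (b : 'I_N -> R -> 'rV[R]_d).
Hypothesis cX : forall i, {within `[0, +oo[, continuous (X i)}.
Hypothesis X1 : forall i t c, 0 <= t -> (X i t).1 ord0 c = (X i 0).1 ord0 c +
  \int[mu]_(r in `[0, t]) ((X i r).2 ord0 c).
Hypothesis X2 : forall i t c, 0 <= t -> (X i t).2 ord0 c = (X i 0).2 ord0 c +
  \int[mu]_(r in `[0, t]) (force (X ^~ r) i ord0 c) + b i t ord0 c.

Variables (t : R) (s : nat -> nat) (h : nat -> R).
Hypotheses (h_gt0 : forall n, 0 < h n) (h_cvg : h @ \oo --> 0).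
Hypotheses (sh : forall n, h n * (s n)%:R = t) (s_le : forall n, (s n <= n.+1)%N).

(** At most n + 1 increments are quantized, each with error 1/(k n + 1); the square makes the
    accumulated error O(1/n), while the window [-k, k] exhausts the line. *)
Let k n := (n.+1 ^ 2)%N.

Let y n : {ffun 'I_N -> @input_code d (s n) (quant_type (k n))} :=
  [ffun j => ([ffun i => quant (k n) (pcoord i (X j 0))],
    [ffun l : 'I_(s n) => [ffun c =>
      quant (k n) ((b j (h n * l.+1%:R) - b j (h n * l%:R)) ord0 c)]])].

Let t0 : 0 <= t.
Proof. by rewrite -(sh 0) mulr_ge0// ltW. Qed.

Let L0 : 0 <= L.
Proof. by rewrite (le_trans ler01)// lipschitz_force_ge1. Qed.

Let cXt i : {within `[0, t], continuous (X i)}.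
Proof. by apply: (continuous_subspaceW _ (@cX i)); apply: subset_itvl; rewrite bnd_simp. Qed.

Let force_cont i : {within `[0, t], continuous (fun r => force (X ^~ r) i)}.
Proof.
apply/subspace_continuousP => u ut; apply/cvgrPdist_le => e e0.
have L1 : 0 < L by rewrite (lt_le_trans ltr01)// lipschitz_force_ge1.
have : \forall r \near within `[0, t]%classic (nbhs u), forall j, `|X j u - X j r| <= e / L.
  apply: filter_forall => j; have /subspace_continuousP/(_ u ut)/cvgrPdist_le := @cXt j.
  by apply; rewrite divr_gt0.
apply: filterS => r Xr; apply: le_trans (force_lipschitz kappa0 gam0 a0 M0 gM i Xr) _.
by rewrite mulrC divfK// lt0r_neq0.
Qed.

Let coord_cont (f : R -> 'rV[R]_d) c :
  {within `[0, t], continuous f} -> {within `[0, t], continuous (fun r => f r ord0 c)}.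
Proof.
move=> cf u; apply: (@continuous_comp (subspace `[0, t]) _ _ f (fun x => x ord0 c) u).
  exact: cf.
exact: coord_continuous.
Qed.

Let bounded_on (V : normedModType R) (f : R -> V) : {within `[0, t], continuous f} ->
  exists C : R, forall r, 0 <= r <= t -> `|f r| <= C.
Proof.
move=> cf; have : {within `[0, t], continuous (fun r => `|f r|)}.
  move=> u; apply: (@continuous_comp (subspace `[0, t]) _ _ f (fun x => `|x|) u).
    exact: cf.
  exact: norm_continuous.
move=> /(EVT_max t0)[c _ fc]; exists `|f c| => r r0; apply: fc.
by rewrite in_itv.
Qed.

Lemma euler_pathwise_cvg i :
  (fun n => euler kappa gam a (h n) g (@decoded_init R d (s n) (k n))
    (@decoded_noise R d (s n) (k n)) (s n) (y n) i) @ \oo --> X i t.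
Proof.
have /choice[CX CXP] : forall j, exists C : R, forall r, 0 <= r <= t -> `|X j r| <= C.
  by move=> j; exact: bounded_on.
have /choice[CF CFP] : forall j, exists C : R, forall r, 0 <= r <= t -> `|force (X ^~ r) j| <= C.
  by move=> j; exact: bounded_on.
pose E := expR (t * L).
have E0 : 0 < E by exact: expR_gt0.
apply/cvgrPdist_le => e e0.
(* Half of [e] pays for the defect t L eta amplified by the Gronwall factor [E], half for
   quantization; the + 1 avoids a division by zero at t = 0. *)
pose eta := e / 2 / (E * (t * L + 1)).
have tL : 0 <= t * L by rewrite mulr_ge0.
have tL1 : 0 < t * L + 1 by rewrite ltr_wpDl.
have eta0 : 0 < eta by rewrite !divr_gt0// mulr_gt0.
have eta_e : E * (t * (L * eta)) <= e / 2.
  rewrite mulrA mulrA -[E * t * L]mulrA.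
  have -> : e / 2 = E * (t * L + 1) * eta by rewrite /eta [RHS]mulrC divfK// lt0r_neq0// mulr_gt0.
  by apply: ler_wpM2r; [exact: ltW|rewrite ler_pM2l// lerDl].
have Xunif : \forall n \near \oo, forall j u v, 0 <= u <= t -> 0 <= v <= t ->
    `|u - v| <= h n -> `|X j u - X j v| <= eta.
  by apply: filter_forall => j; apply: segment_uniform_continuity.
have large (c : R) : \forall n \near \oo, c <= n%:R.
  exact: nbhs_infty_ger.
near=> n.
have h0 : 0 <= h n by exact: ltW.
have h1 : h n <= 1.
  rewrite (le_trans (ler_norm _))//; near: n.
  by move/cvgrPdist_le : h_cvg => /(_ _ ltr01); under eq_near do rewrite sub0r normrN.
have Xn : forall j u v, 0 <= u <= t -> 0 <= v <= t ->
    `|u - v| <= h n -> `|X j u - X j v| <= eta by near: n.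
(* Ensures that the initial data and all increments lie in the quantization window, so that no junk
   code occurs. *)
have Cn : forall j, 2 * CX j + CF j + L * eta <= n%:R.
  by near: n; apply: filter_forall => j; exact: large.
have En : E * 4 / e <= n%:R by near: n; exact: large.
have nk : (n%:R : R) <= (k n)%:R by rewrite ler_nat /k expnS expn1 (leq_trans (leqnSn n))// leq_pmulr.
set u := fun l => h n * l%:R.
have u0 l : 0 <= u l by rewrite mulr_ge0.
have uS l : u l.+1 - u l = h n by rewrite /u -mulrBr -natrB// subSnn mulr1.
have ult l : (l <= s n)%N -> 0 <= u l <= t by move=> ls; rewrite u0 -(sh n) ler_wpM2l// ler_nat.
have uu l : u l <= u l.+1 by rewrite -subr_ge0 uS.
have mid l r : (l < s n)%N -> u l <= r <= u l.+1 -> 0 <= r <= t /\ `|r - u l| <= h n.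
  move=> ls /andP[r1 r2]; have /andP[_ tS] := ult _ ls; split.
    by rewrite (le_trans (u0 l))//= (le_trans r2).
  by rewrite ger0_norm ?subr_ge0// -(uS l) lerB.
have pos j l : (l < s n)%N -> `|(X j (u l.+1)).1 - (X j (u l)).1 - h n *: (X j (u l)).2| <= h n * (L * eta).
  move=> ls; apply: rV_norm_le => [|c]; first exact: mulr_ge0 h0 (mulr_ge0 L0 (ltW eta0)).
  have /andP[_ tS] := ult _ ls.
  rewrite !mxE (X1 _ _ (u0 l.+1)) (X1 _ _ (u0 l)) -(uS l).
  rewrite [X in `|X - _|](_ : _ = \int[mu]_(r in `[0, u l.+1]) ((X j r).2 ord0 c) -
    \int[mu]_(r in `[0, u l]) ((X j r).2 ord0 c)); last by rewrite opprD addrACA subrr add0r.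
  have cXc : {within `[0, t], continuous (fun r => (X j r).2 ord0 c)}.
    apply: coord_cont => v; apply: (@continuous_comp (subspace `[0, t]) _ _ (X j) snd v).
      exact: cXt.
    exact: cvg_snd.
  apply: (le_trans (continuous_Rintegral_step cXc (u0 l) (uu l) tS (eta := eta) _)).
    move=> r rl; have [rt rh] := mid _ _ ls rl.
    apply: le_trans (Xn j _ _ rt (ult _ (ltnW ls)) rh).
    apply: le_trans (phase_norm2 (X j r - X j (u l))).
    by have := rV_coord_le (X j r - X j (u l)).2 c; rewrite !mxE.
  by rewrite uS ler_wpM2l// ler_peMl// ?lipschitz_force_ge1// ltW.
have vel j l : (l < s n)%N -> `|(X j (u l.+1)).2 - (X j (u l)).2 - h n *: force (X ^~ (u l)) j -
    (b j (u l.+1) - b j (u l))| <= h n * (L * eta).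
  move=> ls; apply: rV_norm_le => [|c]; first exact: mulr_ge0 h0 (mulr_ge0 L0 (ltW eta0)).
  have /andP[_ tS] := ult _ ls.
  have -> : ((X j (u l.+1)).2 - (X j (u l)).2 - h n *: force (X ^~ (u l)) j -
      (b j (u l.+1) - b j (u l))) ord0 c =
    \int[mu]_(r in `[0, u l.+1]) (force (X ^~ r) j ord0 c) -
    \int[mu]_(r in `[0, u l]) (force (X ^~ r) j ord0 c) -
    (u l.+1 - u l) * force (X ^~ (u l)) j ord0 c.
    set f := force _ _.
    rewrite uS; have := X2 j c (u0 l.+1); have := X2 j c (u0 l).
    rewrite !mxE => -> ->; ring.
  rewrite -[in leRHS](uS l).
  have cF := coord_cont (c := c) (@force_cont j).
  apply: (continuous_Rintegral_step cF (u0 l) (uu l) tS (eta := L * eta)).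
  move=> r rl; have [rt rh] := mid _ _ ls rl.
  have := rV_coord_le (force (X ^~ r) j - force (X ^~ (u l)) j) c; rewrite !mxE => /le_trans; apply.
  apply: force_lipschitz => // i'; exact: Xn (ult _ (ltnW ls)) rh.
pose K : R := (k n).+1%:R^-1.
have K0 : 0 <= K by rewrite invr_ge0.
have CX0 j : 0 <= CX j by apply: le_trans (normr_ge0 _) (CXP j 0 _); rewrite lexx.
have CF0 j : 0 <= CF j by apply: le_trans (normr_ge0 _) (CFP j 0 _); rewrite lexx.
have Le0 : 0 <= L * eta by exact: mulr_ge0 L0 (ltW eta0).
have init j : `|decoded_init (y n j) - X j (u 0%N)| <= K.
  apply: pnorm_le => // c; rewrite pcoordB pcoord_of /u mulr0 /y !ffunE /= ?ffunE.
  apply: quant_error; rewrite (le_trans (pcoord_le _ _))// (le_trans (CXP j 0 _)) ?lexx//.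
  rewrite (le_trans _ nk)// (le_trans _ (Cn j))//.
  by have := CX0 j; have := CF0 j; lra.
(* The velocity equation bounds an increment of the noise by the trajectory, the force and the
   defect. *)
have incr j l c : (l < s n)%N -> `|(b j (u l.+1) - b j (u l)) ord0 c| <= (k n)%:R.
  move=> ls; rewrite (le_trans (rV_coord_le _ _))//.
  set D := b j _ - _; pose F := h n *: force (X ^~ (u l)) j.
  have -> : D = (X j (u l.+1)).2 - (X j (u l)).2 - F -
     ((X j (u l.+1)).2 - (X j (u l)).2 - F - D) by rewrite opprB addrC subrK.
  rewrite (le_trans (ler_normB _ _))// (le_trans (lerD (ler_normB _ _) (vel j l ls)))//.
  rewrite (le_trans (lerD (lerD (ler_normB _ _) (lexx _)) (lexx _)))//.
  have FC : `|F| <= CF j.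
    rewrite /F normrZ (ger0_norm h0) (le_trans (ler_piMl _ h1))//.
    exact: (CFP j _ (ult _ (ltnW ls))).
  have XC l' : (l' <= s n)%N -> `|(X j (u l')).2| <= CX j.
    by move=> ls'; apply: le_trans (CXP j _ (ult _ ls')); exact: phase_norm2.
  have := XC _ ls; have := XC _ (ltnW ls); have := ler_piMl Le0 h1.
  have := Cn j; lra.
have noise j l : (l < s n)%N -> `|decoded_noise (y n j) l - (b j (u l.+1) - b j (u l))| <= K.
  move=> ls; rewrite /decoded_noise insubT; apply: rV_norm_le => // c.
  have := quant_error (incr j l c ls); rewrite /y !mxE !ffunE /= ?ffunE /= !mxE.
  exact.
have pos' l j : (l < s n)%N ->
    `|(X j (u l.+1)).1 - (X j (u l)).1 - h n *: (X j (u l)).2| <= h n * (L * eta) + K.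
  by move=> ls; rewrite (le_trans (pos j l ls))// lerDl.
have vel' l j : (l < s n)%N -> `|(X j (u l.+1)).2 - (X j (u l)).2 - h n *: force (X ^~ (u l)) j -
    decoded_noise (y n j) l| <= h n * (L * eta) + K.
  move=> ls; set D := decoded_noise _ _.
  rewrite -(subrKA (b j (u l.+1) - b j (u l))).
  by rewrite (le_trans (ler_normD _ _))// lerD ?vel// distrC noise.
have := euler_error kappa0 gam0 a0 M0 gM h0 init pos' vel' i.
rewrite [u (s n)]sh distrC => /le_trans; apply.
have powE : (1 + h n * L) ^+ s n <= E.
  rewrite /E -(sh n) mulrAC expRM_natr lerXn2r ?nnegrE ?expR_ge0 ?addr_ge0 ?mulr_ge0//.
  exact: expR_ge1Dx.
have sK : (1 + (s n)%:R) * K <= 2 / n.+1%:R.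
  rewrite /K ler_pdivrMr// mulrAC ler_pdivlMr// nat1r -!natrM ler_nat.
  rewrite (leq_trans (leq_mul (s_le n : (s n).+1 <= n.+2)%N (leqnn n.+1)))//.
  by rewrite /k expnS expn1 mulSn mul2n -addnn leq_add// leqW// leq_pmulr.
have E2 : E * (2 / n.+1%:R) <= e / 2.
  rewrite mulrA ler_pdivrMr// mulrAC ler_pdivlMr// -mulrA -natrM -ler_pdivrMl//.
  by rewrite mulrC (le_trans En)// ler_nat.
apply: (@le_trans _ _ (E * ((1 + (s n)%:R) * K + t * (L * eta)))).
  rewrite (_ : K + _ = (1 + (s n)%:R) * K + t * (L * eta)); last by rewrite -(sh n); ring.
  apply: ler_wpM2r powE.
  exact: addr_ge0 (mulr_ge0 (addr_ge0 ler01 (ler0n _ _)) K0) (mulr_ge0 t0 Le0).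
rewrite mulrDr [e]splitr lerD// (le_trans _ E2)//; apply: ler_wpM2l => //; exact: ltW.
Unshelve. all: by end_near. Qed.

End pathwise_convergence.

Lemma grad_quadratic_potential (R : realType) d (a : R) (x : 'rV[R]_d) :
  grad (quadratic_potential a) x = a *: x.
Proof.
apply/rowP => j; rewrite !mxE /derive; apply/cvg_lim => //.
have cv : (fun h : R => 2^-1 * a * (2 * x ord0 j + h)) @ 0^' --> a * x ord0 j.
  have -> : a * x ord0 j = 2^-1 * a * (2 * x ord0 j + 0) by rewrite addr0; field.
  apply: cvgMr; apply: cvgD; first exact: cvg_cst.
  exact: (cvg_within (F := nbhs (0 : R))).
apply: cvg_trans cv; apply: near_eq_cvg; near=> h.
have h0 : h != 0 by near: h; exact: nbhs_dnbhs_neq.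
rewrite /quadratic_potential -mulrBr -sumrB (bigD1 j)//= big1 => [|i ij]; last first.
  by rewrite !mxE (negbTE ij) andbF mulr0 add0r subrr.
rewrite !mxE !eqxx mulr1 addr0 /GRing.scale /=.
by field.
Unshelve. all: by end_near. Qed.

Lemma fd_bound_le (R : realType) (V : normedModType R) (l : nat) (M : R) (f : V -> R) :
  fd_bound l M f -> forall x, `|f x| <= M.
Proof. by move=> fM x; have := fM [::] x (leq0n _); rewrite /= big_nil mulr1. Qed.

Lemma fd_bound_lipschitz (R : realType) (V : normedModType R) (l : nat) (M : R) (f : V -> R) :
  (0 < l)%N -> fd_bound l M f -> forall x y, `|f x - f y| <= M * `|x - y|.
Proof.
move=> l0 fM x y; have := fM [:: x - y] y l0.
by rewrite big_seq1 /= /step_diff [y + _]addrC subrK.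
Qed.

Section bounded_convergence.
Context {R : realType} {dsp : measure_display} {Omega : measurableType dsp}.
Variable P : probability Omega R.

Lemma bounded_convergence (F : nat -> Omega -> R) (f : Omega -> R) (C : R) :
  (forall n, measurable_fun setT (F n)) -> measurable_fun setT f ->
  (forall n w, `|F n w| <= C) -> {ae P, forall w, F ^~ w @ \oo --> f w} ->
  (fun n => \int[P]_w F n w) @ \oo --> \int[P]_w f w.
Proof.
move=> mF mf FC Ff.
have iC : P.-integrable setT (EFin \o cst C) by exact: finite_measure_integrable_cst.
have mF' n : measurable_fun setT (fun w => (F n w)%:E) by exact/measurable_EFinP.
have mf' : measurable_fun setT (fun w => (f w)%:E) by exact/measurable_EFinP.
have Ff' : {ae P, forall w, setT w -> (fun n => (F n w)%:E) @ \oo --> (f w)%:E}.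
  by apply: filterS Ff => w Fw _; apply: cvg_EFin => //; exact: nearW.
have FC' : {ae P, forall w n, setT w -> (`|(F n w)%:E| <= (EFin \o cst C) w)%E}.
  by apply: aeW => w n _; rewrite lee_fin.
have [if_ _ cv] := dominated_convergence measurableT mF' mf' Ff' iC FC'.
apply: fine_cvg; rewrite fineK //; exact: integrable_fin_num.
Qed.

End bounded_convergence.

Lemma time_steps (R : realType) (t : R) : 0 <= t -> exists (s : nat -> nat) (h : nat -> R),
  [/\ forall n, 0 < h n, h @ \oo --> 0, forall n, h n * (s n)%:R = t & forall n, (s n <= n.+1)%N].
Proof.
rewrite le_eqVlt => /predU1P[<-|t0].
  (* At t = 0 the scheme takes no step, yet [h] must stay positive and tend to 0. *)
  exists (fun=> 0%N), (@harmonic R); split=> //.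
  - by move=> n; rewrite /harmonic /= invr_gt0.
  - exact: cvg_harmonic.
  - by move=> n; rewrite mulr0.
exists succn, (fun n => t * harmonic n); split=> //.
- by move=> n; rewrite mulr_gt0// /harmonic /= invr_gt0.
- by rewrite -[X in _ --> X](mulr0 t); apply: cvgMr; exact: cvg_harmonic.
- by move=> n; rewrite /harmonic divfK.
Qed.

Section langevin_cvg.
Context {R : realType} {d N m : nat} {dsp : measure_display} {Omega : measurableType dsp}.
Variable P : probability Omega R.
Variables (beta kappa a M : R) (W : 'rV[R]_d -> R).
Hypotheses (beta0 : 0 < beta) (kappa0 : 0 <= kappa) (a0 : 0 < a) (M0 : 0 <= M) (m0 : (0 < m)%N).
Hypothesis gW : forall c, fd_bound m M (fun x => grad W x ord0 c).
Variable mu0 : probability (phase R d) R.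
Variable B : 'I_N -> R -> {mfun Omega >-> 'rV[R]_d}.
Variable Z : 'I_N -> R -> {mfun Omega >-> phase R d}.
Hypothesis LZ : langevin P beta kappa W (quadratic_potential a) mu0 B Z.
Variables (t : R) (s : nat -> nat) (h : nat -> R).
Hypotheses (h_gt0 : forall n, 0 < h n) (h_cvg : h @ \oo --> 0).
Hypotheses (sh : forall n, h n * (s n)%:R = t) (s_le : forall n, (s n <= n.+1)%N).

Local Notation k n := (n.+1 ^ 2)%N.
Local Notation scheme n := (euler kappa (beta / 2) a (h n) (grad W)
  (@decoded_init R d (s n) (k n)) (@decoded_noise R d (s n) (k n)) (s n)).

Let inputs n w := codes_of (n := s n) B Z (h n) (quant (k n)) w.

Let gW_lipschitz x y : `|grad W x - grad W y| <= M * `|x - y|.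
Proof.
apply: rV_norm_le => [|c]; first by rewrite mulr_ge0.
by rewrite !mxE; have := fd_bound_lipschitz m0 (gW c) x y; rewrite !mxE.
Qed.

Lemma langevin_euler_cvg :
  {ae P, forall w, forall i, (fun n => scheme n (inputs n w) i) @ \oo --> Z i t w}.
Proof.
have drift_force i r w : drift beta kappa W (quadratic_potential a) Z i r w =
    force kappa (beta / 2) a (grad W) (fun j => Z j r w) i.
  by rewrite /drift grad_quadratic_potential.
have := langevin_continuous LZ; have := langevin_position LZ; have := langevin_velocity LZ.
apply: filterS3 => w vel pos cont i.
apply: (@euler_pathwise_cvg R d N kappa (beta / 2) a (grad W) M kappa0 _ (ltW a0) M0 gW_lipschitz
  (fun i r => Z i r w) (fun i r => B i r w) cont pos _ t s h h_gt0 h_cvg sh s_le i).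
  by rewrite divr_ge0// ltW.
move=> j r c r0; rewrite vel//; congr (_ + _ + _).
by apply: eq_Rintegral => r' _; rewrite drift_force.
Qed.

Section test_functions.
Variables (r : 'I_m -> 'I_N) (phi : 'I_m -> phase R d -> R) (M2 : R).
Hypotheses (cphi : forall j, continuous (phi j)) (phiM : forall j x, `|phi j x| <= M2).

(** [codes_mean] realizes the product mean on the space that carries the solution, so scheme and
    solution are coupled there and bounded convergence applies. *)
Lemma langevin_mean_cvg (S : {set 'I_m}) :
  (fun n => mean (input_prob (n := s n) mu0 (h n) (quant (k n)))
    (fun y => \prod_(j in S) phi j (scheme n y (r j)))) @ \oo -->
  \int[P]_w \prod_(j in S) phi j (Z (r j) t w).
Proof.
under eq_fun do rewrite -(codes_mean LZ (h_gt0 _) (@measurable_quant R _)).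
apply: (@bounded_convergence _ _ _ P _ _ (\prod_(j in S) M2)).
- move=> n; exact: (@finite_valued_measurable R _ _ _ (inputs n)
    (fun y => \prod_(j in S) phi j (scheme n y (r j)))
    (measurable_codes_of B Z (h n) (@measurable_quant R _))).
- under eq_fun do rewrite -big_enum /=; apply: measurable_prod => j _; apply: measurableT_comp; last exact: measurable_funPT.
  exact: continuous_measurable_phase.
- by move=> n w; rewrite normr_prod; apply: ler_prod => j _; rewrite normr_ge0 phiM.
apply: filterS langevin_euler_cvg => w cw.
apply: cvg_big => [|j _]; first exact: mul_continuous.
exact: (continuous_cvg _ (@cphi j _) (cw (r j))).
Qed.

End test_functions.
End langevin_cvg.

(** * Correlation functions *)

Lemma bounded_integrable (R : realType) (dsp : measure_display) (T : measurableType dsp)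
    (P : probability T R) (f : T -> R) (C : R) :
  measurable_fun setT f -> (forall x, `|f x| <= C) -> P.-integrable setT (EFin \o f).
Proof.
move=> mf fC; have C0 : 0 <= C by exact: le_trans (normr_ge0 _) (fC point).
have iC : P.-integrable setT (EFin \o cst C) by exact: finite_measure_integrable_cst.
apply: le_integrable iC => //; first exact/measurable_EFinP.
by move=> x _; rewrite /= lee_fin (ger0_norm C0).
Qed.

Section bounded_integrals.
Context {R : realType} {d1 d2 : measure_display} {T1 : measurableType d1} {T2 : measurableType d2}.

Lemma Rintegral_distribution (P : probability T1 R) (X : {mfun T1 >-> T2}) (f : T2 -> R) (C : R) :
  measurable_fun setT f -> (forall x, `|f x| <= C) ->
  \int[distribution P X]_y f y = \int[P]_w f (X w).
Proof.
move=> mf fC; rewrite /Rintegral integral_distribution//; first exact/measurable_EFinP.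
apply: (@bounded_integrable R _ _ P (f \o X) C) => [|x]; last exact: fC.
exact: measurableT_comp.
Qed.

Lemma Rintegral_product (P1 : probability T1 R) (P2 : probability T2 R) (f : T1 -> R) (g : T2 -> R)
    (C D : R) :
  measurable_fun setT f -> (forall x, `|f x| <= C) ->
  measurable_fun setT g -> (forall x, `|g x| <= D) ->
  \int[(P1 \x P2)%E]_z (f z.1 * g z.2) = (\int[P1]_x f x) * \int[P2]_y g y.
Proof.
move=> mf fC mg gD.
have imf := bounded_integrable P1 mf fC; have img := bounded_integrable P2 mg gD.
have ifg : ((P1 \x P2)%E : probability _ R).-integrable setT (EFin \o (fun z => f z.1 * g z.2)).
  apply: (@bounded_integrable R _ _ _ _ (C * D)) => [|z]; last by rewrite normrM ler_pM.
  by apply: measurable_funM; exact: measurableT_comp.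
rewrite {1}/Rintegral -(integral12_prod_meas1 ifg) /fubini_F /=.
have e x : (\int[P2]_y (f x * g y)%:E = (f x * \int[P2]_y g y)%:E)%E.
  under eq_integral do rewrite EFinM.
  by rewrite integralZl// EFinM fineK//; exact: integrable_fin_num.
under eq_integral do rewrite e mulrC.
under eq_integral do rewrite EFinM.
by rewrite integralZl// fineM//= 1?mulrC//; exact: integrable_fin_num.
Qed.

End bounded_integrals.

Section tensor_integral.
Context {R : realType} {d m : nat}.
Variable F : forall k : nat, probability (k.-tuple (phase R d)) R.
Variables (phi : 'I_m -> phase R d -> R) (M : R).
Hypotheses (mphi : forall j, measurable_fun setT (phi j)) (phiM : forall j x, `|phi j x| <= M).
Implicit Type S : {set 'I_m}.

(** The entries of [y] belong to the labels of [S] in the order of [enum S], the convention of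
    [set_block]. *)
Definition block_prod S (y : #|S|.-tuple (phase R d)) : R :=
  \prod_(i in S) phi i (nth 0 y (index i (enum S))).

Lemma measurable_block_prod S : measurable_fun setT (@block_prod S).
Proof.
rewrite /block_prod; under eq_fun do rewrite -big_enum /=.
by apply: measurable_prod => i _; apply: measurableT_comp => //; exact: measurable_nth.
Qed.

Lemma block_prod_le S y : `|@block_prod S y| <= \prod_(i in S) M.
Proof. by rewrite normr_prod; apply: ler_prod => i _; rewrite normr_ge0 phiM. Qed.

(** By disjointness, substituting one block leaves the variables of the others alone, so the
    integrand factorizes along the product measure. *)
Lemma tensor_Rintegral (bs : seq {set 'I_m}) :
  pairwise (fun S S' => [disjoint S & S']%B) bs ->
  \int[tensor F bs]_z (\prod_(j in (\bigcup_(S <- bs) S)%SET) phi j (tnth z j)) =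
  \prod_(S <- bs) \int[F #|S|]_y block_prod y.
Proof.
pose tail S (z : m.-tuple (phase R d)) := \prod_(j in S) phi j (tnth z j).
have mtail S : measurable_fun setT (tail S).
  rewrite /tail; under eq_fun do rewrite -big_enum /=.
  by apply: measurable_prod => i _; apply: measurableT_comp => //; exact: measurable_tnth.
have tailM S z : `|tail S z| <= \prod_(i in S) M.
  by rewrite normr_prod; apply: ler_prod => i _; rewrite normr_ge0 phiM.
elim: bs => [|S bs IH] /=.
  move=> _; rewrite !big_nil.
  under eq_Rintegral do rewrite big_set0.
  rewrite Rintegral_cst// mul1r; exact: (congr1 fine (probability_setT (tensor F [::]))).
move=> /andP[/allP Sbs pbs]; rewrite !big_cons -(IH pbs).
set U := (\bigcup_(S' <- bs) S')%SET.
have SU : [disjoint S & U]%B.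
  rewrite /U; elim: (bs) Sbs => [|S' bs' IHb] h; rewrite -finset.setI_eq0 ?big_nil ?finset.setI0// big_cons.
  have := h S' (mem_head _ _); rewrite -finset.setI_eq0 => /eqP SS'.
  rewrite finset.setIUr SS' finset.set0U finset.setI_eq0.
  by apply: IHb => S2 S2b; apply: h; rewrite inE S2b orbT.
rewrite -/(tail _) (Rintegral_distribution _ _ (mtail (S :|: U)%SET) (tailM (S :|: U)%SET)).
rewrite -(Rintegral_product _ _ (@measurable_block_prod S) (@block_prod_le S) (mtail U) (tailM U)).
apply: eq_Rintegral => -[y z] _ /=; rewrite /tail.
rewrite (eq_bigl [predU S & U]) => [|i]; last by rewrite !inE.
rewrite bigU//=; congr (_ * _).
  by apply: eq_bigr => i iS; rewrite tnth_mktuple iS.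
apply: eq_bigr => i iU; rewrite tnth_mktuple.
by rewrite (disjointFl SU iU).
Qed.

End tensor_integral.

Lemma correlation_Rintegral (R : realType) d N m (L : probability (N.-tuple (phase R d)) R)
    (phi : 'I_m -> phase R d -> R) (M : R) :
  (forall j, measurable_fun setT (phi j)) -> (forall j x, `|phi j x| <= M) ->
  signed_integral (correlation m L) (fun z => \prod_(j < m) phi j (tnth z j)) =
  log_set (fun S : {set 'I_m} => \int[marginal #|S| L]_y block_prod phi y) [set: 'I_m]%SET.
Proof.
move=> mphi phiM; rewrite /signed_integral /correlation big_map big_filter big_enum_cond /=.
apply: eq_bigr => Q /and3P[/eqP covQ /finset.trivIsetP tQ _]; rewrite /log_coef; congr (_ * _).
transitivity (\int[tensor (fun k => marginal k L) (enum Q)]_z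
    (\prod_(j in (\bigcup_(S <- enum Q) S)%SET) phi j (tnth z j))).
  apply: eq_Rintegral => z _; apply: eq_bigl => j.
  by rewrite big_enum -/(finset.cover Q) covQ finset.in_setT.
rewrite (tensor_Rintegral _ mphi phiM) ?big_enum//.
have : uniq (enum Q) by exact: enum_uniq.
have : {subset enum Q <= Q} by move=> S; rewrite mem_enum.
elim: (enum Q) => //= S s IH sQ /andP[Ss us]; apply/andP; split; last first.
  by apply: IH => // S' S's; apply: sQ; rewrite inE S's orbT.
apply/allP => S' S's; apply: tQ; first exact/sQ/mem_head.
  by apply: sQ; rewrite inE S's orbT.
by apply: contraNneq Ss => ->.
Qed.

Lemma seq_perm_extension N (u : seq 'I_N) : uniq u ->
  exists2 sigma : 'I_N -> 'I_N, injective sigma & forall k : 'I_N, (k < size u)%N -> sigma k = nth k u k.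
Proof.
move=> uu; pose s := u ++ [seq x <- enum 'I_N | x \notin u].
have us : uniq s.
  rewrite cat_uniq uu filter_uniq ?enum_uniq// andbT /=.
  by apply/hasPn => x; rewrite mem_filter => /andP[].
have sN : size s = N.
  rewrite -[RHS](size_enum_ord N); apply/perm_size/uniq_perm => //; first exact: enum_uniq.
  by move=> x; rewrite mem_cat mem_filter !mem_enum andbT orbN.
exists (fun k => nth k s k) => [i j|k ku]; last by rewrite nth_cat ku.
rewrite (set_nth_default i j) ?sN// => /eqP; rewrite nth_uniq ?sN// => /eqP.
exact: val_inj.
Qed.

(** * Invariance under relabelling of the particles *)

Section exchangeability.
Context {R : realType} {d N : nat} {T : finType}.
Variables (kappa gam a h : R) (g : 'rV[R]_d -> 'rV[R]_d).
Variables (z0 : T -> phase R d) (b : T -> nat -> 'rV[R]_d).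

Lemma euler_perm (sigma : 'I_N -> 'I_N) n (y : {ffun 'I_N -> T}) i : injective sigma ->
  euler kappa gam a h g z0 b n [ffun i => y (sigma i)] i = euler kappa gam a h g z0 b n y (sigma i).
Proof.
move=> sI; elim: n i => [|n IH] i /=; first by rewrite ffunE.
rewrite !IH ffunE; congr (_, _ + _ *: _ + _).
rewrite /force !IH; congr (- (_ *: _) - _ - _).
by rewrite [RHS](reindex_inj sI); apply: eq_bigr => j _; rewrite IH.
Qed.

Variable p : T -> R.
Variables (m n : nat) (phi : 'I_m -> phase R d -> R).

(* The particles carrying the labels of a block may be renumbered. *)
Lemma mean_block (S : {set 'I_m}) (r r' : 'I_m -> 'I_N) :
  injective r -> (forall j, j \in S -> r' j = index j (enum S) :> nat) ->
  mean p (fun y => \prod_(j in S) phi j (euler kappa gam a h g z0 b n y (r' j))) =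
  mean p (fun y => \prod_(j in S) phi j (euler kappa gam a h g z0 b n y (r j))).
Proof.
move=> rI r'S.
have [|sigma sI sE] := @seq_perm_extension N [seq r j | j <- enum S].
  by rewrite map_inj_uniq ?enum_uniq.
rewrite -(mean_perm _ _ sI); apply: eq_bigr => y _; congr (_ * _).
apply: eq_bigr => j jS; rewrite euler_perm// sE r'S// ?size_map ?index_mem ?mem_enum//.
by rewrite (nth_map j) ?index_mem ?mem_enum// nth_index ?mem_enum.
Qed.

End exchangeability.

Section langevin_correlation.
Context {R : realType} {d N m : nat} {dsp : measure_display} {Omega : measurableType dsp}.
Variable P : probability Omega R.
Variable Z : 'I_N -> R -> {mfun Omega >-> phase R d}.
Variables (phi : 'I_m -> phase R d -> R) (M2 : R) (t : R).
Hypotheses (cphi : forall j, continuous (phi j)) (phiM : forall j x, `|phi j x| <= M2).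

Let mphi j : measurable_fun setT (phi j).
Proof. exact: continuous_measurable_phase. Qed.

Lemma law_block (S : {set 'I_m}) (r : 'I_m -> 'I_N) :
  (forall j, j \in S -> r j = index j (enum S) :> nat) ->
  \int[marginal #|S| (law P Z t)]_y block_prod phi y =
  \int[P]_w \prod_(j in S) phi j (Z (r j) t w).
Proof.
move=> rS; have mb := @measurable_block_prod R d m phi mphi S.
have bM := @block_prod_le R d m phi M2 phiM S.
rewrite (Rintegral_distribution _ _ mb bM).
rewrite (Rintegral_distribution P (configuration Z t) (f := @block_prod R d m phi S \o first_particles #|S|) _
  (fun z => bM (first_particles #|S| z))); last first.
  by apply: measurableT_comp => //; exact: measurable_funPT.
apply: eq_Rintegral => w _ /=; apply: eq_bigr => j jS.
have jlt : (index j (enum S) < #|S|)%N by rewrite cardE index_mem mem_enum.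
congr (phi j _); rewrite -(tnth_nth 0 (first_particles #|S| _) (Ordinal jlt)) tnth_mktuple /= -rS//.
by rewrite -(tnth_nth 0 (configuration Z t w) (r j)) tnth_mktuple.
Qed.

Variables (beta kappa a M C h0 : R) (W : 'rV[R]_d -> R).
Hypotheses (beta0 : 0 < beta) (kappa0 : 0 <= kappa) (a0 : 0 < a) (M0 : 0 <= M) (m0 : (0 < m)%N).
Hypotheses (h00 : 0 < h0) (mN : (m <= N)%N).
Hypothesis gW : forall c, fd_bound m M (fun x => grad W x ord0 c).
Variable mu0 : probability (phase R d) R.
Variable B : 'I_N -> R -> {mfun Omega >-> 'rV[R]_d}.
Hypothesis LZ : langevin P beta kappa W (quadratic_potential a) mu0 B Z.
Hypothesis t0 : 0 <= t.
Hypothesis euler_bound : forall (T : finType) (p : T -> R) (h : R) (z0 : T -> phase R d)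
    (b : T -> nat -> 'rV[R]_d) (r : 'I_m -> 'I_N) (n : nat),
  injective r -> (forall e, 0 <= p e) -> \sum_e p e = 1 -> 0 <= h <= h0 ->
  `|log_set (fun S => mean p (fun y => \prod_(j in S)
      phi j (euler kappa (beta / 2) a h (grad W) z0 b n y (r j)))) [set: 'I_m]%SET| <= C.

Lemma correlation_bound :
  `|signed_integral (correlation m (law P Z t)) (fun z => \prod_(j < m) phi j (tnth z j))| <= C.
Proof.
rewrite (correlation_Rintegral _ mphi phiM).
have [s [h [h_gt0 h_cvg sh s_le]]] := time_steps t0.
pose r := widen_ord mN.
have rI : injective r by move=> i j /(congr1 (@nat_of_ord N)) /= ij; exact: val_inj.
pose r' (S : {set 'I_m}) j := insubd (r j) (index j (enum S)).
have r'S (S : {set 'I_m}) j : j \in S -> r' S j = index j (enum S) :> nat.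
  move=> jS; rewrite insubdK// -topredE /= (leq_trans _ mN)//.
  have : (index j (enum S) < #|S|)%N by rewrite cardE index_mem mem_enum.
  by move=> /leq_trans; apply; rewrite -[leqRHS](card_ord m) max_card.
have N0 : (0 < N)%N by exact: leq_trans mN.
pose q n := input_prob (n := s n) mu0 (h n) (quant (n.+1 ^ 2)).
pose E n (S : {set 'I_m}) (v : 'I_m -> 'I_N) := mean (q n) (fun y => \prod_(j in S)
  phi j (euler kappa (beta / 2) a (h n) (grad W)
    (@decoded_init R d (s n) (n.+1 ^ 2)) (@decoded_noise R d (s n) (n.+1 ^ 2)) (s n) y (v j))).
have cv : (fun n => log_set (fun S => E n S r) [set: 'I_m]%SET) @ \oo -->
    log_set (fun S : {set 'I_m} => \int[marginal #|S| (law P Z t)]_y block_prod phi y) [set: 'I_m]%SET.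
  apply: cvg_big => [|Q _]; first exact: add_continuous.
  apply: cvgMr; apply: cvg_big => [|S _]; first exact: mul_continuous.
  rewrite (@law_block S (r' S) (r'S S)) (_ : (fun n => E n S r) = fun n => E n S (r' S)).
    exact: (langevin_mean_cvg beta0 kappa0 a0 M0 m0 gW LZ h_gt0 h_cvg sh s_le).
  by apply/funext => n; apply/esym/mean_block => // j; exact: r'S.
apply: (ler_cvg_to (cvg_norm cv) (cvg_cst C)).
near=> n; apply: euler_bound => //.
- by move=> e; exact: input_prob_ge0.
- exact: (input_prob_sum LZ (h_gt0 n) (@measurable_quant R _)).
rewrite ltW//= (le_trans (ler_norm _))//; near: n.
by move/cvgrPdist_le : h_cvg => /(_ _ h00); under eq_near do rewrite sub0r normrN.
Unshelve. all: by end_near. Qed.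

End langevin_correlation.

Theorem theorem1p1 (R : realType) (m : nat) (hm : (2 <= m)%N) :
  exists l : nat, (0 < l)%N /\
  forall (d : nat) (beta a theta : R) (W : 'rV[R]_d -> R),
    (1 <= d)%N -> 0 < beta -> 0 < a -> 0 < theta ->
    smooth_bounded (@rV_dir R d) W -> (forall x, W x = W (- x)) ->
  exists kappa_m : R, 0 < kappa_m /\
  forall mu0 : probability (phase R d) R,
    (\int[mu0]_z (expR (enorm z `^ theta))%:E < +oo)%E ->
  exists C : R, 0 < C /\
  forall kappa : R, 0 <= kappa <= kappa_m ->
  forall N : nat, (m <= N)%N ->
  forall (dsp : measure_display) (Omega : measurableType dsp)
    (P : probability Omega R)
    (B : 'I_N -> R -> {mfun Omega >-> 'rV[R]_d})
    (Z : 'I_N -> R -> {mfun Omega >-> phase R d}),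
    langevin P beta kappa W (quadratic_potential a) mu0 B Z ->
  forall t : R, 0 <= t ->
    (neg_sobolev_norm l (correlation m (law P Z t))
      <= (C * N%:R ^ (1 - m%:Z))%:E)%E.
Proof.
have m0 : (0 < m)%N := ltnW hm.
(* A cumulant of order m uses differences of the test functions up to order m, hence this Sobolev
   index. *)
exists m; split=> // d beta a theta W _ beta0 a0 _ sW _.
have [M M0 gW] := smooth_bounded_grad_fd_bound m sW.
pose M2 : R := (1 + (d + d)%:R) ^+ m * 2.
have M20 : 0 <= M2 by rewrite mulr_ge0// exprn_ge0// addr_ge0.
have beta2 : 0 < beta / 2 by rewrite divr_gt0.
have [kappa0 [h0 [kappa00 h00 [C C0 HC]]]] := finite_cumulant_bound beta2 a0 M0 M20 gW.
exists kappa0; split=> // mu0 _; exists (C + 1); split; first by rewrite ltr_wpDl.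
move=> kappa kappaP N mN dsp Omega P B Z LZ t t0.
have N0 : (0 < N)%N by exact: leq_trans mN.
apply: ub_ereal_sup => _ [phi phiP <-]; rewrite lee_fin.
have phiM j : fd_bound m M2 (phi j) by have [cphi] := phiP j; exact: sobolev_fd_bound.
have := @correlation_bound R d N m dsp Omega P Z phi M2 t (fun j => (phiP j).1)
  (fun j => fd_bound_le (phiM j)) beta kappa a M (C * N%:R^-1 ^+ m.-1) h0 W.
have /andP[k0 _] := kappaP.
move=> /(_ beta0 k0 a0 M0 m0 h00 mN gW mu0 B LZ t0) bound.
apply: le_trans (ler_norm _) (le_trans (bound _) _).
  by move=> T p h z0 b r n rI p0 p1 hP; exact: HC.
rewrite (_ : 1 - m%:Z = - (m.-1)%:Z); last by rewrite -{1}(prednK m0) -addn1 PoszD opprD addrCA subrr addr0.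
by rewrite -exprnN -exprVn; apply: ler_wpM2r; [rewrite exprn_ge0// invr_ge0|rewrite lerDl].
Qed.
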